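(* Let $n\ge 3$, $q>1$, and let $(\mathbb{S}^n,g_0)$ be the round unit sphere. Let $f=f^{d,c}:\mathbb{S}^n\to[-1,1]$ be an isoparametric function obtained as the restriction to $\mathbb{S}^n$ of a Cartan–Münzner polynomial $F$ of degree $d$ on $\mathbb{R}^{n+1}$ with constant $c\le 0$. Consider the equation $$-\Delta_{g_0} u+\lambda u=\lambda u^q,\qquad u>0,\ \lambda>0,$$ on $f$-invariant functions $u$. For an integer $i\ge 1$ put $\mu_{di}=-di(n+di-1)$ and $\lambda_{di}=\frac{-\mu_{di}}{q-1}$, and let $s\mapsto (u^{d,c}_i(s),\lambda^{d,c}_i(s))$, $s\in(-\varepsilon,\varepsilon)$, be the smooth branch of nontrivial $f$-invariant solutions bifurcating from the trivial family $\lambda\mapsto(1,\lambda)$ at $(1,\lambda_{di})$, i.e. $u^{d,c}_i(0)=1$, $\lambda^{d,c}_i(0)=\lambda_{di}$, $u^{d,c}_i(s)\ne 1$ for $s\ne 0$, and $\frac{d u^{d,c}_i}{ds}(0)$ is a nonzero $f$-invariant eigenfunction of $-\Delta_{g_0}$ with eigenvalue $di(n+di-1)$. Then: (1) if $c=0$, then $\frac{d\lambda^{d,0}_i}{ds}(0)=0$ if and only if $i$ is odd; (2) if $c\neq 0$, then $\frac{d\lambda^{d,c}_i}{ds}(0)\ne 0$ for every $i\ge 1$.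
   Context: A Cartan–Münzner polynomial of degree $d$ is a homogeneous polynomial $F$ on $\mathbb{R}^{n+1}$ satisfying $|\nabla F|^2=d^2\|x\|^{2d-2}$ and $\Delta F=\frac12 c d^2\|x\|^{d-2}$ for a constant $c$; then $f=F|_{\mathbb{S}^n}$ takes values in $[-1,1]$ and satisfies $|\nabla f|^2=d^2(1-f^2)$, $\Delta f=-d(n+d-1)f+\frac12 cd^2$. (Here $d\in\{1,2,3,4,6\}$ and $c=m_2-m_1$ is the difference of multiplicities of principal curvatures of the isoparametric hypersurfaces.) Replacing $F$ by $-F$ changes $c$ to $-c$, so by convention $c\le 0$. A function $u$ on $\mathbb{S}^n$ is $f$-invariant if $u=\varphi\circ f$ for some function $\varphi$ on $[-1,1]$. The nonzero eigenvalues of $-\Delta_{g_0}$ restricted to $f$-invariant functions are exactly $di(n+di-1)$, $i\ge1$, each with one-dimensional eigenspace; bifurcation from these simple eigenvalues (Crandall–Rabinowitz) yields the branch in the statement. *)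

(* Defs.v *)
From HB Require Import structures.
From mathcomp Require Import all_boot all_order all_algebra.
From mathcomp Require Import all_classical all_reals all_analysis.
Set Implicit Arguments. Unset Strict Implicit. Unset Printing Implicit Defensive.
Import Order.TTheory GRing.Theory Num.Theory numFieldNormedType.Exports.
Local Open Scope ring_scope.

(* Functions on the unit sphere S^{m-1} of R^m are represented as functions
   on row vectors 'rV[R]_m, only their values on the sphere mattering. *)
Section Defs.
Variable R : realType.
Variable m : nat.
Local Notation V := 'rV[R]_m.

(* Euclidean squared norm and norm (the library's matrix norm is the sup norm) *)
Definition sqnorm (x : V) : R := \sum_(j < m) x ord0 j ^+ 2.
Definition enorm (x : V) : R := Num.sqrt (sqnorm x).
Definition on_sphere (x : V) : Prop := sqnorm x = 1.

Definition ebasis (j : 'I_m) : V := delta_mx ord0 j.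
Definition pderiv (g : V -> R) (j : 'I_m) : V -> R := fun x => 'D_(ebasis j) g x.
Definition gradsq (g : V -> R) (x : V) : R := \sum_(j < m) (pderiv g j x) ^+ 2.
Definition lap (g : V -> R) (x : V) : R := \sum_(j < m) pderiv (pderiv g j) j x.

Definition hom_ext (u : V -> R) : V -> R := fun y => u ((enorm y)^-1 *: y).
(* Laplace-Beltrami operator of the round sphere: the Euclidean Laplacian of
   the 0-homogeneous extension, evaluated on the sphere. *)
Definition sph_lap (u : V -> R) (x : V) : R := lap (hom_ext u) x.

Definition C2_away0 (g : V -> R) : Prop :=
  forall y : V, y != 0 ->
    {for y, continuous g} /\
    forall i j : 'I_m,
      [/\ derivable g y (ebasis i), {for y, continuous (pderiv g i)},
          derivable (pderiv g i) y (ebasis j)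
        & {for y, continuous (pderiv (pderiv g i) j)}].
Definition C2_sphere (u : V -> R) : Prop := C2_away0 (hom_ext u).

Definition hom_poly (d : nat) (F : V -> R) : Prop :=
  exists a : {ffun {ffun 'I_m -> 'I_d.+1} -> R},
    (forall al, a al != 0 -> (\sum_(j < m) (al j : nat))%N = d) /\
    forall x : V, F x = \sum_al a al * \prod_(j < m) x ord0 j ^+ al j.

Definition CM_poly (d : nat) (c : R) (F : V -> R) : Prop :=
  [/\ (0 < d)%N, hom_poly d F,
      forall x, gradsq F x = (d%:R) ^+ 2 * sqnorm x ^+ d.-1
    & forall x, x != 0 -> lap F x = c * (d%:R) ^+ 2 / 2 * enorm x `^ (d%:R - 2)].

Definition f_invariant (F : V -> R) (u : V -> R) : Prop :=
  exists phi : R -> R, forall x, on_sphere x -> u x = phi (F x).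

Definition sph_deriv0 (u : R -> V -> R) (w : V -> R) : Prop :=
  forall e : R, 0 < e -> exists2 del : R, 0 < del &
    forall s : R, 0 < `|s| < del -> forall x, on_sphere x ->
      `|(u s x - u 0 x) / s - w x| <= e.

End Defs.

Definition mu_di {R : realType} (n d i : nat) : R :=
  - ((d * i)%:R * (n%:R + (d * i)%:R - 1)).
Definition lambda_di {R : realType} (n d i : nat) (q : R) : R :=
  - mu_di n d i / (q - 1).

(* Main.v *)
(** Differentiating the equation twice along the branch and projecting onto the
    eigenfunction [Q_i(f)], where [Q_i] is a Jacobi polynomial, expresses
    lambda'(0) as a nonzero multiple of the coefficient of [Q_i] in the Jacobi
    expansion of [Q_i ^+ 2].  The square of a solution of a second order equation
    solves the symmetric-square equation, of third order, which turns into a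
    three-term recurrence for the expansion coefficients.  Run upward from the
    constant term, it shows that they are all positive if c < 0, and that exactly
    those of odd index vanish if c = 0.

    The reduction to one variable restricts everything to a great circle along
    which F is the sine of d times the arc length; its end points are found by
    minimizing the distance between the level sets F = -1 and F = 1.
    The positivity of both Jacobi exponents is a trace inequality for the Hessian
    of F at a minimum.  The projection uses no integration: the weighted
    Wronskian of two profiles vanishes at both ends and is therefore not monotone
    unless it is constant. *)

Require Import Defs.
From HB Require Import structures.
From mathcomp Require Import all_boot all_order all_algebra.
From mathcomp Require Import all_classical all_reals all_analysis.
From mathcomp Require Import ring lra zify.
Import Order.TTheory GRing.Theory Num.Theory numFieldNormedType.Exports.
Local Open Scope ring_scope.

Set Implicit Arguments.
Unset Strict Implicit.
Unset Printing Implicit Defensive.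

(** * Jacobi polynomials *)

(** In the variable $t=F$ the Laplacian becomes $d^2$ times $L=(1-t^2)D^2+(b-at)D$ with
    $a=(n+d-1)/d$ and $b=c/2$, and the eigenvalue $di(n+di-1)$ becomes $d^2\,i(i+a-1)$. What the
    geometry delivers to the analysis is $a>1$, $|b|<a$ and $b\le 0$. Two obstacles shape the proof.
    The branch is differentiable in $s$ only once, at $0$, so the equation cannot literally be
    differentiated twice: the projection is made at a fixed small $s$, where the equation is exact,
    with the power $q$ expanded to second order and the error kept below a strictly positive term.
    And profiles are known to be twice differentiable only for $-1<t<1$. At the ends the Wronskian
    argument asks for bounded $\varphi$ and $\varphi'$; the bound on $\varphi'$ comes from the fact
    that a differentiable function of $F$ has zero derivative where $F$ is extremal along the
    meridian. *)

Section Jacobi.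
Variable R : realFieldType.
Implicit Types (a b : R) (k i : nat).

(** Iterated raising operator of the Jacobi operator with classical parameters $\alpha,\beta$, where
    $a=\alpha+\beta+2$ and $b=\beta-\alpha$. The normalisation is not the classical one; it makes
    raising a plain formula whose only denominators $2j+a$ are positive. *)
Fixpoint jac a b k : {poly R} :=
  if k is j.+1 then
    - (1 - 'X^2) * (jac a b j)^`()
    + (j%:R + a - 1)%:P * ('X - (b / (2 * j%:R + a))%:P) * jac a b j
  else 1.

Definition jac_eig a k : R := k%:R * (k%:R + a - 1).

Definition jac_op a b (z : {poly R}) : {poly R} :=
  (1 - 'X^2) * z^`()^`() + (b%:P - a%:P * 'X) * z^`().

Lemma jac_ode a b k : 1 < a -> jac_op a b (jac a b k) = - (jac_eig a k)%:P * jac a b k.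
Proof.
move=> a1; rewrite /jac_op /jac_eig; elim: k => [|k IH] /=.
  by rewrite !derivC mul0r !mulr0 addr0 polyC0 oppr0 mul0r.
set y := jac a b k in IH *; set y1 := y^`() in IH *; set y2 := y1^`() in IH *.
have k0 : 2 * k%:R + a != 0 :> R.
  by rewrite gt_eqF// ltr_wpDl ?mulr_ge0// (lt_trans ltr01).
set e := b / _.
have be : b = (2 * k%:R + a) * e by rewrite /e; field.
have IH' := congr1 (@deriv R) IH.
rewrite !poly.derivE -/y1 -/y2 ?mul0r ?mulr0 ?sub0r ?subr0 ?addr0 ?add0r ?expr1 in IH'.
rewrite !poly.derivE -/y1 -/y2 ?mul0r ?mulr0 ?sub0r ?subr0 ?addr0 ?add0r ?expr1.
set y3 := y2^`() in IH' *.
rewrite be in IH IH' *.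
rewrite -[k.+1]addn1 natrD.
apply/eqP; rewrite -subr_eq0; apply/eqP.
move/eqP: IH; rewrite -subr_eq0 => /eqP IH; move/eqP: IH'; rewrite -subr_eq0 => /eqP IH'.
set ode := (X in X = 0) in IH; set ode' := (X in X = 0) in IH'.
(* The defect in degree [k.+1] is this combination of the equation of degree [k] and of its
   derivative. *)
transitivity (- (1 - 'X^2) * ode' + ((k%:R + a - 1)%:P * ('X - e%:P) + 2 * 'X) * ode); last first.
  by rewrite IH IH' !mulr0 addr0.
rewrite /ode /ode' /= expr0 mulr1n; ring.
Qed.

Definition jac_low a b k : R :=
  k%:R * (k%:R + a - 2) * (1 - (b / (2 * k%:R + a - 2)) ^+ 2).

(** Lowering undoes raising: after the raised polynomial is expanded, the difference of the two
    sides is a multiple of the Jacobi equation of degree [k.-1]. At [k = 0] both sides vanish. *)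
Lemma jac_lowering a b k : 1 < a ->
  (1 - 'X^2) * (jac a b k)^`() + k%:R%:P * ('X + (b / (2 * k%:R + a - 2))%:P) * jac a b k
  = (jac_low a b k)%:P * jac a b k.-1.
Proof.
move=> a1; case: k => [|k] /=.
  by rewrite /jac_low !mul0r derivC mulr0 addr0.
have := jac_ode b k a1; rewrite /jac_low /jac_op /jac_eig.
set y := jac a b k; set y1 := y^`(); set y2 := y1^`() => IH.
have k0 : 2 * k%:R + a != 0 :> R.
  by rewrite gt_eqF// ltr_wpDl ?mulr_ge0// (lt_trans ltr01).
have -> : 2 * k.+1%:R + a - 2 = 2 * k%:R + a by rewrite -[k.+1]addn1 natrD; ring.
set e := b / _.
have be : b = (2 * k%:R + a) * e by rewrite /e; field.
rewrite !poly.derivE -/y1 -/y2 ?mul0r ?mulr0 ?sub0r ?subr0 ?addr0 ?add0r ?expr1.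
rewrite be in IH *.
rewrite -[k.+1]addn1 natrD.
apply/eqP; rewrite -subr_eq0; apply/eqP.
move/eqP: IH; rewrite -subr_eq0 => /eqP IH.
set ode := (X in X = 0) in IH.
transitivity (- (1 - 'X^2) * ode); last by rewrite IH mulr0.
rewrite /ode /=; ring.
Qed.

(** Here [|b| < a] enters the algebra: it keeps the shift $b/(2k+a-2)$ strictly between $-1$ and
    $1$. *)
Lemma jac_low_gt0 a b k : 1 < a -> `|b| < a -> (0 < k)%N -> 0 < jac_low a b k.
Proof.
move=> a1 ba; case: k => // k _; rewrite /jac_low.
have -> : 2 * k.+1%:R + a - 2 = 2 * k%:R + a by rewrite -[k.+1]addn1 natrD; ring.
have k0 : 0 <= k%:R :> R by [].
have ka : 0 < 2 * k%:R + a by lra.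
have -> : k.+1%:R + a - 2 = k%:R + a - 1 by rewrite -[k.+1]addn1 natrD; ring.
rewrite !mulr_gt0 ?ltr0n//; first by lra.
rewrite subr_gt0 -real_normK ?num_real// expr_lt1// normrM normfV (gtr0_norm ka).
by rewrite ltr_pdivrMr// mul1r (lt_le_trans ba)// lerDr mulr_ge0.
Qed.

(** Raising multiplies the leading coefficient by $k+(k+a-1)$, the first summand coming from
    $t^2y'$. *)
Lemma jac_size_coef a b k : 1 < a ->
  (size (jac a b k) <= k.+1)%N /\ 0 < (jac a b k)`_k.
Proof.
move=> a1; elim: k => [|k [IHs IHc]] /=; first by rewrite size_poly1 coef1.
set y := jac a b k in IHs IHc *; set e := b / _.
have E j : (- (1 - 'X^2) * y^`() + (k%:R + a - 1)%:P * ('X - e%:P) * y)`_j.+1 =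
  - y`_j.+2 *+ j.+2 + (if j is l.+1 then y`_j *+ j else 0) + (k%:R + a - 1) * (y`_j - e * y`_j.+1).
  have -> : - (1 - 'X^2) * y^`() + (k%:R + a - 1)%:P * ('X - e%:P) * y =
    'X^2 * y^`() - y^`() + ((k%:R + a - 1)%:P * ('X * y) - (k%:R + a - 1)%:P * (e%:P * y)) by ring.
  rewrite coefD !coefB !coefCM coefXM coefXnM !coef_deriv /=.
  by case: j => [|l] /=; rewrite ?subn2 /= ?coef_deriv ?mulNrn; ring.
split.
  apply/leq_sizeP => -[//|j] kj; rewrite E.
  have h l : (k < l)%N -> y`_l = 0 by move=> kl; rewrite nth_default// (leq_trans IHs).
  rewrite !h; [|lia..].
  by case: {E kj}j h => [|l] h; rewrite ?mul0rn; ring.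
rewrite E.
have h l : (k < l)%N -> y`_l = 0 by move=> kl; rewrite nth_default// (leq_trans IHs).
rewrite (h k.+1)// (h k.+2)// oppr0 mul0rn add0r mulr0 subr0.
have -> : (if k is _.+1 then y`_k *+ k else 0) = k%:R * y`_k.
  by case: (k) => [|l]; rewrite ?mul0r// mulr_natl.
by rewrite -mulrDl mulr_gt0//; have : 0 <= k%:R :> R by []; lra.
Qed.

Lemma jac_free a b (c : nat -> R) N : 1 < a ->
  \sum_(k < N) (c k)%:P * jac a b k = 0 -> forall k, (k < N)%N -> c k = 0.
Proof.
move=> a1; elim: N => // N IH; rewrite big_ord_recr /= => S.
have cN : c N = 0.
  have [_ pos] := jac_size_coef b N a1.
  have := congr1 (fun z : {poly R} => z`_N) S.
  rewrite coefD coef_sum big1 ?add0r => [|j _]; last first.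
    rewrite coefCM nth_default ?mulr0//.
    by have [+ _] := jac_size_coef b j a1; move=> /leq_trans; apply.
  by rewrite coefCM coef0 => /eqP; rewrite mulf_eq0 (gt_eqF pos) orbF => /eqP.
move: S; rewrite cN polyC0 mul0r addr0 => /IH h k.
by rewrite ltnS leq_eqVlt => /predU1P[->//|/h].
Qed.

Lemma jac_span a b N (z : {poly R}) : 1 < a -> (size z <= N)%N ->
  exists c : nat -> R, z = \sum_(k < N) (c k)%:P * jac a b k.
Proof.
move=> a1; elim: N z => [|N IH] z sz.
  by exists (fun=> 0); rewrite big_ord0; apply/eqP; rewrite -size_poly_eq0 -leqn0.
have [sN pos] := jac_size_coef b N a1.
set l := z`_N / (jac a b N)`_N.
have [|c hc] := IH (z - l%:P * jac a b N).
  apply/leq_sizeP => j; rewrite leq_eqVlt coefB coefCM => /predU1P[<-|Nj].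
    by rewrite /l; field; rewrite gt_eqF.
  by rewrite !nth_default ?mulr0 ?subr0// (leq_trans _ Nj).
exists (fun k => if (k == N)%N then l else c k).
rewrite big_ord_recr /= eqxx -[LHS](subrK (l%:P * jac a b N)) hc; congr (_ + _).
by apply: eq_bigr => j _; rewrite ltn_eqF.
Qed.

End Jacobi.

(** * The square of a Jacobi polynomial in the Jacobi basis *)

Section JacobiSquare.
Variable R : realFieldType.
Variables (a b : R) (i : nat).
Hypotheses (a1 : 1 < a) (ba : `|b| < a).
Local Notation Q := (jac a b).
Local Notation nu := (jac_eig a).

(** Symmetric square of the Jacobi equation with eigenvalue [nu i]. For $z=y^2$ one has $Lz+2\nu
    z=2(1-t^2)y'^2$; a further differentiation eliminates $y'^2$. The third-order operator is
    written through $L$ because $L$ acts as a scalar on each [Q k]. *)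
Definition symsq_op (z : {poly R}) : {poly R} :=
  (1 - 'X^2) * (jac_op a b z)^`()
  + ((2 * b)%:P - (2 * a - 2)%:P * 'X) * (jac_op a b z + (2 * nu i)%:P * z)
  + (4 * nu i)%:P * (1 - 'X^2) * z^`().

Lemma symsq_op_jac_sqr : symsq_op (Q i ^+ 2) = 0.
Proof.
have := jac_ode b i a1; rewrite /symsq_op /jac_op.
set y := Q i; set n := nu i; set y1 := y^`(); set y2 := y1^`() => IH.
have L : (1 - 'X^2) * ((y ^+ 2)^`())^`() + (b%:P - a%:P * 'X) * (y ^+ 2)^`()
    = 2%:P * ((1 - 'X^2) * y1 ^+ 2) - (2 * n)%:P * y ^+ 2.
  move/eqP: IH; rewrite -subr_eq0 => /eqP IH; apply/eqP; rewrite -subr_eq0; apply/eqP.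
  rewrite !poly.derivE -/y1 -/y2; transitivity (2 * y * (0 : {poly R})); last by rewrite mulr0.
  by rewrite -IH /= ?expr1; ring.
rewrite L !poly.derivE -/y1 -/y2 /=.
move/eqP: IH; rewrite -subr_eq0 => /eqP IH.
transitivity (4 * (1 - 'X^2) * y1 * ((1 - 'X^2) * y2 + (b%:P - a%:P * 'X) * y1 - - n%:P * y)); last by rewrite IH mulr0.
rewrite ?expr1 ?mulr1n; ring.
Qed.

Definition symsq_up k : R :=
  (k%:R + a - 1) * (2 * i%:R - k%:R) * (2 * i%:R + k%:R + 2 * a - 2).
Definition symsq_diag k : R :=
  (2 * nu i - nu k) * (2 * b * (2 * k%:R + a - 1)
     - (2 * a - 2) * ((k%:R + a - 1) * (b / (2 * k%:R + a)) - k%:R * (b / (2 * k%:R + a - 2))))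
  - (4 * nu i - nu k) * (k%:R * (k%:R + a - 1) * (b / (2 * k%:R + a - 2) + b / (2 * k%:R + a))).
Definition symsq_down k : R :=
  k%:R * ((2 * i%:R + a - 1) ^+ 2 - k%:R ^+ 2) * jac_low a b k.

(** With $L$ a scalar, only $(1-t^2)Q_k'$, $tQ_k$ and $Q_k$ remain. The raising and lowering
    formulas are a linear system for the first two, of determinant $2k+a-1$ up to sign; this is the
    factor on the left. *)
Lemma symsq_op_jac k : (2 * k%:R + a - 1)%:P * symsq_op (Q k) =
  - (symsq_up k)%:P * Q k.+1 + (symsq_diag k)%:P * Q k + (symsq_down k)%:P * Q k.-1.
Proof.
have -> : (symsq_down k)%:P * Q k.-1 =
    (k%:R * ((2 * i%:R + a - 1) ^+ 2 - k%:R ^+ 2))%:P * ((jac_low a b k)%:P * Q k.-1).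
  by rewrite mulrA -polyCM.
rewrite -jac_lowering//=.
rewrite /symsq_op jac_ode// /symsq_up /symsq_diag !poly.derivE.
set e := b / (2 * k%:R + a); set e' := b / (2 * k%:R + a - 2).
rewrite /jac_eig; set y := Q k; set y1 := y^`(); ring.
Qed.

Lemma symsq_op_sum N (c : nat -> R) :
  symsq_op (\sum_(k < N) (c k)%:P * Q k) = \sum_(k < N) (c k)%:P * symsq_op (Q k).
Proof.
elim: N => [|N IH].
  by rewrite !big_ord0 /symsq_op /jac_op !deriv0 !(mulr0, addr0, deriv0).
rewrite !big_ord_recr /= -IH /symsq_op /jac_op !derivD !poly.derivE; ring.
Qed.

(** The factor $2k+a-1$ of [symsq_op_jac] is built into the coefficients, so that the recurrence,
    read off by linear independence, has no denominators. *)
Lemma jac_sqr_expansion : exists c : nat -> R,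
  [/\ Q i ^+ 2 = \sum_(k < (2 * i).+1) (c k * (2 * k%:R + a - 1))%:P * Q k,
      symsq_down 1 * c 1%N = - symsq_diag 0 * c 0%N
    & forall m, (m < 2 * i)%N ->
        symsq_down m.+2 * c m.+2 = symsq_up m * c m - symsq_diag m.+1 * c m.+1].
Proof.
have k0 k : 0 < 2 * k%:R + a - 1 by have := a1; have : 0 <= k%:R :> R by []; lra.
have [|c0 hc0] := @jac_span R a b (2 * i).+1 (Q i ^+ 2) a1.
  apply: leq_trans (size_poly_exp_leq _ _) _; rewrite ltnS mulnC leq_mul2l.
  by have [+ _] := jac_size_coef b i a1; case: (size _) => [|n] // .
set N := (2 * i).+1 in hc0 *.
(* Continued by zero beyond degree [2 * i], so that the sums shifted by raising and lowering get a
   common range. *)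
pose c k := if (k < N)%N then c0 k / (2 * k%:R + a - 1) else 0.
have hc : Q i ^+ 2 = \sum_(k < N) (c k * (2 * k%:R + a - 1))%:P * Q k.
  rewrite hc0; apply: eq_bigr => k _; rewrite /c ltn_ord divfK//.
  by rewrite gt_eqF.
have cN k : (N <= k)%N -> c k = 0 by rewrite /c ltnNge => ->.
pose up m := if m is j.+1 then symsq_up j * c j else 0.
(* One term more than in the expansion, since raising reaches degree [N]. *)
have S : \sum_(m < N.+1)
    (- up m + symsq_diag m * c m + symsq_down m.+1 * c m.+1)%:P * Q m = 0.
  transitivity (symsq_op (Q i ^+ 2)); last exact: symsq_op_jac_sqr.
  rewrite hc (symsq_op_sum _ (fun k => c k * (2 * k%:R + a - 1))).
  transitivity (\sum_(k < N) (c k)%:P *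
    (- (symsq_up k)%:P * Q k.+1 + (symsq_diag k)%:P * Q k + (symsq_down k)%:P * Q k.-1)); last first.
    by apply: eq_bigr => k _; rewrite (polyCM (c k)) -[RHS]mulrA symsq_op_jac.
  under eq_bigr do rewrite 2!polyCD 2!mulrDl.
  under [RHS]eq_bigr do rewrite 2!mulrDr.
  rewrite !big_split /=; congr (_ + _ + _).
  - rewrite big_ord_recl /= oppr0 mul0r add0r; apply: eq_bigr => k _.
    by rewrite !add0n; ring.
  - rewrite big_ord_recr /= cN// mulr0 mul0r addr0; apply: eq_bigr => k _; ring.
  - transitivity (\sum_(k < N.+2) (c k)%:P * ((symsq_down k)%:P * Q k.-1)).
      rewrite [RHS]big_ord_recl /= {2}/symsq_down !mul0r mulr0 add0r.
      by apply: eq_bigr => k _; rewrite !add0n; ring.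
    by rewrite !big_ord_recr /= (cN N)// (cN N.+1)// polyC0 !mul0r !addr0.
have E m : (m < N.+1)%N -> - up m + symsq_diag m * c m + symsq_down m.+1 * c m.+1 = 0.
  exact: (jac_free (c := fun m => - up m + symsq_diag m * c m + symsq_down m.+1 * c m.+1) a1 S).
exists c; split=> // [|m mi].
  by have := E 0%N isT; rewrite /=; lra.
by have := E m.+1 (leq_trans mi (leqnSn _)); rewrite /=; lra.
Qed.

Lemma symsq_down_gt0 k : (0 < k <= 2 * i)%N -> 0 < symsq_down k.
Proof.
have a1' := a1.
move=> /andP[k0 ki]; rewrite /symsq_down; apply: mulr_gt0; last exact: jac_low_gt0.
have : k%:R <= 2 * i%:R :> R by rewrite -natrM ler_nat.
have : 0 < k%:R :> R by rewrite ltr0n.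
by move=> h1 h2; rewrite subr_sqr !mulr_gt0 //; lra.
Qed.

Lemma symsq_up_gt0 k : (k < 2 * i)%N -> 0 < symsq_up k.
Proof.
have a1' := a1.
move=> ki.
have : k%:R < 2 * i%:R :> R by rewrite -natrM ltr_nat.
have : 0 <= k%:R :> R by [].
by move=> h1 h2; rewrite /symsq_up !mulr_gt0//; lra.
Qed.

(** For [k >= 1] the sign is that of $b$ times $4NX-3X^2+(a-2)(2N-X)$, with $X=\nu_k\le N=\nu_i$. As
    $a-2>-1$, this is at least $4NX-3X^2-2N+X$, which increases with $N$ and equals $X(X-1)>0$ at
    $N=X$. *)
Lemma symsq_diag_lt0 k : b < 0 -> (k < i)%N -> symsq_diag k < 0.
Proof.
have a1' := a1.
move=> b0 ki.
have kn : 0 <= k%:R :> R by [].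
have iR : k%:R + 1 <= i%:R :> R by rewrite natr1 ler_nat.
have Nb : 0 < - b by lra.
have XN : nu k <= nu i by rewrite /jac_eig ler_pM//; lra.
(* At [k = 0] the denominator $2k+a-2$ may vanish, but its quotients carry the factor [k]. *)
case: k ki kn iR XN => [|k] ki kn iR XN.
  have -> : symsq_diag 0 = b * (4 * nu i * (a - 1) / a).
    by rewrite /symsq_diag /jac_eig mulr0n !mul0r !(mulr0, add0r, subr0); field; lra.
  have nu0 : 0 < nu i by rewrite /jac_eig mulr_gt0; lra.
  by rewrite nmulr_rlt0// divr_gt0 ?mulr_gt0//; lra.
have k1 : 1 <= k.+1%:R :> R by rewrite ler1n.
have D0 : 0 < (2 * k.+1%:R + a - 2) * (2 * k.+1%:R + a) by apply: mulr_gt0; lra.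
have -> : symsq_diag k.+1 = b * (2 * (2 * k.+1%:R + a - 1)) *
    (4 * nu i * nu k.+1 - 3 * nu k.+1 ^+ 2 + (a - 2) * (2 * nu i - nu k.+1))
    / ((2 * k.+1%:R + a - 2) * (2 * k.+1%:R + a)).
  by rewrite /symsq_diag /jac_eig; field; apply/andP; split; lra.
rewrite pmulr_llt0 ?invr_gt0// -mulrA nmulr_rlt0// mulr_gt0//; first lra.
have : a <= nu k.+1 by rewrite /jac_eig; nra.
move: XN; set X := nu k.+1; set N := nu i => XN aX.
apply: (@lt_le_trans _ _ (4 * N * X - 3 * X ^+ 2 - (2 * N - X))); last by nra.
by nra.
Qed.

Variable c : nat -> R.
Hypothesis c_1 : symsq_down 1 * c 1%N = - symsq_diag 0 * c 0%N.
Hypothesis c_rec : forall m, (m < 2 * i)%N ->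
  symsq_down m.+2 * c m.+2 = symsq_up m * c m - symsq_diag m.+1 * c m.+1.

(** Both contributions to the right side of the recurrence are positive as long as the diagonal
    coefficient is negative, which holds below index [i]: just enough to reach [c i], the
    coefficient that governs the slope. *)
Lemma jac_sqr_coef_gt0 : b < 0 -> 0 < c 0%N -> forall k, (k <= i)%N -> 0 < c k.
Proof.
move=> b0 c0; elim/ltn_ind => -[//|[|k]] IH ki.
  by rewrite -(pmulr_rgt0 _ (symsq_down_gt0 (k := 1) _)) ?c_1;
    [rewrite mulr_gt0// oppr_gt0 symsq_diag_lt0|lia].
rewrite -(pmulr_rgt0 _ (symsq_down_gt0 (k := k.+2) _)); last by lia.
rewrite c_rec; last by lia.
rewrite subr_gt0; apply: (@lt_trans _ _ 0).
  by rewrite nmulr_rlt0 ?symsq_diag_lt0//; apply: IH => //; lia.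
by rewrite mulr_gt0 ?symsq_up_gt0//; [lia|apply: IH; lia].
Qed.

Lemma symsq_diag_b0 k : b = 0 -> symsq_diag k = 0.
Proof. by move=> b0; rewrite /symsq_diag b0 !(mul0r, mulr0, addr0, subr0). Qed.

(** Without diagonal term the recurrence links indices two apart; the odd chain starts from zero,
    the even one from [c 0]. *)
Lemma jac_sqr_coef_sym : b = 0 -> 0 < c 0%N -> forall k, (k <= 2 * i)%N ->
  if odd k then c k = 0 else 0 < c k.
Proof.
move=> b0 c0; elim/ltn_ind => -[//|[|k]] IH ki.
  apply/eqP; have /eqP := c_1; rewrite symsq_diag_b0// oppr0 mul0r mulf_eq0.
  by rewrite gt_eqF// symsq_down_gt0//; lia.
have := c_rec (m := k); rewrite symsq_diag_b0// mul0r subr0 /= negbK => E.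
have := IH k (leqnSn _) ltac:(lia); have D : 0 < symsq_down k.+2 by apply: symsq_down_gt0; lia.
case: (odd k) => ck.
  by move: E; rewrite ck mulr0 => /(_ ltac:(lia))/eqP; rewrite mulf_eq0 (gt_eqF D) => /eqP.
have ki2 : (k < 2 * i)%N by lia.
by rewrite -(pmulr_rgt0 _ D) E// mulr_gt0// symsq_up_gt0.
Qed.

(** The recurrence determines everything from [c 0]. Its vanishing would make $Q_i^2$ zero, which is
    how it gets excluded. *)
Lemma jac_sqr_coef0 : c 0%N = 0 -> forall k, (k <= 2 * i)%N -> c k = 0.
Proof.
move=> c0; elim/ltn_ind => -[//|[|k]] IH ki.
  apply/eqP; have /eqP := c_1; rewrite c0 mulr0 mulf_eq0.
  by rewrite gt_eqF// symsq_down_gt0//; lia.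
have D : 0 < symsq_down k.+2 by apply: symsq_down_gt0; lia.
have ki2 : (k < 2 * i)%N by lia.
have [ck ck1] : c k = 0 /\ c k.+1 = 0 by split; apply: IH; lia.
have := c_rec ki2; rewrite ck ck1.
by rewrite !mulr0 subr0 => /eqP; rewrite mulf_eq0 (gt_eqF D) => /eqP.
Qed.

End JacobiSquare.

Local Open Scope classical_set_scope.
Local Open Scope ring_scope.

(** * One-variable calculus *)

Section Calculus.
Variable R : realType.
Implicit Types (f g : R -> R) (x y t : R).

Lemma is_derive_continuous f x l : is_derive x 1 f l -> {for x, continuous f}.
Proof. by move=> [d _]; apply: differentiable_continuous; apply/derivable1_diffP. Qed.

Lemma MVT_is_derive f (f' : R -> R) x y : x < y ->
  (forall t, x <= t <= y -> is_derive t 1 f (f' t)) ->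
  exists2 c, x < c < y & f y - f x = f' c * (y - x).
Proof.
move=> xy df.
have [|t|c cxy E] := @MVT R f f' x y xy; last by exists c => //; move: cxy; rewrite in_itv.
  by move=> t; rewrite in_itv /= => /andP[/ltW xt /ltW ty]; apply: df; rewrite xt ty.
apply: continuous_in_subspaceT => z; rewrite inE /= in_itv /= => zxy.
exact: is_derive_continuous (df z zxy).
Qed.

Lemma is_derive_approx f x l : is_derive x 1 f l ->
  forall e, 0 < e -> exists2 del, 0 < del &
    forall h, `|h| < del -> `|f (x + h) - f x - l * h| <= e * `|h|.
Proof.
move=> [df <-] e e0.
move/cvgrPdist_le : (df) => /(_ e e0); rewrite near_withinE => -[/= del del0 H].
exists del => // h hd; have [->|h0] := eqVneq h 0.
  by rewrite addr0 subrr mulr0 subrr !normr0 mulr0.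
have := H h; rewrite /ball_ /= sub0r normrN => /(_ hd h0).
rewrite -/(derive f x 1) /= => K.
have -> : f (x + h) - f x - 'D_1 f x * h = - (('D_1 f x - h^-1 *: (f (h *: 1 + x) - f x)) * h).
  by rewrite /GRing.scale /= mulr1 (addrC h x); field.
by rewrite normrN normrM ler_wpM2r.
Qed.

Lemma is_derive_near_eq f g x l del : 0 < del ->
  (forall y, `|y - x| < del -> f y = g y) -> is_derive x 1 f l -> is_derive x 1 g l.
Proof.
move=> d0 fg; apply: near_eq_is_derive.
by exists del => //= y; rewrite /ball_ /= distrC => /fg.
Qed.

Lemma is_derive_unique f x (l l' : R) : is_derive x 1 f l -> is_derive x 1 f l' -> l = l'.
Proof. by move=> [_ <-] [_ <-]. Qed.

Lemma is_derive_comp1 f g x (l m : R) :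
  is_derive (g x) 1 f l -> is_derive x 1 g m -> is_derive x 1 (fun y => f (g y)) (l * m).
Proof. exact: is_derive1_comp. Qed.

Lemma is_derive_horner (p : {poly R}) x : is_derive x 1 (horner p) (p^`().[x]).
Proof.
by split; [exact: derivable_horner|rewrite derivE derive1E].
Qed.

Lemma ger0_is_derive_le (f f' : R -> R) (u v : R) :
  (forall t, u < t < v -> is_derive t 1 f (f' t)) ->
  (forall t, u < t < v -> 0 <= f' t) ->
  forall x y, u < x -> x <= y -> y < v -> f x <= f y.
Proof.
move=> df f0 x y ux; rewrite le_eqVlt => /predU1P[->//|xy] yv.
have [t /andP[xt ty]|c /andP[xc cy] E] := @MVT_is_derive f f' x y xy.
  by apply: df; rewrite (lt_le_trans ux xt) (le_lt_trans ty yv).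
rewrite -subr_ge0 E mulr_ge0 ?subr_ge0 ?(ltW xy)//.
by apply: f0; rewrite (lt_trans ux xc) (lt_trans cy yv).
Qed.

Lemma poly_root_itv_eq0 (p : {poly R}) :
  (forall t, -1 < t < 1 -> p.[t] = 0) -> p = 0.
Proof.
move=> p0; apply/eqP; apply: contraT => pn0.
pose s : seq R := [seq (k.+2%:R)^-1 | k <- iota 0 (size p)].
suff : (size s < size p)%N by rewrite size_map size_iota ltnn.
apply: max_poly_roots => //; last first.
  rewrite map_inj_uniq ?iota_uniq// => j k /(congr1 (@GRing.inv R)).
  by rewrite !invrK => /eqP; rewrite eqr_nat => /eqP[].
apply/allP => t /mapP[k _ ->]; rewrite /root p0//.
rewrite (@lt_trans _ _ 0)//= ?invf_lt1 ?ltr1n//.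
Qed.

End Calculus.

(** * The Jacobi weight and its vanishing at the ends *)

Section Weight.
Variable R : realType.
Implicit Types (A B e t : R).

(** For $A=(a-b)/2$ and $B=(a+b)/2$ this is $1-t^2$ times the orthogonality weight of the Jacobi
    polynomials, that is, the leading coefficient of the Jacobi operator in divergence form. It
    tends to zero at both ends exactly because $|b|<a$. *)
Definition jweight (A B t : R) : R := (1 - t) `^ A * (1 + t) `^ B.

Lemma jweight_gt0 (A B t : R) : -1 < t < 1 -> 0 < jweight A B t.
Proof. by move=> ?; rewrite mulr_gt0// powR_gt0//; lra. Qed.

Lemma is_derive_jweight (A B t : R) : -1 < t < 1 ->
  is_derive t 1 (jweight A B) (jweight A B t * (B * (1 - t) - A * (1 + t)) / (1 - t ^+ 2)).
Proof.
move=> t1; have p1 : 0 < 1 - t by lra. have p2 : 0 < 1 + t by lra.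
have l1 : is_derive t 1 (fun t : R => 1 - t) (- 1) by apply: is_derive_eq; ring.
have l2 : is_derive t 1 (fun t : R => 1 + t) 1 by apply: is_derive_eq; ring.
have d1 := is_derive_comp1 (is_derive1_powR A p1 : is_derive ((fun t => 1 - t) t) _ _ _) l1.
have d2 := is_derive_comp1 (is_derive1_powR B p2 : is_derive ((fun t => 1 + t) t) _ _ _) l2.
apply: is_derive_eq.
rewrite /GRing.scale /= /jweight.
have e1 : (1 - t) `^ (A - 1) = (1 - t) `^ A / (1 - t).
  by rewrite powRB ?powRr1// ?ltW//; apply/implyP => _; rewrite gt_eqF.
have e2 : (1 + t) `^ (B - 1) = (1 + t) `^ B / (1 + t).
  by rewrite powRB ?powRr1// ?ltW//; apply/implyP => _; rewrite gt_eqF.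
rewrite e1 e2; field.
have : 0 < (1 - t) * (1 + t) by rewrite mulr_gt0.
by move=> h; apply/and3P; split; lra.
Qed.

Lemma powR_small (A : R) e : 0 < A -> 0 < e ->
  exists2 del, 0 < del & forall x, 0 < x < del -> x `^ A < e.
Proof.
move=> A0 e0; have /cvgrPdist_lt/(_ e e0) := powR_cvg0 A0.
case=> /= del d0 H; exists del => // x /andP[x0 xd].
have := H x; rewrite /ball_ /= sub0r normrN gtr0_norm// => /(_ xd x0).
by rewrite sub0r normrN ger0_norm// powR_ge0.
Qed.

Lemma jweight_small A B e : 0 < A -> 0 < B -> 0 < e ->
  exists2 del, 0 < del & forall t, -1 < t < 1 -> 1 - del < `|t| -> jweight A B t < e.
Proof.
move=> A0 B0 e0.
have P2 C : 0 < (2 : R) `^ C by rewrite powR_gt0.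
have le2 C (x : R) : 0 < C -> 0 < x < 2 -> x `^ C <= 2 `^ C.
  by move=> C0 x2; rewrite ge0_ler_powR ?nnegrE//; lra.
have [d1 d10 H1] := powR_small A0 (divr_gt0 e0 (P2 B)).
have [d2 d20 H2] := powR_small B0 (divr_gt0 e0 (P2 A)).
exists (Num.min 1 (Num.min d1 d2)) => [|t t1]; first by rewrite !lt_min ltr01 d10.
rewrite /jweight; have [t0|t0] := leP 0 t.
  rewrite ger0_norm// => td.
  have : Num.min 1 (Num.min d1 d2) <= d1 by rewrite !ge_min lexx orbT.
  move=> ?; have /H1 : 0 < 1 - t < d1 by lra.
  rewrite ltr_pdivlMr// => h; apply: le_lt_trans h.
  by rewrite ler_wpM2l ?powR_ge0// le2//; lra.
rewrite ltr0_norm// => td.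
have : Num.min 1 (Num.min d1 d2) <= d2 by rewrite !ge_min lexx !orbT.
move=> ?; have /H2 : 0 < 1 + t < d2 by lra.
rewrite ltr_pdivlMr// => h; rewrite mulrC; apply: le_lt_trans h.
by rewrite ler_wpM2l ?powR_ge0// le2//; lra.
Qed.

Definition bounded_at_ends (f : R -> R) : Prop := exists C del : R, 0 < del /\ forall t, -1 < t < 1 -> 1 - del < `|t| -> `|f t| <= C.

(* [(1-t^2) g' + (b - a t) g] is the derivative of [jweight * g] up to a positive
   factor, and [jweight * g] vanishes at both ends. *)
Lemma first_order_ge0_eq0 (a b : R) (g g' : R -> R) : `|b| < a ->
  (forall t, -1 < t < 1 -> is_derive t 1 g (g' t)) -> bounded_at_ends g ->
  (forall t, -1 < t < 1 -> 0 <= (1 - t ^+ 2) * g' t + (b - a * t) * g t) ->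
  forall t, -1 < t < 1 -> g t = 0 /\ g' t = 0.
Proof.
move=> ba dg [C [del [del0 gC]]] g0.
have {}ba : - a < b < a by rewrite -ltr_norml.
pose A := (a - b) / 2; pose B := (a + b) / 2.
have A0 : 0 < A by rewrite /A; lra.
have B0 : 0 < B by rewrite /B; lra.
have p0 (t : R) : -1 < t < 1 -> 0 < 1 - t ^+ 2.
  by move=> t1; rewrite (_ : 1 - t ^+ 2 = (1 - t) * (1 + t)); [apply: mulr_gt0; lra|ring].
pose Y t := jweight A B t * g t.
pose Y' t := jweight A B t / (1 - t ^+ 2) * ((1 - t ^+ 2) * g' t + (b - a * t) * g t).
have dY t : -1 < t < 1 -> is_derive t 1 Y (Y' t).
  move=> t1; have := is_derive_jweight A B t1; have := dg t t1 => d1 d2.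
  apply: is_derive_eq; rewrite /GRing.scale /= /Y' /A /B.
  by field; have := p0 t t1; lra.
have Ymono x y : -1 < x -> x <= y -> y < 1 -> Y x <= Y y.
  apply: (ger0_is_derive_le dY) => t t1.
  by rewrite mulr_ge0 ?g0// divr_ge0 ?ltW ?p0// jweight_gt0.
have Ysmall e : 0 < e -> exists2 d, 0 < d <= 1 &
    forall t, -1 < t < 1 -> 1 - d < `|t| -> `|Y t| < e.
  move=> e0; have C0 : 0 < `|C| + 1 by rewrite ltr_wpDl.
  have [d d0 H] := jweight_small A0 B0 (divr_gt0 e0 C0).
  exists (Num.min 1 (Num.min d del)); first by rewrite !lt_min ltr01 d0 del0 ge_min lexx.
  move=> t t1 td.
  have td1 : 1 - d < `|t|.
    apply: le_lt_trans td; rewrite lerD2l lerN2 !ge_min lexx orbT//.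
  have td2 : 1 - del < `|t|.
    apply: le_lt_trans td; rewrite lerD2l lerN2 !ge_min lexx !orbT//.
  rewrite /Y normrM (gtr0_norm (jweight_gt0 _ _ t1)).
  have := H t t1 td1; rewrite ltr_pdivlMr//; apply: le_lt_trans.
  rewrite ler_wpM2l ?ltW ?jweight_gt0//.
  have := gC t t1 td2 ; have := ler_norm C; lra.
have Y0 t : -1 < t < 1 -> Y t = 0.
  move=> t1; have [//|Yn0] := eqVneq (Y t) 0.
  have Yt : 0 < `|Y t| by rewrite normr_gt0.
  have [d /andP[d0 d1] H] := Ysmall _ Yt.
  have /andP[tl tu] := t1.
  (* [Y] is nondecreasing and small near both ends: a positive value would persist to the right, a
     negative one to the left. *)
  have [Yp|Yn] := leP 0 (Y t).
    pose s := Num.max t (1 - d / 2).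
    have ts : t <= s by rewrite le_max lexx.
    have sd : 1 - d / 2 <= s by rewrite le_max lexx orbT.
    have s1 : s < 1 by rewrite gt_max tu; lra.
    have := H s; rewrite (ger0_norm (_ : 0 <= s)); last lra.
    move=> /(_ ltac:(lra) ltac:(lra)); rewrite (ger0_norm Yp) ltNge.
    by rewrite (le_trans (Ymono t s tl ts s1))// ler_norm.
  pose s := Num.min t (- (1 - d / 2)).
  have ts : s <= t by rewrite ge_min lexx.
  have sd : s <= - (1 - d / 2) by rewrite ge_min lexx orbT.
  have s1 : -1 < s by rewrite lt_min tl; lra.
  have := H s; rewrite (ler0_norm (_ : s <= 0)); last lra.
  move=> /(_ ltac:(lra) ltac:(lra)); rewrite (ltr0_norm Yn) ltNge.
  have := Ymono s t s1 ts tu; rewrite -(lerN2 (Y t)) => /le_trans -> //.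
  by rewrite -normrN ler_norm.
have gz t : -1 < t < 1 -> g t = 0.
  move=> t1; apply/eqP; have /eqP := Y0 t t1.
  by rewrite mulf_eq0 gt_eqF ?jweight_gt0.
move=> t t1; split; first exact: gz.
have d0 : 0 < Num.min (1 - t) (1 + t) by rewrite lt_min; lra.
apply: (is_derive_unique (dg t t1)).
apply: (is_derive_near_eq (f := fun=> 0) d0) => y.
rewrite lt_min ltr_norml => /andP[h1]; rewrite ltr_norml => h2.
by rewrite gz//; lra.
Qed.

End Weight.

(** * Uniqueness for the Jacobi equation; second-order expansion of powers *)

Section Ode.
Variable R : realType.

(** $e^{Mt}E$ is nondecreasing and $e^{-Mt}E$ nonincreasing; the first carries the zero to the left
    of [t0], the second to the right. *)
Lemma gronwall_eq0 (E E' : R -> R) (M u v t0 : R) : u < t0 < v ->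
  (forall t : R, u < t < v -> is_derive t 1 E (E' t)) ->
  (forall t : R, u < t < v -> 0 <= E t) ->
  (forall t : R, u < t < v -> `|E' t| <= M * E t) ->
  E t0 = 0 -> forall t : R, u < t < v -> E t = 0.
Proof.
move=> /andP[ut0 t0v] dE E0 EM Et0 t /andP[ut tv].
have dexp (c x : R) : is_derive x 1 (fun x => expR (c * x)) (expR (c * x) * c).
  have l : is_derive x 1 (fun x : R => c * x) c by apply: is_derive_eq; rewrite /GRing.scale /=; ring.
  exact: (is_derive_comp1 (is_derive_expR _ : is_derive ((fun x => c * x) x) _ _ _) l).
have dF (c x : R) : u < x < v ->
    is_derive x 1 (fun x => expR (c * x) * E x) (expR (c * x) * (E' x + c * E x)).
  move=> xuv; have d1 := dE x xuv; have d2 := dexp c x.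
  by apply: is_derive_eq; rewrite /GRing.scale /=; ring.
have bnd x : u < x < v -> - (M * E x) <= E' x <= M * E x.
  by move=> xuv; rewrite -ler_norml EM.
suff : E t <= 0 by move=> h; apply/eqP; rewrite eq_le h E0// ut.
have [tt|tt] := leP t t0.
  have := ger0_is_derive_le (dF M) _ ut tt t0v.
  rewrite Et0 mulr0 pmulr_rle0 ?expR_gt0//; apply => x xuv.
  by rewrite mulr_ge0 ?expR_ge0//; have := bnd x xuv; lra.
have dF' x : u < x < v ->
    is_derive x 1 (fun x => - (expR (- M * x) * E x)) (- (expR (- M * x) * (E' x + - M * E x))).
  by move=> xuv; have := dF (- M) x xuv => d; apply: is_deriveN.
have := ger0_is_derive_le dF' _ ut0 (ltW tt) tv.
rewrite Et0 mulr0 oppr0 oppr_ge0 pmulr_rle0 ?expR_gt0//; apply => x xuv.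
by rewrite -mulrN mulr_ge0 ?expR_ge0//; have := bnd x xuv; lra.
Qed.

(** In the derivative of the energy $(1-t^2)f'^2+\nu f^2$ the equation cancels the terms with $f''$
    and $f$ and leaves a multiple of $f'^2$. The comparison takes place on a compact interval
    $[-r,r]$, where $1-t^2$ stays away from zero. *)
Lemma ode_unique (a b nu : R) (f f1 f2 : R -> R) (t0 : R) : 0 < nu -> -1 < t0 < 1 ->
  (forall t : R, -1 < t < 1 -> is_derive t 1 f (f1 t) /\ is_derive t 1 f1 (f2 t)) ->
  (forall t : R, -1 < t < 1 -> (1 - t ^+ 2) * f2 t + (b - a * t) * f1 t + nu * f t = 0) ->
  f t0 = 0 -> f1 t0 = 0 -> forall t : R, -1 < t < 1 -> f t = 0.
Proof.
move=> nu0 t01 df ode ft0 f1t0 t t1.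
pose r := (1 + Num.max `|t| `|t0|) / 2.
have tm : `|t| <= Num.max `|t| `|t0| by rewrite le_max lexx.
have tm0 : `|t0| <= Num.max `|t| `|t0| by rewrite le_max lexx orbT.
have m1 : Num.max `|t| `|t0| < 1 by rewrite gt_max !ltr_norml; apply/andP.
have r1 : r < 1 by rewrite /r; lra.
have r0 : 0 <= r by rewrite /r; have := normr_ge0 t; lra.
have tr : - r < t < r by rewrite -ltr_norml /r; lra.
have tr0 : - r < t0 < r by rewrite -ltr_norml /r; lra.
have p0 : 0 < 1 - r ^+ 2.
  by rewrite (_ : 1 - r ^+ 2 = (1 - r) * (1 + r)); [apply: mulr_gt0; lra|ring].
have pr (x : R) : - r < x < r -> 1 - r ^+ 2 <= 1 - x ^+ 2.
  move=> xr; have : 0 <= (r - x) * (r + x) by apply: mulr_ge0; lra.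
  by rewrite -subr_sqr; lra.
pose E x := (1 - x ^+ 2) * f1 x ^+ 2 + nu * f x ^+ 2.
pose E' x := (2 * (a - 1) * x - 2 * b) * f1 x ^+ 2.
pose M := 2 * (`|a - 1| + `|b|) / (1 - r ^+ 2).
have Ege0 x : - r < x < r -> (1 - r ^+ 2) * f1 x ^+ 2 <= E x.
  move=> xr; rewrite /E; have := pr x xr; have := sqr_ge0 (f1 x); have := sqr_ge0 (f x).
  by nra.
have Ez : forall x, - r < x < r -> E x = 0.
  apply: (@gronwall_eq0 E E' M (- r) r t0) => // [x xr|x xr|x xr|].
  - have [d1 d2] : is_derive x 1 f (f1 x) /\ is_derive x 1 f1 (f2 x) by apply: df; lra.
    have := ode x ltac:(lra) => o.
    apply: is_derive_eq; rewrite /GRing.scale /= /E'.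
    have -> : 2 * (a - 1) * x - 2 * b = - 2 * x - 2 * (b - a * x) by ring.
    apply/eqP; rewrite -subr_eq0; apply/eqP.
    transitivity (2 * f1 x * ((1 - x ^+ 2) * f2 x + (b - a * x) * f1 x + nu * f x)).
      ring.
    by rewrite o mulr0.
  - by apply: le_trans (Ege0 x xr); rewrite mulr_ge0 ?sqr_ge0// ltW.
  - rewrite /E' normrM (ger0_norm (sqr_ge0 _)).
    apply: (@le_trans _ _ (2 * (`|a - 1| + `|b|) * f1 x ^+ 2)).
      rewrite ler_wpM2r ?sqr_ge0//.
      apply: (le_trans (ler_normB _ _)); rewrite !normrM (ger0_norm (_ : (0 : R) <= 2))//.
      have : `|x| <= 1 by rewrite ler_norml; lra.
      by have := normr_ge0 (a - 1); have := normr_ge0 x; nra.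
    rewrite /M -[X in X * E x]mulrA -!mulrA ler_wpM2l// ler_wpM2l ?addr_ge0//.
    by rewrite mulrC ler_pdivlMr// mulrC Ege0.
  - by rewrite /E f1t0 ft0 !expr0n /= !mulr0 addr0.
have h1 : 0 <= (1 - t ^+ 2) * f1 t ^+ 2 by rewrite mulr_ge0 ?sqr_ge0//; have := pr t tr; lra.
have h2 : 0 <= nu * f t ^+ 2 by rewrite mulr_ge0 ?sqr_ge0// ltW.
have h3 : nu * f t ^+ 2 = 0 by have := Ez t tr; rewrite /E; lra.
by move/eqP: h3; rewrite mulf_eq0 (gt_eqF nu0) sqrf_eq0 => /eqP.
Qed.

(** The derivative of the remainder is $q$ times the first-order remainder of $(1+h)^{q-1}$, hence
    $o(h)$; the mean value theorem supplies the second factor $h$. *)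
Lemma powR_taylor2 (q e : R) : 0 < e -> exists2 del, 0 < del & forall h : R, `|h| < del ->
  `|(1 + h) `^ q - 1 - q * h - q * (q - 1) / 2 * h ^+ 2| <= e * h ^+ 2.
Proof.
move=> e0.
have dp (r h : R) : -1 < h -> is_derive h 1 (fun h => (1 + h) `^ r) (r * (1 + h) `^ (r - 1)).
  move=> h1; have p : 0 < 1 + h by lra.
  have l : is_derive h 1 (fun t : R => 1 + t) 1 by apply: is_derive_eq; ring.
  have := is_derive_comp1 (is_derive1_powR r p : is_derive ((fun t => 1 + t) h) _ _ _) l.
  by rewrite mulr1.
have q0 : 0 < `|q| + 1 by rewrite ltr_wpDl.
have := is_derive_approx (dp (q - 1) 0 ltac:(lra)) (divr_gt0 e0 q0).
rewrite addr0 powR1 mulr1 => -[d d0 H].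
exists (Num.min 1 d) => [|h]; first by rewrite lt_min ltr01.
rewrite lt_min => /andP[h1 hd].
pose g (x : R) := (1 + x) `^ q - 1 - q * x - q * (q - 1) / 2 * x ^+ 2.
pose g' (x : R) := q * ((1 + x) `^ (q - 1) - 1 - (q - 1) * x).
have dg (x : R) : `|x| < 1 -> is_derive x 1 g (g' x).
  rewrite ltr_norml => x1; have := dp q x ltac:(lra) => d1.
  by apply: is_derive_eq; rewrite /g' /GRing.scale /=; field.
have g'b (x : R) : `|x| <= `|h| -> `|g' x| <= e * `|h|.
  move=> xh; rewrite /g' normrM.
  have := H x (le_lt_trans xh hd); rewrite add0r => Hx.
  apply: (@le_trans _ _ (`|q| * (e / (`|q| + 1) * `|h|))).
    rewrite ler_wpM2l//; apply: (le_trans Hx); rewrite ler_wpM2l//.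
    by rewrite divr_ge0 // ltW.
  rewrite mulrA ler_wpM2r// mulrCA ger_pMr// ler_pdivrMr// mul1r; lra.
have g0 : g 0 = 0 by rewrite /g addr0 powR1 subrr !mulr0 expr0n /= mulr0; ring.
rewrite -/(g h) -[h ^+ 2]real_normK ?num_real// expr2 mulrA.
have [->|hn0] := eqVneq h 0; first by rewrite g0 normr0 !mulr0.
have [hp|hn] := ltP 0 h.
  have [t th|c ch E] := @MVT_is_derive _ g g' 0 h hp.
    by apply: dg; apply: le_lt_trans h1; rewrite !ger0_norm; lra.
  move: E; rewrite g0 !subr0 => ->; rewrite normrM ler_wpM2r// g'b//.
  by rewrite !ger0_norm; lra.
have hn' : h < 0 by rewrite lt_neqAle hn0.
have [t th|c ch E] := @MVT_is_derive _ g g' h 0 hn'.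
  by apply: dg; apply: le_lt_trans h1; rewrite !ler0_norm; lra.
move: E; rewrite g0 !sub0r mulrN => /oppr_inj ->.
by rewrite normrM ler_wpM2r// g'b// !ler0_norm; lra.
Qed.

End Ode.

(** * Profiles and the slope of the branch *)

Section Profile.
Variable R : realType.
Implicit Types f g : R -> R.

Lemma bounded_at_endsD f g : bounded_at_ends f -> bounded_at_ends g ->
  bounded_at_ends (fun t => f t + g t).
Proof.
move=> [C [d [d0 fC]]] [C' [d' [d'0 gC]]]; exists (C + C'), (Num.min d d').
rewrite lt_min d0 d'0; split=> // t t1 td.
have [m1 m2] : Num.min d d' <= d /\ Num.min d d' <= d' by rewrite !ge_min !lexx orbT.
apply: (le_trans (ler_normD _ _)); apply: lerD; [apply: fC|apply: gC] => //; lra.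
Qed.

Lemma bounded_at_endsM f g : bounded_at_ends f -> bounded_at_ends g ->
  bounded_at_ends (fun t => f t * g t).
Proof.
move=> [C [d [d0 fC]]] [C' [d' [d'0 gC]]]; exists (C * C'), (Num.min d d').
rewrite lt_min d0 d'0; split=> // t t1 td.
have [m1 m2] : Num.min d d' <= d /\ Num.min d d' <= d' by rewrite !ge_min !lexx orbT.
rewrite normrM; apply: ler_pM => //; [apply: fC|apply: gC] => //; lra.
Qed.

Lemma bounded_at_ends_cst (k : R) : bounded_at_ends (fun=> k).
Proof. by exists `|k|, 1. Qed.

Lemma horner_bound (p : {poly R}) : exists2 B, 0 < B & forall t : R, -1 < t < 1 -> `|p.[t]| <= B.
Proof.
exists (1 + \sum_(k < size p) `|p`_k|) => [|t t1].
  by rewrite ltr_wpDr ?sumr_ge0.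
rewrite horner_coef; apply: le_trans (ler_norm_sum _ _ _) _.
rewrite -[leLHS]add0r; apply: lerD => //; apply: ler_sum => k _.
rewrite normrM ler_piMr// normrX exprn_ile1// ler_norml; lra.
Qed.

Lemma bounded_at_ends_horner (p : {poly R}) : bounded_at_ends (horner p).
Proof. by have [B _ H] := horner_bound p; exists B, 1; split => // t t1 _; exact: H. Qed.

(** No bound is imposed on the second derivative: the weighted Wronskian at the ends involves only a
    function and its first derivative. *)
Definition profile (f f1 f2 : R -> R) : Prop :=
  [/\ forall t : R, -1 < t < 1 -> is_derive t 1 f (f1 t) /\ is_derive t 1 f1 (f2 t),
      bounded_at_ends f & bounded_at_ends f1].

Lemma profile_horner (p : {poly R}) :
  profile (horner p) (horner p^`()) (horner p^`()^`()).
Proof.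
by split; [move=> t _; split; exact: is_derive_horner|exact: bounded_at_ends_horner..].
Qed.

Lemma profile_lin (k l : R) f f1 f2 g g1 g2 : profile f f1 f2 -> profile g g1 g2 ->
  profile (fun t => k * f t + l * g t) (fun t => k * f1 t + l * g1 t)
          (fun t => k * f2 t + l * g2 t).
Proof.
move=> [df bf bf1] [dg bg bg1]; split.
- move=> t t1; have [d1 d2] := df t t1; have [d3 d4] := dg t t1.
  by split; apply: is_derive_eq; rewrite /GRing.scale /=; ring.
- by apply: bounded_at_endsD; apply: bounded_at_endsM => //; exact: bounded_at_ends_cst.
- by apply: bounded_at_endsD; apply: bounded_at_endsM => //; exact: bounded_at_ends_cst.
Qed.

Definition jop (a b : R) (f1 f2 : R -> R) (t : R) : R := (1 - t ^+ 2) * f2 t + (b - a * t) * f1 t.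

Lemma jop_lin a b k l (f1 f2 g1 g2 : R -> R) t :
  jop a b (fun t => k * f1 t + l * g1 t) (fun t => k * f2 t + l * g2 t) t =
  k * jop a b f1 f2 t + l * jop a b g1 g2 t.
Proof. by rewrite /jop; ring. Qed.

Lemma horner_jac_op a b (p : {poly R}) t :
  (jac_op a b p).[t] = jop a b (horner p^`()) (horner p^`()^`()) t.
Proof. by rewrite /jac_op /jop !hornerE. Qed.

(** Stands in for Green's identity: $f\,Lg-g\,Lf+Lh$ has zero weighted integral, so it vanishes if
    it is nonnegative. The term $Lh$ leaves room to correct the sign by something of mean zero. *)
Lemma wronskian_ge0_eq0 (a b : R) f f1 f2 g g1 g2 h h1 h2 : `|b| < a ->
  profile f f1 f2 -> profile g g1 g2 -> profile h h1 h2 ->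
  (forall t : R, -1 < t < 1 ->
     0 <= f t * jop a b g1 g2 t - g t * jop a b f1 f2 t + jop a b h1 h2 t) ->
  forall t : R, -1 < t < 1 -> f t * g1 t - g t * f1 t + h1 t = 0
    /\ f t * g2 t - g t * f2 t + h2 t = 0.
Proof.
move=> ba [df bf bf1] [dg bg bg1] [dh bh bh1] ge0.
apply: (first_order_ge0_eq0 ba (g := fun t => f t * g1 t - g t * f1 t + h1 t)
  (g' := fun t => f t * g2 t - g t * f2 t + h2 t)).
- move=> t t1; have [d1 d2] := df t t1; have [d3 d4] := dg t t1; have [d5 d6] := dh t t1.
  by apply: is_derive_eq; rewrite /GRing.scale /=; ring.
- apply: bounded_at_endsD => //; apply: bounded_at_endsD; first exact: bounded_at_endsM.
  have -> : (fun t => - (g t * f1 t)) = (fun t => -1 * (g t * f1 t)).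
    by apply/funext => t; rewrite mulN1r.
  by apply: bounded_at_endsM; [exact: bounded_at_ends_cst|exact: bounded_at_endsM].
- move=> t t1; have := ge0 t t1; congr (0 <= _); rewrite /jop; ring.
Qed.

Lemma wronskian_gt0_False (a b : R) f f1 f2 g g1 g2 h h1 h2 : `|b| < a ->
  profile f f1 f2 -> profile g g1 g2 -> profile h h1 h2 ->
  ~ (forall t : R, -1 < t < 1 ->
     0 < f t * jop a b g1 g2 t - g t * jop a b f1 f2 t + jop a b h1 h2 t).
Proof.
move=> ba pf pg ph gt0.
have [|e1 e2] := @wronskian_ge0_eq0 a b _ _ _ _ _ _ _ _ _ ba pf pg ph _ 0 ltac:(lra).
  by move=> t t1; exact: ltW (gt0 t t1).
have := gt0 0 ltac:(lra); rewrite ltNge => /negP; apply.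
rewrite /jop; set F := (X in X <= 0).
suff -> : F = 0 by [].
transitivity ((f 0 * g2 0 - g 0 * f2 0 + h2 0) + b * (f 0 * g1 0 - g 0 * f1 0 + h1 0)).
  by rewrite /F; ring.
by rewrite e1 e2; ring.
Qed.

End Profile.

(** * Components of the square on the constants and on the eigenfunction *)

Section Core.
Variable R : realType.
Variables (a b : R) (i : nat).
Hypotheses (a1 : 1 < a) (ba : `|b| < a) (i0 : (0 < i)%N).
Local Notation Q := (jac a b).
Local Notation nu := (jac_eig a).

Lemma jac_eig_inj j k : (j < k)%N -> nu j < nu k.
Proof.
have a1' := a1; move=> jk; rewrite /jac_eig.
have : j%:R + 1 <= k%:R :> R by rewrite natr1 ler_nat.
have : 0 <= j%:R :> R by [].
by move=> h1 h2; nra.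
Qed.

Lemma jac_eig_gt0 k : (0 < k)%N -> 0 < nu k.
Proof. by move=> /jac_eig_inj; rewrite /jac_eig mul0r. Qed.

Lemma jac_neq0 : exists2 t : R, -1 < t < 1 & (Q i).[t] != 0.
Proof.
apply: contrapT => H.
have [_] := jac_size_coef b i a1; rewrite (_ : Q i = 0) ?coef0 ?ltxx//.
apply: poly_root_itv_eq0 => t t1; apply/eqP; apply/negPn/negP => n0.
by apply: H; exists t.
Qed.

Lemma jac_op_sum N (c : nat -> R) :
  jac_op a b (\sum_(k < N) (c k)%:P * Q k) = \sum_(k < N) (- nu k * c k)%:P * Q k.
Proof.
elim: N => [|N IH]; first by rewrite !big_ord0 /jac_op !deriv0 !mulr0 addr0.
rewrite !big_ord_recr /= -IH {1}/jac_op !derivD !poly.derivE.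
transitivity (jac_op a b (\sum_(k < N) (c k)%:P * Q k) + (c N)%:P * jac_op a b (Q N)).
  by rewrite /jac_op; ring.
by rewrite jac_ode//; ring.
Qed.

(** Fredholm alternative: $L+\nu_j$ multiplies [Q k] by $\nu_j-\nu_k$, so every component except the
    one of index [j] lies in its image. *)
Lemma jac_sqr_split N (c : nat -> R) j : (j < N)%N ->
  exists psi : {poly R}, \sum_(k < N) (c k)%:P * Q k =
    (c j)%:P * Q j + jac_op a b psi + (nu j)%:P * psi.
Proof.
move=> jN; pose e k := if k == j then 0 else c k / (nu j - nu k).
exists (\sum_(k < N) (e k)%:P * Q k); rewrite jac_op_sum mulr_sumr -addrA -big_split /=.
rewrite (bigD1 (Ordinal jN))//= [in RHS](bigD1 (Ordinal jN))//= {1 2}/e eqxx.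
rewrite mulr0 polyC0 !mul0r mulr0 !add0r; congr (_ + _); apply: eq_bigr => k kj.
have kj' : (k == j :> nat) = false by apply/negbTE; apply: contra kj => /eqP kj; apply/eqP/val_inj.
rewrite mulrA -polyCM -mulrDl -polyCD /e kj'; congr (_%:P * _); field.
have : nu j != nu k.
  have [jk|kj2|jk] := ltngtP j k; last by rewrite jk eqxx in kj'.
    by rewrite lt_eqF// jac_eig_inj.
  by rewrite gt_eqF// jac_eig_inj.
by rewrite -subr_eq0.
Qed.

(** [A0] is the mean of $Q_i^2$ and [A] its coefficient on [Q i]; [chi] and [psi] absorb the
    remaining components at the eigenvalues $0$ and $\nu_i$. *)
Lemma jac_sqr_decomp : b <= 0 -> exists A0 A (chi psi : {poly R}),
  [/\ 0 < A0, Q i ^+ 2 = A0%:P + jac_op a b chi,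
      Q i ^+ 2 = A%:P * Q i + jac_op a b psi + (nu i)%:P * psi
    & if b == 0 then (A == 0) = odd i else 0 < A].
Proof.
have a1' := a1; move=> b0; have [c [cE c1 crec]] := @jac_sqr_expansion R a b i a1.
pose C k := c k * (2 * k%:R + a - 1).
have cE' : Q i ^+ 2 = \sum_(k < (2 * i).+1) (C k)%:P * Q k by [].
have [chi Hchi] := @jac_sqr_split (2 * i).+1 C 0 isT.
have [psi Hpsi] := @jac_sqr_split (2 * i).+1 C i ltac:(lia).
rewrite -cE' {1}/jac_eig mul0r polyC0 mul0r addr0 mulr1 in Hchi.
rewrite -cE' in Hpsi.
have C0 : C 0%N = c 0%N * (a - 1) by rewrite /C mulr0 add0r.
have c0 : 0 < c 0%N.
  rewrite ltNge; apply/negP; rewrite le_eqVlt => /orP[/eqP c0|c0].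
    have c_ := jac_sqr_coef0 a1 ba c1 crec c0.
    have [t _] := jac_neq0; have := congr1 (fun p : {poly R} => p.[t]) cE.
    rewrite /= big1 => [|[k ki] _ /=]; last by rewrite c_// mul0r polyC0 mul0r.
    by rewrite !hornerE => /eqP; rewrite sqrf_eq0 => ->.
  (* A negative mean would make $L\chi=Q_i^2-A_0$ positive everywhere. *)
  apply: (@wronskian_gt0_False R a b _ _ _ _ _ _ _ _ _ ba
    (profile_horner 0) (profile_horner 0) (profile_horner chi)) => t t1.
  rewrite -!horner_jac_op !horner0 !mul0r subrr add0r.
  have := congr1 (fun p : {poly R} => p.[t]) Hchi; rewrite hornerD hornerC horner_exp => E.
  have : 0 <= (Q i).[t] ^+ 2 by exact: sqr_ge0.
  rewrite E C0; have : c 0%N * (a - 1) < 0 by rewrite nmulr_rlt0// subr_gt0.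
  lra.
exists (C 0%N), (C i), chi, psi; split=> //.
  by rewrite C0 mulr_gt0// subr_gt0.
have p0 : 0 < 2 * i%:R + a - 1 by have : 0 <= i%:R :> R by []; move=> ?; lra.
case: eqVneq => [bz|bn].
  have := jac_sqr_coef_sym a1 ba c1 crec bz c0 (k := i) ltac:(lia).
  case: (odd i) => ci; first by rewrite /C ci mul0r eqxx.
  by rewrite gt_eqF// mulr_gt0.
by rewrite mulr_gt0// (jac_sqr_coef_gt0 a1 ba c1 crec)// lt_neqAle bn.
Qed.

End Core.

(** * Projection of the nonlinear equation at small parameter *)

Section Slope.
Variable R : realType.

(** In the application [x] is $CQ(t)$, [y] is $(\varphi_s(t)-1)/s$, [ls] is the difference quotient
    of $\lambda$ at $0$, [Ls] is $\lambda(s)$ and [err] is the Taylor remainder over $s^2$. The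
    bound sees $t$ only through [B], hence is uniform. *)
Lemma residual_bound (q x y l ls L0 Ls err e B : R) : 1 < q -> 0 <= e <= 1 ->
  `|x| <= B -> `|y - x| <= e -> `|ls - l| <= e -> `|Ls - L0| <= e -> `|err| <= e * y ^+ 2 ->
  `|- (q - 1) * (ls * y - l * x) - q * (q - 1) / 2 * (Ls * y ^+ 2 - L0 * x ^+ 2) - Ls * err|
  <= e * ((q - 1) * (B + 1 + `|l|) + q * (q - 1) / 2 * ((B + 1) ^+ 2 + `|L0| * (2 * B + 1))
          + (`|L0| + 1) * (B + 1) ^+ 2).
Proof.
move=> q1 e01 xB yx lsl LsL errb.
have B0 : 0 <= B by apply: le_trans xB.
have yB : `|y| <= B + 1.
  rewrite -[y](subrK x); apply: (le_trans (ler_normD _ _)); lra.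
have y2 : y ^+ 2 <= (B + 1) ^+ 2.
  by rewrite -[y ^+ 2]real_normK ?num_real// ler_sqr ?nnegrE//; lra.
have Lsb : `|Ls| <= `|L0| + 1.
  rewrite -[Ls](subrK L0); apply: (le_trans (ler_normD _ _)); lra.
have h1 : `|ls * y - l * x| <= e * (B + 1 + `|l|).
  rewrite (_ : _ - _ = (ls - l) * y + l * (y - x)); last by ring.
  apply: (le_trans (ler_normD _ _)); rewrite !normrM mulrDr; apply: lerD.
    by apply: ler_pM.
  by rewrite mulrC ler_wpM2r.
have h2 : `|Ls * y ^+ 2 - L0 * x ^+ 2| <= e * ((B + 1) ^+ 2 + `|L0| * (2 * B + 1)).
  rewrite (_ : _ - _ = (Ls - L0) * y ^+ 2 + L0 * ((y - x) * (y + x))); last by ring.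
  apply: (le_trans (ler_normD _ _)); rewrite !normrM mulrDr; apply: lerD.
    by apply: ler_pM => //; rewrite expr2 ler_pM.
  rewrite [leRHS]mulrCA ler_wpM2l//; apply: ler_pM => //.
  by apply: (le_trans (ler_normD _ _)); lra.
have h3 : `|Ls * err| <= e * ((`|L0| + 1) * (B + 1) ^+ 2).
  rewrite normrM [leRHS]mulrCA; apply: ler_pM => //; apply: (le_trans errb).
  by rewrite ler_wpM2l//; lra.
apply: (le_trans (ler_normB _ _)); rewrite [leRHS]mulrDr; apply: lerD => //.
apply: (le_trans (ler_normB _ _)); rewrite [leRHS]mulrDr; apply: lerD; rewrite normrM.
  by rewrite normrN (gtr0_norm (_ : 0 < q - 1)) ?subr_gt0// [leRHS]mulrCA ler_wpM2l//; lra.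
have q2 : 0 < q * (q - 1) / 2 by rewrite divr_gt0 ?mulr_gt0//; lra.
by rewrite (gtr0_norm q2) [leRHS]mulrCA ler_wpM2l// ltW.
Qed.

Variables (a b q D L0 l eps : R) (i : nat) (lam : R -> R) (phi : R -> R -> R).
Variables (rho rho1 rho2 : R -> R).
Hypotheses (a1 : 1 < a) (ba : `|b| < a) (b0 : b <= 0) (i0 : (0 < i)%N).
Hypotheses (q1 : 1 < q) (D0 : 0 < D) (eps0 : 0 < eps).
Hypotheses (dlam : is_derive (0 : R) 1 lam l) (lam0 : lam 0 = L0).
Hypothesis L0E : L0 * (q - 1) = D * jac_eig a i.
Hypothesis branch : forall s, 0 < `|s| < eps -> exists phi1 phi2,
  profile (phi s) phi1 phi2 /\ forall t : R, -1 < t < 1 ->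
    - (D * jop a b phi1 phi2 t) + lam s * phi s t = lam s * phi s t `^ q.
Hypothesis branch_d : forall e, 0 < e -> exists2 del, 0 < del &
  forall s, 0 < `|s| < del -> forall t : R, -1 < t < 1 -> `|(phi s t - 1) / s - rho t| <= e.
Hypothesis prho : profile rho rho1 rho2.
Hypothesis rho_eig : forall t : R, -1 < t < 1 -> jop a b rho1 rho2 t = - jac_eig a i * rho t.
Hypothesis rho_n0 : exists2 t : R, -1 < t < 1 & rho t != 0.
Local Notation Q := (jac a b i).
Local Notation nu := (jac_eig a i).

Lemma jop_jac t : jop a b (horner Q^`()) (horner Q^`()^`()) t = - nu * Q.[t].
Proof. by rewrite -horner_jac_op jac_ode// hornerM hornerN hornerC. Qed.

(** Equal eigenvalues make the Wronskian of [rho] and [Q] vanish, so at a point where [Q] is nonzero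
    a suitable [rho - C Q] has zero Cauchy data. *)
Lemma eigenprofile_jac : exists2 C, C != 0 & forall t : R, -1 < t < 1 -> rho t = C * Q.[t].
Proof.
have [t0 t01 Qt0] := @jac_neq0 R a b i a1.
have nu0 : 0 < nu by apply: jac_eig_gt0.
pose C := rho t0 / Q.[t0].
have pC := profile_lin 1 (- C) prho (profile_horner Q).
have W : Q.[t0] * rho1 t0 - rho t0 * Q^`().[t0] = 0.
  have [|+ _] := wronskian_ge0_eq0 ba (profile_horner Q) prho (profile_horner 0) _ t01.
    move=> t t1; rewrite rho_eig// jop_jac -horner_jac_op /jac_op !deriv0 !mulr0 addr0 horner0.
    by rewrite le_eqVlt; apply/orP; left; apply/eqP; ring.
  by rewrite deriv0 horner0 addr0.
have rhoE : forall t : R, -1 < t < 1 -> rho t = C * Q.[t].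
  move=> t t1; apply/eqP; rewrite -subr_eq0; apply/eqP.
  have [df _ _] := pC.
  rewrite -[rho t]mul1r -mulNr.
  apply: (@ode_unique R a b nu _ _ _ t0 nu0 t01 df _ _ _ t t1).
  - move=> x x1; rewrite -/(jop a b _ _ x).
    have := jop_lin a b 1 (- C) rho1 rho2 (horner Q^`()) (horner Q^`()^`()) x.
    rewrite /jop => ->; rewrite -!/(jop a b _ _ x) rho_eig// jop_jac; ring.
  - by rewrite /C; field.
  - apply: (mulfI Qt0); rewrite mulr0 -[RHS]W /C; field.
    exact: Qt0.
exists C => //; have [t t1 rt] := rho_n0; apply: contra_neq rt => C0.
by rewrite rhoE// C0 mul0r.
Qed.

(** With $\varphi_s=1+sy$ the equation makes $D(Ly+\nu y)/s$ close to $-(q-1)lCQ-kQ^2$, where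
    $k=L_0q(q-1)C^2/2$. Adding $k\psi$ to $Dy/s$ turns this source into $-MQ$. Were $M\ne0$, the
    Wronskian of $Q$ with $-M$ times the result would have source $M^2Q^2$ up to a small error. That
    term may vanish, but subtracting $M^2L\chi$ replaces it by the constant $M^2A_0>0$, which
    dominates the error: a contradiction. *)
Lemma slope_relation (A0 A C : R) (chi psi : {poly R}) : 0 < A0 ->
  Q ^+ 2 = A0%:P + jac_op a b chi -> Q ^+ 2 = A%:P * Q + jac_op a b psi + nu%:P * psi ->
  (forall t : R, -1 < t < 1 -> rho t = C * Q.[t]) ->
  (q - 1) * C * l + L0 * q * (q - 1) / 2 * C ^+ 2 * A = 0.
Proof.
move=> A00 Echi Epsi rhoE; set M := LHS; apply/eqP; apply: contraT => Mn0.
have q1' := q1; have D0' := D0.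
pose k := L0 * q * (q - 1) / 2 * C ^+ 2.
have [B B0 QB] := horner_bound Q.
(* Residual size for which the error $MQW$ is at most half of $M^2A_0$. *)
pose del := `|M| * A0 / (2 * B).
have M0 : 0 < `|M| by rewrite normr_gt0.
have del0 : 0 < del by rewrite divr_gt0 ?mulr_gt0.
pose B1 := `|C| * B.
pose K := (q - 1) * (B1 + 1 + `|l|) + q * (q - 1) / 2 * ((B1 + 1) ^+ 2 + `|L0| * (2 * B1 + 1))
          + (`|L0| + 1) * (B1 + 1) ^+ 2.
have B10 : 0 <= B1 by rewrite mulr_ge0// ltW.
have K0 : 0 < K.
  rewrite /K ltr_wpDl//; last by rewrite mulr_gt0 ?exprn_gt0 ?ltr_wpDl.
  apply: addr_ge0; apply: mulr_ge0; try lra.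
  - by have := normr_ge0 l; lra.
  - by apply: divr_ge0 => //; apply: mulr_ge0; lra.
  - by apply: addr_ge0; [exact: sqr_ge0|apply: mulr_ge0 => //; lra].
pose e := Num.min 1 (del / K).
have e0 : 0 < e by rewrite lt_min ltr01 divr_gt0.
have e1 : e <= 1 by rewrite ge_min lexx.
have eK : e * K <= del by rewrite -ler_pdivlMr// ge_min lexx orbT.
have [d1 d10 H1] := is_derive_approx dlam e0.
have [d2 d20 H2] := branch_d e0.
have [d3 d30 H3] := powR_taylor2 q e0.
(* The bound by [d3 / (B1 + 1)] keeps $sy$ in the range of the Taylor estimate; the last one keeps
   [lam s] within [e] of [L0]. *)
pose s := Num.min (Num.min d1 d2) (Num.min (Num.min eps (d3 / (B1 + 1))) (e / (`|l| + 1))) / 2.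
have dd3 : 0 < d3 / (B1 + 1) by rewrite divr_gt0// ltr_wpDl.
have dl : 0 < e / (`|l| + 1) by rewrite divr_gt0// ltr_wpDl.
have s0 : 0 < s by rewrite divr_gt0// !lt_min d10 d20 eps0 dd3 dl.
have : 2 * s <= Num.min (Num.min d1 d2) (Num.min (Num.min eps (d3 / (B1 + 1))) (e / (`|l| + 1))).
  by rewrite /s mulrC divfK.
rewrite !le_min => /andP[/andP[sd1 sd2] /andP[/andP[seps sd3] sl]].
have sabs : `|s| = s by rewrite gtr0_norm.
have [phi1 [phi2 [pphi Ephi]]] := branch (s := s) ltac:(rewrite sabs; lra).
have {}H1 : `|lam s - L0 - l * s| <= e * s.
  by have := H1 s; rewrite sabs add0r lam0; apply; lra.
have {}H2 := H2 s ltac:(rewrite sabs; lra).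
have lsl : `|(lam s - L0) / s - l| <= e.
  rewrite (_ : _ - l = (lam s - L0 - l * s) / s); last by field; rewrite gt_eqF.
  by rewrite normrM normfV sabs ler_pdivrMr.
have LsL : `|lam s - L0| <= e.
  rewrite -[lam s - L0](subrK (l * s)); apply: (le_trans (ler_normD _ _)).
  rewrite normrM sabs; have : (`|l| + 1) * s <= e.
    by rewrite mulrC -ler_pdivlMr ?ltr_wpDl//; lra.
  have : e * s <= s by rewrite ger_pMl.
  lra.
(* This is $D(\varphi_s-1)/s^2+k\psi$. The zero profiles in [r2] and [h] only pad the linear
   combinations. *)
pose r := profile_lin 1 k
  (profile_lin (D / s ^+ 2) (- (D / s ^+ 2)) pphi (profile_horner 1)) (profile_horner psi).
pose r2 := profile_lin (- M) 0 r (profile_horner 0).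
pose h := profile_lin (- M ^+ 2) 0 (profile_horner chi) (profile_horner 0).
exfalso; apply: (wronskian_gt0_False ba (profile_horner Q) r2 h) => t t1.
rewrite !jop_lin -!horner_jac_op jac_ode//.
have -> : (jac_op a b 1 : {poly R}) = 0 by rewrite /jac_op -polyC1 !derivC !mulr0 addr0.
have -> : (jac_op a b 0 : {poly R}) = 0 by rewrite /jac_op !deriv0 !mulr0 addr0.
have Ec : (jac_op a b chi).[t] = Q.[t] ^+ 2 - A0.
  by have := congr1 (fun p : {poly R} => p.[t]) Echi; rewrite hornerD hornerC horner_exp => ->; ring.
have Ep : (jac_op a b psi).[t] = Q.[t] ^+ 2 - A * Q.[t] - nu * psi.[t].
  have := congr1 (fun p : {poly R} => p.[t]) Epsi.
  by rewrite !hornerD !hornerM !hornerC -expr2 => Eq; lra.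
rewrite Ec Ep hornerM hornerN !hornerC.
pose y := (phi s t - 1) / s.
pose err := (phi s t `^ q - 1 - q * (phi s t - 1) - q * (q - 1) / 2 * (phi s t - 1) ^+ 2) / s ^+ 2.
have sn0 : s != 0 by rewrite gt_eqF.
have phiE : phi s t = 1 + s * y by rewrite /y; field.
have xB : `|C * Q.[t]| <= B1 by rewrite normrM ler_wpM2l// QB.
have yx : `|y - C * Q.[t]| <= e by rewrite -rhoE// H2.
have yB : `|y| <= B1 + 1.
  rewrite -[y](subrK (C * Q.[t])); apply: (le_trans (ler_normD _ _)); lra.
have errb : `|err| <= e * y ^+ 2.
  have := H3 (s * y); rewrite normrM sabs => /(_ _)/wrap[].
    apply: (@le_lt_trans _ _ (s * (B1 + 1))); first by rewrite ler_wpM2l// ltW.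
    by rewrite -ltr_pdivlMr ?ltr_wpDl//; lra.
  rewrite -phiE => /= Ht; rewrite /err normrM normfV (gtr0_norm (exprn_gt0 2 s0)).
  rewrite ler_pdivrMr ?exprn_gt0//.
  by move: Ht; rewrite phiE (_ : 1 + s * y - 1 = s * y) ?exprMn; [lra|ring].
have res := residual_bound q1 (_ : 0 <= e <= 1) xB yx lsl LsL errb.
have {res} := le_trans (res ltac:(by rewrite ltW)) eK.
set W := (X in `|X| <= _).
have -> : Q.[t] * (- M * (1 * (D / s ^+ 2 * jop a b phi1 phi2 t + - (D / s ^+ 2) * 0) + k * (Q.[t] ^+ 2 - A * Q.[t] - nu * psi.[t])) + 0 * 0)
   - (- M * (1 * (D / s ^+ 2 * phi s t + - (D / s ^+ 2) * 1) + k * psi.[t]) + 0 * 0) * (- nu * Q.[t])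
   + (- M ^+ 2 * (Q.[t] ^+ 2 - A0) + 0 * 0) = - M * Q.[t] * W + M ^+ 2 * A0.
  have E1 : D * jop a b phi1 phi2 t = lam s * (phi s t - phi s t `^ q) by have := Ephi t t1; lra.
  have E2 : phi s t `^ q = 1 + q * (s * y) + q * (q - 1) / 2 * (s * y) ^+ 2 + s ^+ 2 * err.
    by rewrite /err phiE; field.
  have E3 : D / s ^+ 2 * jop a b phi1 phi2 t = D * jop a b phi1 phi2 t / s ^+ 2 by field.
  rewrite E3 E1 E2 phiE.
  have E4 : D / s ^+ 2 * (1 + s * y) + - (D / s ^+ 2) * 1 = D * y / s by field.
  rewrite E4.
  have E5 : D * nu = L0 * (q - 1) by rewrite L0E.
  rewrite /W /M /k; set N := nu in E5 *.
  transitivity ((D * N) * (Q.[t] * - M * y / s) + (Q.[t] * (- M * (lam s * (1 + s * y - (1 + q * (s * y) + q * (q - 1) / 2 * (s * y) ^+ 2 + s ^+ 2 * err)) / s ^+ 2 + k * (Q.[t] ^+ 2 - A * Q.[t]))) + - M ^+ 2 * (Q.[t] ^+ 2 - A0))).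
    by rewrite /M /k; field.
  by rewrite E5 /M /k; field.
move=> Wd.
have : `|- M * Q.[t] * W| <= `|M| * B * del.
  by rewrite !normrM normrN; apply: ler_pM => //; apply: ler_wpM2l => //; exact: QB.
have -> : `|M| * B * del = M ^+ 2 * A0 / 2.
  by rewrite -[M ^+ 2]real_normK ?num_real// /del; field; rewrite gt_eqF.
have : 0 < M ^+ 2 * A0 by rewrite mulr_gt0// exprn_even_gt0.
rewrite ler_norml; lra.
Qed.

(** Since $C$, $q-1$ and $L_0$ are nonzero, the relation reads $l=-L_0qCA/2$, and everything rests
    on whether $A$ vanishes. *)
Theorem branch_slope : if b == 0 then (l == 0) = odd i else l != 0.
Proof.
have [A0 [A [chi [psi [A00 Echi Epsi]]]]] := jac_sqr_decomp a1 ba i0 b0.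
have [C C0 rhoE] := eigenprofile_jac.
have := slope_relation A00 Echi Epsi rhoE.
have L00 : 0 < L0.
  rewrite -(pmulr_lgt0 _ (_ : 0 < q - 1)) ?subr_gt0// L0E mulr_gt0//.
  exact: jac_eig_gt0.
have -> : (q - 1) * C * l + L0 * q * (q - 1) / 2 * C ^+ 2 * A =
   (q - 1) * C * (l + L0 * q * C / 2 * A) by field.
move/eqP; rewrite !mulf_eq0 (negbTE C0) subr_eq0 (gt_eqF q1) /=.
rewrite addr_eq0 => /eqP ->; rewrite oppr_eq0 !mulf_eq0 (negbTE C0) (gt_eqF L00).
rewrite (gt_eqF (lt_trans ltr01 q1)) invr_eq0 pnatr_eq0 /=.
by case: ifP => // _ /gt_eqF ->.
Qed.

End Slope.

(** * Calculus along great circles *)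

Section CurveChain.
Variable R : realType.

Lemma is_derive_of_approx (f : R -> R) (x l : R) :
  (forall e, 0 < e -> exists2 del, 0 < del &
    forall h : R, `|h| < del -> `|f (x + h) - f x - l * h| <= e * `|h|) ->
  is_derive x 1 f l.
Proof.
move=> H.
have lim : (fun h : R => h^-1 *: (f (h *: 1 + x) - f x)) h @[h --> 0^'] --> l.
  apply/cvgrPdist_le => e e0; have [d d0 Hd] := H e e0.
  rewrite near_withinE; exists d => //= h; rewrite /ball_ /= sub0r normrN => hd h0.
  have := Hd h hd; rewrite -ler_pdivrMr ?normr_gt0//; apply: le_trans.
  rewrite -normfV -normrM -normrN /GRing.scale /= mulr1 (addrC h).
  by rewrite le_eqVlt; apply/orP; left; apply/eqP; congr (`|_|); field.
by split; [apply/cvg_ex; exists l|apply: cvg_lim].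
Qed.

Lemma MVT_sym (f f' : R -> R) (h : R) :
  (forall t : R, `|t| <= `|h| -> is_derive t 1 f (f' t)) ->
  exists2 c, `|c| <= `|h| & f h - f 0 = f' c * h.
Proof.
move=> df; have [->|h0] := eqVneq h 0.
  by exists 0; rewrite ?normr0// subrr mulr0.
have [hp|hn] := ltP 0 h.
  have [t th|c ch E] := @MVT_is_derive R f f' 0 h hp.
    by apply: df; rewrite !ger0_norm; lra.
  by exists c; [rewrite !ger0_norm; lra|rewrite E subr0].
have hn' : h < 0 by rewrite lt_neqAle h0.
have [t th|c ch E] := @MVT_is_derive R f f' h 0 hn'.
  by apply: df; rewrite !ler0_norm; lra.
exists c; first by rewrite !ler0_norm; lra.
by apply: oppr_inj; rewrite opprB E sub0r mulrN.
Qed.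

Variable m : nat.
Local Notation V := 'rV[R]_m.
Implicit Types (g : V -> R) (y z v : V).

Lemma nbhs_rV_coord y (P : set V) : nbhs y P ->
  exists2 r : R, 0 < r & forall z, (forall j, `|z ord0 j - y ord0 j| < r) -> P z.
Proof.
move=> /nbhs_ballP[r /= r0 H]; exists r => // z zy; apply: H; split=> // k j.
by rewrite ord1 /ball /= distrC.
Qed.

Lemma is_derive_line g y v (t l : R) :
  is_derive (t *: v + y) v g l <-> is_derive t 1 (fun h : R => g (h *: v + y)) l.
Proof.
have E : (fun h : R => h^-1 *: (g (h *: v + (t *: v + y)) - g (t *: v + y))) =
    (fun h : R => h^-1 *: (g ((h *: 1 + t) *: v + y) - g (t *: v + y))).
  apply/funext => h /=; have -> : h *: (1 : R) = h by rewrite /GRing.scale /= mulr1.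
  by rewrite scalerDl addrA.
split=> -[d1 d2]; (split; [move: d1|move: d2]).
- by rewrite /derivable E.
- by rewrite /derive E.
- by rewrite /derivable E.
- by rewrite /derive E.
Qed.

Lemma is_derive_line0 g y v (l : R) :
  is_derive y v g l <-> is_derive (0 : R) 1 (fun h : R => g (h *: v + y)) l.
Proof. by rewrite -is_derive_line scale0r add0r. Qed.

(* A function with continuous partial derivatives is differentiable along curves;
   the increment is split along the coordinate axes. *)
Lemma is_derive_curve g (G : 'I_m -> V -> R) (x : R -> V) (x' : 'I_m -> R) (t : R) :
  (\forall y \near x t, forall j, is_derive y (ebasis R j) g (G j y)) ->
  (forall j, {for x t, continuous (G j)}) ->
  (forall j, is_derive t 1 (fun s => x s ord0 j) (x' j)) ->
  is_derive t 1 (g \o x) (\sum_j G j (x t) * x' j).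
Proof.
move=> /nbhs_rV_coord[r r0 dg] cG dx; apply: is_derive_of_approx => e e0.
pose K := \sum_j (`|x' j| + 1 + `|G j (x t)|) + 1.
have K0 : 0 < K by rewrite ltr_wpDl// sumr_ge0// => j _; rewrite !addr_ge0.
pose e1 := Num.min 1 (e / K).
have e10 : 0 < e1 by rewrite lt_min ltr01 divr_gt0.
have e11 : e1 <= 1 by rewrite ge_min lexx.
have e1K : e1 * K <= e by rewrite -ler_pdivlMr// ge_min lexx orbT.
have [r1 r10 Gr1] : exists2 r1, 0 < r1 & forall j z,
    (forall k, `|z ord0 k - x t ord0 k| < r1) -> `|G j z - G j (x t)| <= e1.
  have H : \forall z \near x t, forall j, `|G j z - G j (x t)| <= e1.
    apply: (@filter_forall V 'I_m (fun j z => `|G j z - G j (x t)| <= e1) (nbhs (x t)) _) => j.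
    have /cvgrPdist_le/(_ _ e10) := cG j.
    by apply: filterS => z; rewrite distrC.
  by have [r1 r10 H1] := nbhs_rV_coord H; exists r1 => // j z zx; exact: H1.
pose r2 := Num.min r r1.
have r20 : 0 < r2 by rewrite lt_min r0.
have [d d0 Hd] : exists2 d, 0 < d & forall h : R, `|h| < d -> forall j,
    `|x (t + h) ord0 j - x t ord0 j - x' j * h| <= e1 * `|h|.
  have H : \forall h \near (0 : R), forall j,
      `|x (t + h) ord0 j - x t ord0 j - x' j * h| <= e1 * `|h|.
    apply: (@filter_forall R 'I_m (fun j h => `|x (t + h) ord0 j - x t ord0 j - x' j * h| <= e1 * `|h|) (nbhs (0 : R)) _) => j.
    have [d d0 Hd] := is_derive_approx (dx j) e10.
    by exists d => //= h; rewrite /ball_ /= sub0r normrN; exact: Hd.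
  by case: H => d /= d0 Hd; exists d => // h hd; apply: Hd; rewrite /= sub0r normrN.
pose X := \sum_j (`|x' j| + 1) + 1.
have X0 : 0 < X by rewrite ltr_wpDl// sumr_ge0// => j _; rewrite addr_ge0.
exists (Num.min d (r2 / X)) => [|h]; first by rewrite lt_min d0 divr_gt0.
rewrite lt_min => /andP[hd]; rewrite ltr_pdivlMr// => hr.
have {}Hd := Hd h hd.
pose D j := x (t + h) ord0 j - x t ord0 j.
have Db j : `|D j| <= (`|x' j| + 1) * `|h|.
  rewrite -[D j](subrK (x' j * h)); apply: (le_trans (ler_normD _ _)).
  rewrite normrM mulrDl mul1r addrC lerD2l; apply: (le_trans (Hd j)).
  by rewrite ler_piMl.
have Dr j : `|D j| < r2.
  apply: le_lt_trans hr; rewrite mulrC; apply: (le_trans (Db j)).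
  have S0 : 0 <= \sum_(k | k != j) (`|x' k| + 1).
    by apply: sumr_ge0 => k _; exact: addr_ge0.
  by rewrite ler_wpM2r// /X (bigD1 j)//=; lra.
(* Hybrid points: the first [k] coordinates are those of [x (t + h)], the others those of [x t], so
   consecutive points differ along one axis. *)
pose z k : V := \row_j (if (j < k)%N then x (t + h) ord0 j else x t ord0 j).
have z0 : z 0%N = x t by apply/rowP => j; rewrite mxE.
have zm : z m = x (t + h) by apply/rowP => j; rewrite mxE ltn_ord.
have zS (j : 'I_m) : z j.+1 = D j *: ebasis R j + z j.
  apply/rowP => k; rewrite !mxE ltnS leq_eqVlt eqxx /= val_eqE.
  have [->|kj] := eqVneq k j; first by rewrite ltnn /D /= mulr1; ring.
  by rewrite mulr0 add0r.
have zr (j : 'I_m) (s : R) : `|s| <= `|D j| ->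
    forall k : 'I_m, `|(s *: ebasis R j + z j) ord0 k - x t ord0 k| < r2.
  move=> sD k; rewrite !mxE eqxx /=; have [->|kj] := eqVneq k j.
    by rewrite ltnn mulr1 addrK (le_lt_trans sD).
  rewrite mulr0 add0r; case: ifP => _; first exact: Dr.
  by rewrite subrr normr0.
have inc (j : 'I_m) : `|g (z j.+1) - g (z j) - G j (x t) * x' j * h|
    <= e1 * `|h| * (`|x' j| + 1 + `|G j (x t)|).
  have [s sD|s sD E] := @MVT_sym (fun s => g (s *: ebasis R j + z j))
    (fun s => G j (s *: ebasis R j + z j)) (D j).
    apply/is_derive_line; apply: dg => k; apply: lt_le_trans (zr j s sD k) _.
    by rewrite ge_min lexx.
  rewrite zS; move: E; rewrite scale0r add0r => ->.
  set y := s *: _ + _.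
  have Gy : `|G j y - G j (x t)| <= e1.
    apply: Gr1 => k; apply: lt_le_trans (zr j s sD k) _.
    by rewrite ge_min lexx orbT.
  rewrite (_ : _ - _ = (G j y - G j (x t)) * D j + G j (x t) * (D j - x' j * h)); last by ring.
  apply: (le_trans (ler_normD _ _)); rewrite !normrM mulrDr; apply: lerD.
    by rewrite -mulrA; apply: ler_pM => //; rewrite mulrC.
  by rewrite mulrC; apply: ler_wpM2r => //; exact: Hd.
rewrite /= -zm -z0 -(telescope_sumr (fun k => g (z k)))// big_mkord mulr_suml -sumrB z0.
apply: (le_trans (ler_norm_sum _ _ _)).
apply: (@le_trans _ _ (\sum_j e1 * `|h| * (`|x' j| + 1 + `|G j (x t)|))).
  by apply: ler_sum => j _; exact: inc.
rewrite -mulr_sumr mulrAC ler_wpM2r//; apply: le_trans e1K.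
by rewrite /K ler_wpM2l ?(ltW e10)// lerDl.
Qed.

End CurveChain.

(** * Euclidean scalar product *)

Section Dot.
Variables (R : realType) (m : nat).
Local Notation V := 'rV[R]_m.
Implicit Types (u v w y : V).

Definition dot u v : R := \sum_j u ord0 j * v ord0 j.

Lemma dotC u v : dot u v = dot v u.
Proof. by apply: eq_bigr => j _; rewrite mulrC. Qed.

Lemma dotDl u v w : dot (u + v) w = dot u w + dot v w.
Proof. by rewrite /dot -big_split; apply: eq_bigr => j _; rewrite mxE mulrDl. Qed.

Lemma dotZl k u w : dot (k *: u) w = k * dot u w.
Proof. by rewrite /dot mulr_sumr; apply: eq_bigr => j _; rewrite mxE mulrA. Qed.

Lemma dotDr u v w : dot w (u + v) = dot w u + dot w v.
Proof. by rewrite dotC dotDl !(dotC w). Qed.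

Lemma dotZr k u w : dot w (k *: u) = k * dot w u.
Proof. by rewrite dotC dotZl dotC. Qed.

Lemma dotNl u w : dot (- u) w = - dot u w.
Proof. by rewrite -scaleN1r dotZl mulN1r. Qed.

Lemma dotNr u w : dot w (- u) = - dot w u.
Proof. by rewrite dotC dotNl dotC. Qed.

Definition dotE := (dotDl, dotDr, dotNl, dotNr, dotZl, dotZr).

Lemma sqnormE u : sqnorm u = dot u u.
Proof. by apply: eq_bigr => j _; rewrite expr2. Qed.

Lemma dot_ge0 u : 0 <= dot u u.
Proof. by rewrite -sqnormE sumr_ge0// => j _; rewrite sqr_ge0. Qed.

Lemma dot_eq0 u : (dot u u == 0) = (u == 0).
Proof.
apply/idP/eqP => [|->]; last by rewrite /dot big1// => j _; rewrite mxE mul0r.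
rewrite psumr_eq0 => [/allP h|j _]; last by rewrite -expr2 sqr_ge0.
apply/rowP => j; rewrite mxE; apply/eqP; have := h j (mem_index_enum _).
by rewrite -expr2 sqrf_eq0.
Qed.

Lemma dot_gt0 u : u != 0 -> 0 < dot u u.
Proof. by move=> u0; rewrite lt_neqAle dot_ge0 eq_sym dot_eq0 u0. Qed.

Lemma bessel2 p v w : dot p p = 1 -> dot v v = 1 -> dot p v = 0 ->
  dot w p ^+ 2 + dot w v ^+ 2 <= dot w w.
Proof.
move=> pp vv pv; have := dot_ge0 (w - dot w p *: p - dot w v *: v).
rewrite !dotE pp vv (dotC v p) pv (dotC p w) (dotC v w); lra.
Qed.

Lemma cauchy_schwarz1 p w : dot p p = 1 -> dot w p ^+ 2 <= dot w w.
Proof.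
move=> pp; have := dot_ge0 (w - dot w p *: p).
rewrite !dotE pp (dotC p w); lra.
Qed.

Lemma ebasis_dot j y : dot (ebasis R j) y = y ord0 j.
Proof.
rewrite /dot (bigD1 j)//= mxE !eqxx mul1r big1 ?addr0// => k kj.
by rewrite mxE (negbTE kj) andbF mul0r.
Qed.

Lemma enorm_gt0 y : y != 0 -> 0 < enorm y.
Proof. by move=> y0; rewrite sqrtr_gt0 sqnormE dot_gt0. Qed.

Lemma enorm_sqr y : enorm y ^+ 2 = dot y y.
Proof. by rewrite sqr_sqrtr sqnormE// dot_ge0. Qed.

Lemma enorm1 y : on_sphere y -> enorm y = 1.
Proof. by rewrite /on_sphere /enorm => ->; rewrite sqrtr1. Qed.

Lemma on_sphereE y : on_sphere y <-> dot y y = 1.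
Proof. by rewrite /on_sphere sqnormE. Qed.

Lemma sphere_neq0 y : on_sphere y -> y != 0.
Proof. by move=> /on_sphereE h; rewrite -dot_eq0 h oner_eq0. Qed.

Lemma hom_ext_sphere (u : V -> R) y : on_sphere y -> hom_ext u y = u y.
Proof. by move=> h; rewrite /hom_ext enorm1// invr1 scale1r. Qed.

Lemma normalize_sphere y : y != 0 -> on_sphere ((enorm y)^-1 *: y).
Proof.
move=> y0; apply/on_sphereE; rewrite !dotE -enorm_sqr; field.
by rewrite gt_eqF// enorm_gt0.
Qed.

End Dot.

(* Functions built from the coordinates and [1 / enorm]: a class of functions,
   smooth away from the origin, that is closed under partial derivatives and contains
   the 0-homogeneous extension of a homogeneous polynomial. *)
Section SmoothExpr.
Variables (R : realType) (m : nat).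
Local Notation V := 'rV[R]_m.
Implicit Types (y : V) (g : V -> R).

Inductive sexpr : Type :=
  | SCst of R | SVar of 'I_m | SInv | SAdd of sexpr & sexpr | SMul of sexpr & sexpr.

Fixpoint sev (e : sexpr) (y : V) : R :=
  match e with
  | SCst c => c
  | SVar j => y ord0 j
  | SInv => (enorm y)^-1
  | SAdd e1 e2 => sev e1 y + sev e2 y
  | SMul e1 e2 => sev e1 y * sev e2 y
  end.

Fixpoint sder (j : 'I_m) (e : sexpr) : sexpr :=
  match e with
  | SCst c => SCst 0
  | SVar k => SCst (k == j)%:R
  | SInv => SMul (SCst (-1)) (SMul (SMul SInv (SMul SInv SInv)) (SVar j))
  | SAdd e1 e2 => SAdd (sder j e1) (sder j e2)
  | SMul e1 e2 => SAdd (SMul (sder j e1) e2) (SMul e1 (sder j e2))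
  end.

Lemma is_derive_coord y (j k : 'I_m) :
  is_derive y (ebasis R j) (fun y : V => y ord0 k) (k == j)%:R.
Proof.
apply/is_derive_line0.
rewrite (_ : (fun _ => _) = (fun h : R => h * (k == j)%:R + y ord0 k)); last first.
  by apply/funext => h; rewrite !mxE eqxx.
by apply: is_derive_eq; rewrite /GRing.scale /=; ring.
Qed.

Lemma is_derive_inv_enorm y (j : 'I_m) : y != 0 ->
  is_derive y (ebasis R j) (fun y : V => (enorm y)^-1) (- (enorm y)^-1 ^+ 3 * y ord0 j).
Proof.
move=> y0; apply/is_derive_line0; have n0 := enorm_gt0 y0.
have yy : 0 < dot y y by rewrite dot_gt0.
rewrite (_ : (fun _ => _) =
    (fun h : R => (Num.sqrt (dot y y + 2 * y ord0 j * h + h ^+ 2))^-1)); last first.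
  apply/funext => h; rewrite /enorm sqnormE !dotE (dotC y (ebasis R j)) !ebasis_dot mxE !eqxx /=.
  by congr ((Num.sqrt _)^-1); ring.
have l : is_derive (0 : R) 1 (fun h : R => dot y y + 2 * y ord0 j * h + h ^+ 2) (2 * y ord0 j).
  by apply: is_derive_eq; rewrite /GRing.scale /=; ring.
have q0 : dot y y + 2 * y ord0 j * 0 + 0 ^+ 2 = dot y y by ring.
pose f (h : R) := dot y y + 2 * y ord0 j * h + h ^+ 2.
have f0 : 0 < f 0 by rewrite /f q0.
pose s h := Num.sqrt (f h).
have d2 : is_derive (0 : R) 1 s _ :=
  is_derive_comp1 (is_derive1_sqrt f0) (l : is_derive _ _ f _).
have nE : Num.sqrt (dot y y) = enorm y by rewrite /enorm sqnormE.
have sf : s 0 = enorm y by rewrite /s /f q0 nE.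
have sf0 : s 0 != 0 by rewrite sf gt_eqF.
have d3 := is_deriveV sf0 d2.
apply: is_derive_eq; rewrite /GRing.scale /= -/(s 0) sf; field.
by rewrite gt_eqF.
Qed.

Lemma is_derive_sev (e : sexpr) y (j : 'I_m) : y != 0 ->
  is_derive y (ebasis R j) (sev e) (sev (sder j e) y).
Proof.
move=> y0; elim: e => [c|k||e1 d1 e2 d2|e1 d1 e2 d2] /=.
- exact: is_derive_cst.
- exact: is_derive_coord.
- have d := is_derive_inv_enorm j y0; apply: is_derive_eq; ring.
- exact: is_deriveD.
- by have d := is_deriveM d1 d2; apply: is_derive_eq; rewrite /GRing.scale /=; ring.
Qed.

Lemma sum_continuous (I : Type) (r : seq I) (f : I -> V -> R) y :
  (forall i, {for y, continuous (f i)}) ->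
  {for y, continuous (fun y => \sum_(i <- r) f i y)}.
Proof.
move=> cf; elim: r => [|i r IH].
  rewrite (_ : (fun y => _) = cst 0); first exact: cst_continuous.
  by apply/funext => z; rewrite big_nil.
rewrite (_ : (fun y => _) = (fun y => f i y + \sum_(i <- r) f i y)).
  by apply: continuousD; [exact: cf|exact: IH].
by apply/funext => z; rewrite big_cons.
Qed.

Lemma sqnorm_continuous : continuous (@sqnorm R m).
Proof.
move=> y; apply: sum_continuous => j.
by apply: (@continuousM _ _ (fun y : V => y ord0 j) (fun y : V => y ord0 j));
  exact: coord_continuous.
Qed.

Lemma enorm_continuous : continuous (@enorm R m).
Proof.
move=> y; apply: (@continuous_comp _ _ _ (@sqnorm R m) Num.sqrt).
  exact: sqnorm_continuous.
exact: sqrt_continuous.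
Qed.

Lemma sev_continuous (e : sexpr) y : y != 0 -> {for y, continuous (sev e)}.
Proof.
move=> y0; elim: e => [c|k||e1 d1 e2 d2|e1 d1 e2 d2] /=.
- exact: cst_continuous.
- exact: coord_continuous.
- apply: continuousV; first by rewrite gt_eqF// enorm_gt0.
  exact: enorm_continuous.
- exact: continuousD.
- exact: continuousM.
Qed.

Lemma near_neq0 y : y != 0 -> \forall z \near y, z != 0.
Proof.
move=> y0; have /cvgrPdist_lt/(_ _ (enorm_gt0 y0)) := @enorm_continuous y.
apply: filterS => z; apply: contraTneq => ->.
rewrite {2}/enorm sqnormE (_ : dot 0 0 = 0) ?sqrtr0 ?subr0 ?ger0_norm ?ltxx ?sqrtr_ge0//.
by apply/eqP; rewrite dot_eq0.
Qed.

Lemma is_derive_sev_curve (e : sexpr) (x : R -> V) (x' : 'I_m -> R) (t : R) : x t != 0 ->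
  (forall j, is_derive t 1 (fun s => x s ord0 j) (x' j)) ->
  is_derive t 1 (fun s => sev e (x s)) (\sum_j sev (sder j e) (x t) * x' j).
Proof.
move=> xt dx; apply: (is_derive_curve (G := fun j => sev (sder j e))) => //.
  by apply: filterS (near_neq0 xt) => y y0 j; exact: is_derive_sev.
by move=> j; exact: sev_continuous.
Qed.

Definition expressible g := exists e : sexpr, forall y, sev e y = g y.

Lemma expressible_cst c : expressible (fun=> c).
Proof. by exists (SCst c). Qed.

Lemma expressible_coord j : expressible (fun y => y ord0 j).
Proof. by exists (SVar j). Qed.

Lemma expressible_inv_enorm : expressible (fun y => (enorm y)^-1).
Proof. by exists SInv. Qed.

Lemma expressibleM g h : expressible g -> expressible h -> expressible (fun y => g y * h y).
Proof. by move=> [e eg] [f fh]; exists (SMul e f) => y /=; rewrite eg fh. Qed.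

Lemma expressibleX g k : expressible g -> expressible (fun y => g y ^+ k).
Proof.
move=> eg; elim: k => [|k IH]; first exact: expressible_cst.
by have [e he] := expressibleM eg IH; exists e => y; rewrite he exprS.
Qed.

Lemma expressible_sum (I : Type) (r : seq I) (f : I -> V -> R) :
  (forall i, expressible (f i)) -> expressible (fun y => \sum_(i <- r) f i y).
Proof.
move=> ef; elim: r => [|i r [e he]]; first by exists (SCst 0) => y; rewrite big_nil.
by have [e1 h1] := ef i; exists (SAdd e1 e) => y; rewrite big_cons /= h1 he.
Qed.

Lemma expressible_prod (I : Type) (r : seq I) (f : I -> V -> R) :
  (forall i, expressible (f i)) -> expressible (fun y => \prod_(i <- r) f i y).
Proof.
move=> ef; elim: r => [|i r [e he]]; first by exists (SCst 1) => y; rewrite big_nil.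
by have [e1 h1] := ef i; exists (SMul e1 e) => y; rewrite big_cons /= h1 he.
Qed.

Lemma hom_poly_expressible d (F : V -> R) : hom_poly d F -> expressible F.
Proof.
move=> [a [_ FE]].
have [e he] : expressible (fun y => \sum_al a al * \prod_(j < m) y ord0 j ^+ al j).
  apply: expressible_sum => al; apply: expressibleM; first exact: expressible_cst.
  by apply: expressible_prod => j; apply/expressibleX/expressible_coord.
by exists e => y; rewrite he FE.
Qed.

Lemma hom_polyZ d (F : V -> R) k y : hom_poly d F -> F (k *: y) = k ^+ d * F y.
Proof.
move=> [a [ad FE]]; rewrite !FE mulr_sumr; apply: eq_bigr => al _.
have [->|/ad sd] := eqVneq (a al) 0; first by rewrite !mul0r mulr0.
rewrite mulrCA; congr (_ * _); transitivity (k ^+ (\sum_(j < m) al j)%N * \prod_(j < m) y ord0 j ^+ al j).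
  by rewrite -prodrXr -big_split /=; apply: eq_bigr => j _; rewrite mxE exprMn.
by rewrite sd.
Qed.

Lemma hom_ext_poly d (F : V -> R) y : hom_poly d F ->
  hom_ext F y = F y * (enorm y)^-1 ^+ d.
Proof. by move=> hF; rewrite /hom_ext (hom_polyZ _ _ hF) mulrC. Qed.

Lemma hom_ext_expressible d (F : V -> R) : hom_poly d F -> expressible (hom_ext F).
Proof.
move=> hF.
have [e he] := expressibleM (hom_poly_expressible hF) (expressibleX d expressible_inv_enorm).
by exists e => y; rewrite he (hom_ext_poly _ hF).
Qed.

End SmoothExpr.

(** * Great circles *)

Section GreatCircle.
Variables (R : realType) (m : nat).
Local Notation V := 'rV[R]_m.
Implicit Types (p v : V) (t : R).

Definition gcirc p v t : V := cos t *: p + sin t *: v.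
Definition gcirc' p v t : V := - sin t *: p + cos t *: v.

Lemma is_derive_gcirc p v t j :
  is_derive t 1 (fun s => gcirc p v s ord0 j) (gcirc' p v t ord0 j).
Proof.
rewrite (_ : (fun _ => _) = (fun s => cos s * p ord0 j + sin s * v ord0 j)); last first.
  by apply/funext => s; rewrite !mxE.
by apply: is_derive_eq; rewrite /GRing.scale /= !mxE; ring.
Qed.

Lemma is_derive_gcirc' p v t j :
  is_derive t 1 (fun s => gcirc' p v s ord0 j) (- gcirc p v t ord0 j).
Proof.
rewrite (_ : (fun _ => _) = (fun s => - sin s * p ord0 j + cos s * v ord0 j)); last first.
  by apply/funext => s; rewrite !mxE.
by apply: is_derive_eq; rewrite /GRing.scale /= !mxE; ring.
Qed.

Variables (p v : V).
Hypotheses (pp : dot p p = 1) (vv : dot v v = 1) (pv : dot p v = 0).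

Lemma gcirc_sphere t : on_sphere (gcirc p v t).
Proof.
apply/on_sphereE; rewrite !dotE pp vv (dotC v p) pv.
by rewrite -[RHS](cos2Dsin2 t); ring.
Qed.

Lemma gcirc_orth t : [/\ dot (gcirc p v t) (gcirc p v t) = 1,
  dot (gcirc' p v t) (gcirc' p v t) = 1 & dot (gcirc p v t) (gcirc' p v t) = 0].
Proof.
split; first exact/on_sphereE/gcirc_sphere.
  by rewrite !dotE pp vv (dotC v p) pv -[RHS](cos2Dsin2 t); ring.
by rewrite !dotE pp vv (dotC v p) pv; ring.
Qed.

(** The chain rule is applied to the 0-homogeneous extension, which carries the regularity
    hypothesis, then to its partial derivatives; along the circle $\gamma''=-\gamma$. *)
Lemma C2_gcirc (u : V -> R) : C2_sphere u -> exists U1 U2 : R -> R, forall t,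
  is_derive t 1 (fun s => u (gcirc p v s)) (U1 t) /\ is_derive t 1 U1 (U2 t).
Proof.
move=> Cu; pose g := hom_ext u.
have x0 s : gcirc p v s != 0 by apply/sphere_neq0/gcirc_sphere.
pose G j := pderiv g j; pose H j k := pderiv (G j) k.
have dg y (j : 'I_m) : y != 0 -> is_derive y (ebasis R j) g (G j y).
  by move=> /Cu[_ h]; have [h1 _ _ _] := h j j; exact: derivableP.
have dG y (j k : 'I_m) : y != 0 -> is_derive y (ebasis R k) (G j) (H j k y).
  by move=> /Cu[_ h]; have [_ _ h1 _] := h j k; exact: derivableP.
have cG y (j : 'I_m) : y != 0 -> {for y, continuous (G j)}.
  by move=> /Cu[_ h]; have [_ h1 _ _] := h j j.
have cH y (j k : 'I_m) : y != 0 -> {for y, continuous (H j k)}.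
  by move=> /Cu[_ h]; have [_ _ _ h1] := h j k.
exists (fun t => \sum_j G j (gcirc p v t) * gcirc' p v t ord0 j).
exists (fun t => \sum_j ((\sum_k H j k (gcirc p v t) * gcirc' p v t ord0 k) * gcirc' p v t ord0 j
   + G j (gcirc p v t) * - gcirc p v t ord0 j)) => t; split.
  rewrite (_ : (fun s => _) = g \o gcirc p v); last first.
    by apply/funext => s /=; rewrite /g hom_ext_sphere//; exact: gcirc_sphere.
  apply: is_derive_curve => [|j|j]; last exact: is_derive_gcirc.
    by apply: filterS (near_neq0 (x0 t)) => y y0 j; exact: dg.
  exact: cG.
rewrite (_ : (fun t => _) =
    \sum_j (fun t => G j (gcirc p v t) * gcirc' p v t ord0 j)); last first.
  by apply/funext => s; rewrite fct_sumE.
apply: is_derive_sum => j.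
have d1 : is_derive t 1 (G j \o gcirc p v) (\sum_k H j k (gcirc p v t) * gcirc' p v t ord0 k).
  apply: is_derive_curve => [|k|k]; last exact: is_derive_gcirc.
    by apply: filterS (near_neq0 (x0 t)) => y y0 k; exact: dG.
  exact: cH.
have d2 := is_derive_gcirc' p v t j.
by have d3 := is_deriveM d1 d2; apply: is_derive_eq; rewrite /GRing.scale /=; ring.
Qed.

End GreatCircle.

(** * Arc cosine and one-sided limits *)

Section Trigo.
Variable R : realType.
Implicit Types s t x z : R.

Lemma acos_le_cos s z : 0 <= s <= pi -> -1 <= z <= 1 -> cos s <= z -> acos z <= s.
Proof.
move=> s0 z1 sz; rewrite leNgt; apply/negP => lt.
have := @ltr_cos R s (acos z); rewrite !in_itv /= s0 acos_ge0// acos_lepi// => /(_ isT isT).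
by rewrite acosK ?in_itv//= ltNge sz lt.
Qed.

Lemma le_acos_cos s z : 0 <= s <= pi -> -1 <= z <= 1 -> s <= acos z -> z <= cos s.
Proof.
move=> s0 z1 sz; rewrite leNgt; apply/negP => lt.
have := @ltr_cos R (acos z) s; rewrite !in_itv /= s0 acos_ge0// acos_lepi// => /(_ isT isT).
by rewrite acosK ?in_itv//= lt ltNge sz.
Qed.

Lemma acos_le_cosW s z : 0 <= s <= pi -> -1 <= z <= 1 -> acos z <= s -> cos s <= z.
Proof.
move=> s0 z1 sz; rewrite leNgt; apply/negP => lt.
have := @ltr_cos R s (acos z); rewrite !in_itv /= s0 acos_ge0// acos_lepi// => /(_ isT isT).
by rewrite acosK ?in_itv//= lt ltNge sz.
Qed.

Lemma sin_cosB x : sin x = cos (pi / 2 - x).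
Proof. by rewrite -cosN opprB cosBpihalf. Qed.

(** Off the sphere, scalar products and [F] leave $[-1,1]$. Clamping makes their arc cosines
    continuous in the ambient space, as minimisation over the sphere requires here. *)
Definition clamp x : R := Num.max (-1) (Num.min 1 x).

Lemma clamp_itv x : -1 <= clamp x <= 1.
Proof. by rewrite /clamp le_max lexx ge_max ge_min lexx /=; lra. Qed.

Lemma clamp_id x : -1 <= x <= 1 -> clamp x = x.
Proof. by move=> /andP[x1 x2]; rewrite /clamp min_r// max_r. Qed.

Lemma acos_clamp_continuous : continuous (fun x => acos (clamp x)).
Proof.
have ca : {within `[(-1 : R), 1], continuous (@acos R)}.
  rewrite -cospi -[X in `[_, X]]cos0.
  have c2 : {within `[(0 : R), pi], continuous cos}.
    by apply: continuous_subspaceT; exact: continuous_cos.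
  exact: (segment_can_ge_continuous (pi_ge0 R) c2 (@cosK R)).
have cc : continuous clamp.
  move=> x; apply: (@continuous_max _ _ (cst (-1)) (fun x => Num.min 1 x)).
    exact: cst_continuous.
  by apply: (@continuous_min _ _ (cst 1) id) => //; exact: cst_continuous.
move=> x; apply/cvgrPdist_le => e e0.
have cx : `[(-1 : R), 1]%classic (clamp x) by rewrite /= in_itv /= clamp_itv.
move/subspace_continuousP : ca => /(_ _ cx)/cvgrPdist_le/(_ e e0).
rewrite near_withinE => -[d /= d0 H].
have /cvgrPdist_lt/(_ d d0) := cc x.
by apply: filterS => y xy; apply: H => //; rewrite /= in_itv /= clamp_itv.
Qed.

Lemma ge0_at0 (h : R -> R) (l r : R) : 0 < r -> is_derive (0 : R) 1 h l ->
  (forall s, 0 < s < r -> 0 <= h s) -> 0 <= h 0.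
Proof.
move=> r0 dh h0; rewrite leNgt; apply/negP => hneg.
have [d d0 H] := is_derive_approx dh ltr01.
pose s := Num.min (Num.min (r / 2) (d / 2)) (- h 0 / (2 * (`|l| + 1))).
have l0 : 0 < 2 * (`|l| + 1) by rewrite mulr_gt0// ltr_wpDl.
have s0 : 0 < s by rewrite !lt_min !divr_gt0// oppr_gt0.
have : s <= s by []; rewrite {2}/s !le_min => /andP[/andP[sr sd]].
rewrite ler_pdivlMr// => sh.
have := H s; rewrite gtr0_norm// add0r => /(_ ltac:(lra)); rewrite ler_norml => /andP[_].
have := h0 s ltac:(lra); have := ler_norm l => ll.
have : l * s <= `|l| * s by rewrite ler_wpM2r// ltW.
nra.
Qed.

(** Meant for end points of arcs: there the explicit formula for [F] is available on one side
    only. *)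
Lemma is_derive_unique_right (f g : R -> R) (l l' x r : R) : 0 < r ->
  is_derive x 1 f l -> is_derive x 1 g l' ->
  (forall s, x <= s < x + r -> f s = g s) -> l = l'.
Proof.
move=> r0 df dg fg; apply/eqP; rewrite -subr_eq0; apply/negPn/negP => ll.
pose e := `|l - l'| / 4.
have e0 : 0 < e by rewrite divr_gt0// normr_gt0.
have [d1 d10 H1] := is_derive_approx df e0; have [d2 d20 H2] := is_derive_approx dg e0.
pose s := Num.min r (Num.min d1 d2) / 2.
have m0 : 0 < Num.min r (Num.min d1 d2) by rewrite !lt_min r0 d10 d20.
have s0 : 0 < s by rewrite divr_gt0.
have : 2 * s <= Num.min r (Num.min d1 d2) by rewrite /s mulrC divfK.
rewrite !le_min => /and3P[sr sd1 sd2].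
have := H1 s; have := H2 s; rewrite gtr0_norm// => /(_ ltac:(lra)) h2 /(_ ltac:(lra)) h1.
rewrite (fg (x + s)) ?(fg x) in h1; [|lra..].
have : `|(l - l') * s| <= 2 * e * s.
  rewrite (_ : _ * s = (g (x + s) - g x - l' * s) - (g (x + s) - g x - l * s)); last by ring.
  by apply: (le_trans (ler_normB _ _)); lra.
rewrite normrM (gtr0_norm s0) ler_pM2r//.
have : 0 < `|l - l'| by rewrite normr_gt0.
rewrite /e; lra.
Qed.

End Trigo.

(** * Distance on the sphere *)

Section Polar.
Variables (R : realType) (n : nat).
Local Notation V := 'rV[R]_n.+1.
Implicit Types (p q v x y : V).

Lemma dot_sphere_itv p q : dot p p = 1 -> dot q q = 1 -> -1 <= dot p q <= 1.
Proof.
move=> pp qq; have := cauchy_schwarz1 q pp; rewrite (dotC q p) qq => h.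
by apply/andP; split; nra.
Qed.

Lemma sphere_EVT_min (f : V -> R) : (forall y, on_sphere y -> {for y, continuous f}) ->
  exists2 y, on_sphere y & forall z, on_sphere z -> f y <= f z.
Proof.
move=> cf; pose S : set V := [set y | on_sphere y].
have S0 : S !=set0.
  exists (ebasis R ord0); apply/on_sphereE.
  by rewrite ebasis_dot mxE !eqxx.
have cS : compact S.
  apply: bounded_closed_compact.
    exists 1; split=> // M M1 y /on_sphereE yy; apply: (le_trans _ (ltW M1)).
    rewrite [leLHS]/Num.norm /= mx_normrE; apply/bigmax_leP; split=> //= -[k j] _ /=.
    rewrite ord1 -(@ler_pXn2r _ 2)// ?nnegrE// expr1n real_normK ?num_real//.
    by rewrite -yy /dot (bigD1 j)//= -expr2 lerDl sumr_ge0// => i _; rewrite -expr2 sqr_ge0.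
  rewrite (_ : S = @sqnorm R n.+1 @^-1` [set x | x = 1])//.
  by apply: preimage_closed; [move=> y _; exact: sqnorm_continuous|exact: closed_eq].
have [|y yS H] := EVT_min_rV S0 cS (f := f).
  by apply: continuous_in_subspaceT => y; rewrite inE; exact: cf.
by exists y; [rewrite inE in yS|move=> z zS; apply: H; rewrite inE].
Qed.

Hypothesis n0 : (0 < n)%N.

Lemma exists_orth p : dot p p = 1 -> exists2 v, dot v v = 1 & dot p v = 0.
Proof.
move=> pp; pose j : 'I_n.+1 := ord_max.
suff [w w0 pw] : exists2 w, w != 0 & dot p w = 0.
  exists ((enorm w)^-1 *: w); first exact/on_sphereE/normalize_sphere.
  by rewrite dotZr pw mulr0.
have j0 : ord0 != j by rewrite -val_eqE /= eq_sym -lt0n.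
have [p0|p0] := eqVneq (p ord0 ord0) 0.
  exists (ebasis R ord0); last by rewrite dotC ebasis_dot.
  by rewrite -dot_eq0 ebasis_dot mxE !eqxx oner_eq0.
exists (p ord0 j *: ebasis R ord0 - p ord0 ord0 *: ebasis R j); last first.
  by rewrite !dotE !(dotC p) !ebasis_dot; ring.
apply/negP => /eqP/rowP/(_ j); rewrite !mxE !eqxx eq_sym (negbTE j0) /= mulr0 mulr1 sub0r.
by move=> /eqP; rewrite oppr_eq0 (negbTE p0).
Qed.

Lemma polar p q : dot p p = 1 -> dot q q = 1 ->
  exists v, [/\ dot v v = 1, dot p v = 0 & q = gcirc p v (acos (dot p q))].
Proof.
move=> pp qq; set c := dot p q.
have c1 : -1 <= c <= 1 by exact: dot_sphere_itv.
have [w0|w0] := eqVneq (q - c *: p) 0.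
  have [v vv pv] := exists_orth pp; exists v; split=> //.
  have cc : c ^+ 2 = 1.
    have qE : q = c *: p by apply/eqP; rewrite -subr_eq0 w0.
    by move: qq; rewrite qE !dotE pp => <-; ring.
  rewrite /gcirc acosK ?in_itv//= sin_acos// cc subrr sqrtr0 scale0r addr0.
  by apply/eqP; rewrite -subr_eq0 w0.
have ww : dot (q - c *: p) (q - c *: p) = 1 - c ^+ 2.
  by rewrite !dotE pp qq (dotC q p) -/c; ring.
have wp := dot_gt0 w0; rewrite ww in wp.
have s0 : Num.sqrt (1 - c ^+ 2) != 0 by rewrite gt_eqF// sqrtr_gt0.
exists ((Num.sqrt (1 - c ^+ 2))^-1 *: (q - c *: p)); split.
- rewrite dotZl dotZr ww -[X in _ * (_ * X)](sqr_sqrtr (ltW wp)); field; exact: s0.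
- by rewrite dotZr !dotE pp -/c; ring.
rewrite /gcirc acosK ?in_itv//= sin_acos// scalerA divff// scale1r.
by rewrite addrC subrK.
Qed.

(** Triangle inequality for the spherical distance. By Bessel, the component of [x] along [v] is at
    least minus the sine of the distance from [x] to [y]; the addition formula for the cosine does
    the rest. *)
Lemma acos_gcirc_le x y v (s : R) : dot x x = 1 -> dot y y = 1 -> dot v v = 1 -> dot y v = 0 ->
  0 <= s -> acos (dot x (gcirc y v s)) <= acos (dot x y) + s.
Proof.
move=> xx yy vv yv s0.
have xy1 := dot_sphere_itv xx yy.
have xg1 : -1 <= dot x (gcirc y v s) <= 1.
  by apply: dot_sphere_itv => //; apply/on_sphereE/gcirc_sphere.
have a0 := acos_ge0 xy1.
have [spi|spi] := leP (acos (dot x y) + s) pi; last first.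
  by apply: le_trans (ltW spi); exact: acos_lepi.
apply: acos_le_cos => //; first by rewrite addr_ge0.
rewrite cosD acosK ?in_itv//= sin_acos// /gcirc !dotE.
have ss : 0 <= sin s by apply: sin_ge0_pi; rewrite s0 /=; lra.
have b := bessel2 x yy vv yv; rewrite xx in b.
have : - dot x v <= Num.sqrt (1 - dot x y ^+ 2).
  apply: (le_trans (ler_norm _)); rewrite normrN -sqrtr_sqr.
  by apply: ler_wsqrtr; lra.
nra.
Qed.

End Polar.

(** * Isoparametric functions and meridians *)

Section Isoparametric.
Variables (R : realType) (n d : nat) (F : 'rV[R]_n.+1 -> R).
Local Notation V := 'rV[R]_n.+1.
Hypotheses (hF : hom_poly d F) (d0 : (0 < d)%N).
Hypothesis hgrad : forall x, on_sphere x -> gradsq F x = d%:R ^+ 2.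
Implicit Types (x y p v : V).

Definition grad y : V := \row_j pderiv F j y.

Lemma is_derive_grad y j : y != 0 -> is_derive y (ebasis R j) F (grad y ord0 j).
Proof.
move=> y0; have [e /funext eF] := hom_poly_expressible hF; rewrite mxE /pderiv -eF.
by have [h1 h2] := is_derive_sev e j y0; exact: derivableP.
Qed.

Lemma is_derive_F_curve (x : R -> V) (x' : R -> V) (t : R) : x t != 0 ->
  (forall j, is_derive t 1 (fun s => x s ord0 j) (x' t ord0 j)) ->
  is_derive t 1 (fun s => F (x s)) (dot (grad (x t)) (x' t)).
Proof.
move=> x0 dx; have [e /funext eF] := hom_poly_expressible hF.
have dd := is_derive_sev_curve e x0 dx; rewrite eF in dd; apply: (is_derive_eq dd).
apply: eq_bigr => j _; congr (_ * _).
have [_ <-] := is_derive_sev e j x0; have [_ <-] := is_derive_grad j x0.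
by rewrite eF.
Qed.

Lemma F_continuous y : y != 0 -> {for y, continuous F}.
Proof.
by move=> y0; have [e /funext eF] := hom_poly_expressible hF; rewrite -eF; exact: sev_continuous.
Qed.

Lemma grad_sphere y : on_sphere y -> dot (grad y) (grad y) = d%:R ^+ 2.
Proof.
move=> yS; rewrite -(hgrad yS).
by apply: eq_bigr => j _; rewrite mxE expr2.
Qed.

Lemma euler y : y != 0 -> dot (grad y) y = d%:R * F y.
Proof.
move=> y0.
have d1 : is_derive (1 : R) 1 (fun s => F (s *: y)) (dot (grad (1 *: y)) y).
  apply: (is_derive_F_curve (x := fun s => s *: y) (x' := fun=> y)).
    by rewrite scale1r.
  move=> j; rewrite (_ : (fun _ => _) = (fun s : R => s * y ord0 j)).
    by apply: is_derive_eq; rewrite /GRing.scale /=; ring.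
  by apply/funext => s; rewrite mxE.
rewrite scale1r in d1; apply: (is_derive_unique d1).
rewrite (_ : (fun _ => _) = horner (F y *: 'X^d)).
  apply: (is_derive_eq (is_derive_horner _ _)).
  by rewrite derivZ derivXn hornerZ hornerMn hornerXn expr1n mulrC.
by apply/funext => s; rewrite (hom_polyZ _ _ hF) hornerZ hornerXn mulrC.
Qed.

(** By Euler's identity $dF$ is the radial component of a gradient of norm $d$. *)
Lemma F_sphere_itv y : on_sphere y -> -1 <= F y <= 1.
Proof.
move=> yS; have /on_sphereE yy := yS.
have := cauchy_schwarz1 (grad y) yy; rewrite euler ?sphere_neq0// grad_sphere//.
rewrite exprMn ger_pMr ?exprn_gt0 ?ltr0n// => h.
by apply/andP; split; nra.
Qed.

Section Circle.
Variables (p v : V).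
Hypotheses (pp : dot p p = 1) (vv : dot v v = 1) (pv : dot p v = 0).

Definition circ_slope (t : R) : R := dot (grad (gcirc p v t)) (gcirc' p v t).

Lemma is_derive_F_gcirc (t : R) : is_derive t 1 (fun s => F (gcirc p v s)) (circ_slope t).
Proof.
apply: is_derive_F_curve => [|j]; first exact/sphere_neq0/gcirc_sphere.
exact: is_derive_gcirc.
Qed.

Lemma circ_slope_bound (t : R) : circ_slope t ^+ 2 <= d%:R ^+ 2 * (1 - F (gcirc p v t) ^+ 2).
Proof.
have [g1 g2 g3] := gcirc_orth pp vv pv t; have gS := gcirc_sphere pp vv pv t.
have := bessel2 (grad (gcirc p v t)) g1 g2 g3.
rewrite -/(circ_slope t) euler ?sphere_neq0// grad_sphere// exprMn; lra.
Qed.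

(* [acos (k F)] is [d]-Lipschitz along great circles; the factor [k < 1] keeps the
   argument away from the singularities of [acos]. *)
Lemma acos_F_lipschitz (k t s : R) : 0 < k < 1 -> t <= s ->
  `|acos (k * F (gcirc p v s)) - acos (k * F (gcirc p v t))| <= d%:R * (s - t).
Proof.
move=> k01; rewrite le_eqVlt => /predU1P[->|ts]; first by rewrite !subrr normr0 mulr0.
pose g (r : R) := F (gcirc p v r).
have g1 r : -1 <= g r <= 1 by exact/F_sphere_itv/gcirc_sphere.
have kg r : -1 < k * g r < 1 by have := g1 r; move=> /andP[h1 h2]; apply/andP; split; nra.
have kg2 r : 0 < 1 - (k * g r) ^+ 2 by have := kg r; move=> /andP[h1 h2]; nra.
pose A (r : R) := acos (k * g r).
have dA (r : R) : is_derive r 1 A (- (Num.sqrt (1 - (k * g r) ^+ 2))^-1 * (k * circ_slope r)).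
  have dg := is_derive_F_gcirc r.
  have dk : is_derive r 1 (fun s => k * g s) (k * circ_slope r).
    by apply: is_derive_eq; rewrite /GRing.scale /=; ring.
  exact: (is_derive_comp1 (is_derive1_acos (kg r) : is_derive ((fun s => k * g s) r) _ _ _) dk).
have [r _ E] := MVT_is_derive ts (fun r _ => dA r).
rewrite -/(A s) -/(A t) E normrM (gtr0_norm (_ : 0 < s - t)) ?subr_gt0//.
rewrite ler_pM2r ?subr_gt0// normrM normrN normfV (ger0_norm (sqrtr_ge0 _)).
rewrite mulrC ler_pdivrMr ?sqrtr_gt0//.
rewrite -(@ler_pXn2r _ 2)// ?nnegrE ?mulr_ge0 ?sqrtr_ge0//.
rewrite real_normK ?num_real// exprMn [leRHS]exprMn (sqr_sqrtr (ltW (kg2 r))).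
have := circ_slope_bound r; rewrite -/(g r) => b.
have D : 0 <= d%:R ^+ 2 :> R by exact: sqr_ge0.
have k2 : 0 <= k ^+ 2 <= 1 by have /andP[h1 h2] := k01; apply/andP; split; nra.
apply: (@le_trans _ _ (k ^+ 2 * (d%:R ^+ 2 * (1 - g r ^+ 2)))).
  by rewrite ler_wpM2l//; case/andP: k2.
by rewrite mulrCA ler_wpM2l// exprMn; have /andP[h1 h2] := k2; nra.
Qed.

(** The Lipschitz bound from the zero at [0] gives $F\le\sin(dt)$, and from the maximum at [L] it
    gives $F\ge\cos(d(L-t))$. At [L] the first forces $dL=\pi/2$, after which the two bounds
    coincide. *)
Lemma F_gcirc_sin (L : R) : 0 <= L <= pi / (2 * d%:R) ->
  F (gcirc p v 0) = 0 -> F (gcirc p v L) = 1 ->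
  L = pi / (2 * d%:R) /\ forall t : R, 0 <= t <= L -> F (gcirc p v t) = sin (d%:R * t).
Proof.
move=> /andP[L0 Ld] F0 FL.
have D0 : 0 < d%:R :> R by rewrite ltr0n.
have dL : d%:R * L <= pi / 2.
  by move: Ld; rewrite ler_pdivlMr ?mulr_gt0// => h; lra.
have pi0 := pi_gt0 R.
have up (t : R) : 0 <= t <= L -> F (gcirc p v t) <= sin (d%:R * t).
  move=> /andP[t0 tL].
  have dt : 0 <= d%:R * t by rewrite mulr_ge0.
  have dtL : d%:R * t <= d%:R * L by rewrite ler_wpM2l.
  (* The factor required by the Lipschitz bound is taken as [cos s], whose arc cosine is [s]; the
     inequality is then carried to [s = 0]. *)
  pose h (s : R) := sin (d%:R * t) - cos s * F (gcirc p v t).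
  suff : 0 <= h 0 by rewrite /h cos0 mul1r subr_ge0.
  have dh : is_derive (0 : R) 1 h 0.
    by apply: is_derive_eq; rewrite /GRing.scale /= sin0; ring.
  apply: (ge0_at0 (r := pi / 2) _ dh) => [|s s0]; first lra.
  have cs : 0 < cos s < 1.
    rewrite cos_gt0_pihalf ?andTb; last lra.
    by rewrite -cos0 ltr_cos ?in_itv//=; lra.
  have Fi := F_sphere_itv (gcirc_sphere pp vv pv t).
  have := acos_F_lipschitz cs t0; rewrite F0 mulr0 acos0 subr0 ler_norml => /andP[lo _].
  have Fc : -1 <= cos s * F (gcirc p v t) <= 1.
    by have /andP[c1 c2] := cs; have /andP[f1 f2] := Fi; apply/andP; split; nra.
  rewrite /h subr_ge0 sin_cosB; apply: le_acos_cos => //; lra.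
have lo (t : R) : 0 <= t <= L -> cos (d%:R * (L - t)) <= F (gcirc p v t).
  move=> /andP[t0 tL].
  have dt : 0 <= d%:R * (L - t) by rewrite mulr_ge0// subr_ge0.
  have dtL : d%:R * (L - t) <= d%:R * L by rewrite ler_wpM2l//; lra.
  pose h (s : R) := cos s * F (gcirc p v t) - cos (s + d%:R * (L - t)).
  suff : 0 <= h 0 by rewrite /h cos0 mul1r add0r subr_ge0.
  have dh : is_derive (0 : R) 1 h (sin (d%:R * (L - t))).
    have l : is_derive (0 : R) 1 (fun s => s + d%:R * (L - t)) 1.
      by apply: is_derive_eq; rewrite ?addr0.
    have dc := is_derive_comp1 (is_derive_cos _ : is_derive ((fun s => s + d%:R * (L - t)) 0) _ _ _) l.
    by apply: is_derive_eq; rewrite /GRing.scale /= sin0 add0r; ring.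
  apply: (ge0_at0 (r := pi / 2) _ dh) => [|s s0]; first lra.
  have cs : 0 < cos s < 1.
    rewrite cos_gt0_pihalf ?andTb; last lra.
    by rewrite -cos0 ltr_cos ?in_itv//=; lra.
  have Fi := F_sphere_itv (gcirc_sphere pp vv pv t).
  have := acos_F_lipschitz cs tL; rewrite FL mulr1 ler_norml => /andP[_ hi].
  have sK : acos (cos s) = s by apply: cosK; rewrite in_itv /=; lra.
  move: hi; rewrite sK => hi.
  have := acos_F_lipschitz cs tL; rewrite FL mulr1 sK ler_norml => /andP[lo' _].
  have Fc : -1 <= cos s * F (gcirc p v t) <= 1.
    by have /andP[c1 c2] := cs; have /andP[f1 f2] := Fi; apply/andP; split; nra.
  rewrite /h subr_ge0; apply: acos_le_cosW => //; lra.
have LE : d%:R * L = pi / 2.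
  have := up L; rewrite L0 lexx FL => /(_ isT) h.
  apply/eqP; rewrite eq_le dL /= leNgt; apply/negP => lt.
  have : sin (d%:R * L) < sin (pi / 2).
    have dL0 : 0 <= d%:R * L by rewrite mulr_ge0// ltW.
    by rewrite ltr_sin// in_itv /=; lra.
  by rewrite sin_pihalf ltNge h.
split; first by rewrite -(mulKf (_ : d%:R != 0 :> R) L) ?gt_eqF// LE; field; rewrite gt_eqF.
move=> t tL; apply/eqP; rewrite eq_le up//=; apply: le_trans (lo t tL).
by rewrite mulrBr LE -sin_cosB.
Qed.

End Circle.

Hypothesis n0 : (0 < n)%N.

(* Minimising [acos <x, y> + lam * acos (F y)] with [lam > 1 / d]: moving along the
   gradient decreases the second term faster than the first can grow, so a minimiser
   lies in [F = 1] (or in [F = -1], which is too expensive). *)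
Lemma penalised_min x (lam : R) : on_sphere x -> F x = 0 -> d%:R^-1 < lam ->
  exists y, [/\ on_sphere y, F y = 1 & forall z, on_sphere z ->
    acos (dot x y) <= acos (dot x z) + lam * acos (F z)].
Proof.
move=> xS Fx lamd; have /on_sphereE xx := xS.
have D0 : 0 < d%:R :> R by rewrite ltr0n.
have lam0 : 0 < lam by apply: lt_trans lamd; rewrite invr_gt0.
pose Phi y := acos (clamp (dot x y)) + lam * acos (clamp (F y)).
have PhiE y : on_sphere y -> Phi y = acos (dot x y) + lam * acos (F y).
  move=> yS; rewrite /Phi !clamp_id//; first exact: F_sphere_itv.
  by apply: dot_sphere_itv => //; apply/on_sphereE.
have [y yS ymin] : exists2 y, on_sphere y & forall z, on_sphere z -> Phi y <= Phi z.
  apply: sphere_EVT_min => y yS.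
  have c1 : {for y, continuous (fun y => acos (clamp (dot x y)))}.
    apply: (@continuous_comp _ _ _ (dot x) (fun r => acos (clamp r))).
      apply: sum_continuous => j; apply: continuousM; first exact: cst_continuous.
      exact: coord_continuous.
    exact: acos_clamp_continuous.
  have c2 : {for y, continuous (fun y => acos (clamp (F y)))}.
    apply: (@continuous_comp _ _ _ F (fun r => acos (clamp r))).
      exact/F_continuous/sphere_neq0.
    exact: acos_clamp_continuous.
  apply: continuousD => //; apply: continuousM => //; exact: cst_continuous.
have /on_sphereE yy := yS.
have Fi := F_sphere_itv yS.
have {}ymin z : on_sphere z -> acos (dot x y) + lam * acos (F y) <= acos (dot x z) + lam * acos (F z).
  by move=> zS; rewrite -!PhiE// ymin.
have pi0 := pi_gt0 R.
have Fy1 : F y = 1.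
  apply/eqP; apply: contraT => Fy1; exfalso.
  have [Fy2|Fy2] := eqVneq (F y) (-1).
    (* The cost is at least $\lambda\pi$ at such a point and only $\lambda\pi/2$ at [x]. *)
    have := ymin x xS; rewrite Fx Fy2 xx acos1 acos0 acosN1.
    have := acos_ge0 (dot_sphere_itv xx yy); nra.
  have {}Fi : -1 < F y < 1 by rewrite !lt_neqAle eq_sym Fy2 Fy1.
  have s0 : 0 < 1 - F y ^+ 2 by have /andP[h1 h2] := Fi; nra.
  pose s := Num.sqrt (1 - F y ^+ 2).
  have sp : 0 < s by rewrite sqrtr_gt0.
  have s2 : s ^+ 2 = 1 - F y ^+ 2 by rewrite sqr_sqrtr// ltW.
  have Ey := euler (sphere_neq0 yS); have Gy := grad_sphere yS.
  (* Spherical gradient, of norm $d\sqrt{1-F^2}$: in its direction [acos F] decreases at rate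
     exactly [d]. *)
  pose w := grad y - (d%:R * F y) *: y.
  have ww : dot w w = (d%:R * s) ^+ 2.
    by rewrite /w !dotE (dotC y) Ey Gy yy exprMn s2; ring.
  have yw : dot y w = 0 by rewrite /w !dotE (dotC y) Ey yy; ring.
  pose v := (d%:R * s)^-1 *: w.
  have vv : dot v v = 1 by rewrite /v dotZl dotZr ww; field; rewrite !gt_eqF.
  have yv : dot y v = 0 by rewrite /v dotZr yw mulr0.
  have Gv : dot (grad y) v = d%:R * s.
    have -> : dot (grad y) v = (d%:R * s)^-1 * (dot w w + d%:R * F y * dot y w).
      by rewrite /v dotZr {3}/w dotDl dotNl dotZl subrK.
    by rewrite ww yw; field; rewrite !gt_eqF.
  have g0 : gcirc y v 0 = y by rewrite /gcirc cos0 sin0 scale1r scale0r addr0.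
  have g'0 : gcirc' y v 0 = v by rewrite /gcirc' cos0 sin0 oppr0 scale1r scale0r add0r.
  have dF := is_derive_F_gcirc yy vv yv 0.
  rewrite /circ_slope g0 g'0 Gv in dF.
  have Fi0 : -1 < (fun r => F (gcirc y v r)) 0 < 1 by rewrite g0.
  have dA := is_derive_comp1 (is_derive1_acos Fi0) dF.
  rewrite g0 -/s in dA.
  have {dA} dA : is_derive (0 : R) 1 (fun r => acos (F (gcirc y v r))) (- d%:R).
    by apply: is_derive_eq; field; rewrite gt_eqF.
  (* With this accuracy the penalty drops by at least $(\lambda d+1)r/2>r$ over a length [r], while
     the distance grows by at most [r]. *)
  have e0 : 0 < (d%:R - lam^-1) / 2.
    by rewrite divr_gt0// subr_gt0 -[ltRHS]invrK ltf_pV2 ?posrE ?invr_gt0.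
  have [del del0 H] := is_derive_approx dA e0.
  pose r := del / 2.
  have r0 : 0 < r by rewrite divr_gt0.
  have := H r; rewrite gtr0_norm// add0r g0 => /(_ ltac:(rewrite /r; lra)).
  rewrite ler_norml => /andP[_ h1].
  have gS := gcirc_sphere yy vv yv r.
  have := ymin _ gS; have := acos_gcirc_le xx yy vv yv (ltW r0).
  have h2 : lam * (acos (F (gcirc y v r)) - acos (F y)) <=
      lam * ((d%:R - lam^-1) / 2 * r - d%:R * r) by apply: ler_wpM2l; [exact: ltW|lra].
  have h3 : lam * ((d%:R - lam^-1) / 2 * r - d%:R * r) = - (lam * d%:R + 1) / 2 * r.
    by field; rewrite gt_eqF.
  have h4 : 1 < lam * d%:R by rewrite -ltr_pdivrMr// mul1r.
  nra.
exists y; split=> // z zS; have := ymin z zS.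
by rewrite Fy1 acos1 mulr0 addr0.
Qed.

(** Comparison with [x] bounds the distance to a penalised minimiser by $\lambda\pi/2$, for each
    $\lambda>1/d$. Every minimiser is a nearest point of $F=1$, so that distance is the same for all
    $\lambda$ and cannot exceed the limit $\pi/(2d)$. *)
Lemma near_max x : on_sphere x -> F x = 0 ->
  exists y, [/\ on_sphere y, F y = 1 & acos (dot x y) <= pi / (2 * d%:R)].
Proof.
move=> xS Fx; have /on_sphereE xx := xS.
have D0 : 0 < d%:R :> R by rewrite ltr0n.
have pi0 := pi_gt0 R.
have D1 : 0 < d%:R^-1 :> R by rewrite invr_gt0.
have piE : pi / (2 * d%:R) = d%:R^-1 * (pi / 2) :> R by field; rewrite gt_eqF.
have [|y [yS Fy ymin]] := @penalised_min x (2 * d%:R^-1) xS Fx; first lra.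
exists y; split=> //; rewrite leNgt; apply/negP => lt.
set D := acos (dot x y) in lt ymin *.
(* The weight is the midpoint of $1/d$ and $2D/\pi$, the latter being the value at which
   $\lambda\pi/2$ equals [D]. *)
have [|z [zS Fz zmin]] := @penalised_min x ((d%:R^-1 + D * 2 / pi) / 2) xS Fx.
  rewrite piE in lt.
  have : d%:R^-1 < D * 2 / pi by rewrite ltr_pdivlMr//; lra.
  lra.
have := ymin z zS; have := zmin x xS; rewrite Fz Fx acos1 acos0 xx acos1 add0r mulr0 addr0.
have -> : (d%:R^-1 + D * 2 / pi) / 2 * (pi / 2) = (pi / (2 * d%:R) + D) / 2 :> R.
  by field; try lra; apply/andP; split; lra.
lra.
Qed.

(** On the arc to the nearest maximum the slope at [x] is $d$, the full norm of the gradient, so the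
    arc leaves along the gradient. Knowing this direction is what later allows two halves to be
    glued. *)
Lemma half_meridian x : on_sphere x -> F x = 0 ->
  forall t : R, 0 <= t <= pi / (2 * d%:R) ->
  F (gcirc x (d%:R^-1 *: grad x) t) = sin (d%:R * t).
Proof.
move=> xS Fx; have /on_sphereE xx := xS.
have D0 : 0 < d%:R :> R by rewrite ltr0n.
have [y [yS Fy xy]] := near_max xS Fx; have /on_sphereE yy := yS.
have [v [vv xv yE]] := polar n0 xx yy.
have x0 : gcirc x v 0 = x by rewrite /gcirc cos0 sin0 scale1r scale0r addr0.
have xy0 : 0 <= acos (dot x y) <= pi / (2 * d%:R) by rewrite acos_ge0// dot_sphere_itv.
have [] := F_gcirc_sin xx vv xv xy0; rewrite ?x0 -?yE// => LE Fsin.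
have L0 : 0 < pi / (2 * d%:R) :> R by rewrite divr_gt0 ?pi_gt0 ?mulr_gt0.
rewrite LE in Fsin.
suff -> : d%:R^-1 *: grad x = v by exact: Fsin.
have d1 := is_derive_F_gcirc xx vv xv 0.
have d2 : is_derive (0 : R) 1 (fun t => sin (d%:R * t)) d%:R.
  have l : is_derive (0 : R) 1 (fun t : R => d%:R * t) d%:R.
    by apply: is_derive_eq; rewrite /GRing.scale /=; ring.
  have dd := is_derive_comp1 (is_derive_sin _ : is_derive ((fun t : R => d%:R * t) 0) _ _ _) l.
  by apply: is_derive_eq; rewrite mulr0 cos0 mul1r.
have := is_derive_unique_right L0 d1 d2; rewrite add0r => E.
have {}E : circ_slope x v 0 = d%:R by apply: E => s /andP[s0 sL]; rewrite Fsin// s0 ltW.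
have x'0 : gcirc' x v 0 = v by rewrite /gcirc' cos0 sin0 oppr0 scale1r scale0r add0r.
rewrite /circ_slope x0 x'0 in E.
apply/eqP; rewrite -subr_eq0 -dot_eq0 !dotE (dotC v) E (grad_sphere xS) vv.
by apply/eqP; field; rewrite gt_eqF.
Qed.

End Isoparametric.

(** * Extrema in one variable and substitution of the arc sine *)

Section OneVariable.
Variable R : realType.

Lemma is_derive_min0 (f : R -> R) (l r : R) : 0 < r -> is_derive (0 : R) 1 f l ->
  (forall s : R, `|s| < r -> f 0 <= f s) -> l = 0.
Proof.
move=> r0 df fmin; apply/eqP; apply: contraT => l0.
have e0 : 0 < `|l| / 2 by rewrite divr_gt0// normr_gt0.
have [d d0 H] := is_derive_approx df e0.
pose s := - Num.sg l * (Num.min r d / 2).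
have m0 : 0 < Num.min r d by rewrite lt_min r0.
have sabs : `|s| = Num.min r d / 2.
  by rewrite /s normrM normrN normr_sg l0 mul1r gtr0_norm// divr_gt0.
have : Num.min r d / 2 < r /\ Num.min r d / 2 < d.
  have : Num.min r d <= r /\ Num.min r d <= d by rewrite !ge_min !lexx orbT.
  by move=> [h1 h2]; split; lra.
rewrite -sabs => -[sr sd].
have := H s sd; have := fmin s sr; rewrite add0r ler_norml => h1 /andP[_ h2].
have : l * s = - (`|l| * `|s|).
  by rewrite sabs /s mulNr mulrN mulrA (mulrC l) -normrEsg.
have : 0 < `|l| * `|s| by rewrite mulr_gt0 ?normr_gt0// -normr_gt0 sabs divr_gt0.
nra.
Qed.

Lemma second_order_min (f f1 : R -> R) (l r : R) : 0 < r ->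
  (forall s : R, `|s| < r -> is_derive s 1 f (f1 s)) -> is_derive (0 : R) 1 f1 l ->
  (forall s : R, `|s| < r -> f 0 <= f s) -> 0 <= l.
Proof.
move=> r0 df df1 fmin; rewrite leNgt; apply/negP => l0.
have f10 : f1 0 = 0.
  by apply: (is_derive_min0 r0 _ fmin); apply: df; rewrite normr0.
have [|d d0 H] := @is_derive_approx R _ _ _ df1 (- l / 2); first lra.
pose s := Num.min r d / 2.
have m0 : 0 < Num.min r d by rewrite lt_min r0.
have [h1 h2] : Num.min r d <= r /\ Num.min r d <= d by rewrite !ge_min !lexx orbT.
have s0 : 0 < s by rewrite divr_gt0.
have [sr sd] : s < r /\ s < d by rewrite /s; split; lra.
have [t /andP[t0 ts]|t /andP[t0 ts] E] := @MVT_is_derive R f f1 0 s s0.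
  by apply: df; rewrite ger0_norm//; lra.
have := H t; rewrite gtr0_norm// add0r f10 subr0 => /(_ ltac:(lra)).
rewrite ler_norml => /andP[_ h3].
have := fmin s; rewrite gtr0_norm// => /(_ sr).
have lt0 : l * t < 0 by rewrite nmulr_rlt0.
have f1n : f1 t < 0 by lra.
have : f1 t * s < 0 by rewrite nmulr_rlt0.
by move: E; rewrite subr0; lra.
Qed.

(* Near a strict one-sided extremum [c] of [g] every value of [g] is taken on both
   sides of [c], so a function of [g] cannot be strictly monotone at [c]. *)
Lemma function_of_max_derive0 (g U : R -> R) (c l : R) : continuous g ->
  (forall t, g t <= g c) -> (forall s t, g s = g t -> U s = U t) ->
  is_derive c 1 U l -> l = 0.
Proof.
move=> cg gmax gU dU; apply/eqP; apply: contraT => l0; exfalso.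
have e0 : 0 < `|l| / 2 by rewrite divr_gt0// normr_gt0.
have [d d0 H] := is_derive_approx dU e0.
have l2 : 0 < l ^+ 2 by rewrite exprn_even_gt0.
have P h : 0 < h < d -> l * (U (c + h) - U c) > 0.
  move=> /andP[h0 hd]; have := H h; rewrite gtr0_norm// => /(_ hd) K.
  have : `|l * (U (c + h) - U c - l * h)| <= l ^+ 2 / 2 * h.
    rewrite normrM -[l ^+ 2]real_normK ?num_real// expr2 -!mulrA ler_wpM2l//.
    by rewrite mulrA.
  by rewrite ler_norml => /andP[k1 _]; nra.
have N h : 0 < h < d -> l * (U (c - h) - U c) < 0.
  move=> /andP[h0 hd]; have := H (- h); rewrite normrN gtr0_norm// => /(_ hd) K.
  have : `|l * (U (c - h) - U c - l * - h)| <= l ^+ 2 / 2 * h.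
    rewrite normrM -[l ^+ 2]real_normK ?num_real// expr2 -!mulrA ler_wpM2l//.
    by rewrite mulrA.
  by rewrite ler_norml => /andP[_ k1]; nra.
have r0 : 0 < d / 2 < d by lra.
have /andP[r00 _] := r0.
have gp h : 0 < h < d -> g (c + h) < g c.
  move=> hd; rewrite lt_neqAle gmax andbT; apply/eqP => /gU E.
  by have := P h hd; rewrite E subrr mulr0 ltxx.
have gn h : 0 < h < d -> g (c - h) < g c.
  move=> hd; rewrite lt_neqAle gmax andbT; apply/eqP => /gU E.
  by have := N h hd; rewrite E subrr mulr0 ltxx.
pose m := Num.max (g (c + d / 2)) (g (c - d / 2)).
have mc : m < g c by rewrite gt_max gp ?gn.
have cw a b : {within `[a, b], continuous g} by exact: continuous_subspaceT.
have [|s1 s1I gs1] := @IVT R g c (c + d / 2) m ltac:(lra) (cw _ _).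
  by apply/andP; split; [rewrite ge_min /m !le_max lexx /= orbT|rewrite le_max (ltW mc)].
have [|s2 s2I gs2] := @IVT R g (c - d / 2) c m ltac:(lra) (cw _ _).
  by apply/andP; split; [rewrite ge_min /m !le_max lexx /= orbT|rewrite le_max (ltW mc) orbT].
have s1c : s1 != c by apply: contraTneq mc => <-; rewrite gs1 ltxx.
have s2c : s2 != c by apply: contraTneq mc => <-; rewrite gs2 ltxx.
move: s1I s2I; rewrite !in_itv /= => /andP[a1 a2] /andP[a3 a4].
have {}a1 : c < s1 by rewrite lt_neqAle eq_sym s1c.
have {}a4 : s2 < c by rewrite lt_neqAle s2c.
have := P (s1 - c) ltac:(lra); have := N (c - s2) ltac:(lra).
have -> : c + (s1 - c) = s1 by ring.
have -> : c - (c - s2) = s2 by ring.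
rewrite (gU s1 s2) ?gs1 ?gs2//.
by move=> k1 k2; have := lt_trans k1 k2; rewrite ltxx.
Qed.

Lemma asinN (x : R) : -1 <= x <= 1 -> asin (- x) = - asin x.
Proof.
move=> x1; have [h1 h2] := asin_def x1; rewrite -{1}h2 -sinN sinK// in_itv /=.
by have /andP[? ?] := h1; lra.
Qed.

Variable d : R.
Hypothesis d0 : 0 < d.
Local Notation L := (pi / (2 * d)).

(** With $x=\sin(dt)$ the derivative in $x$ is $U'(t)/(d\cos(dt))$. Near [L] the numerator is
    $O(L-t)$ because $U'(L)=0$, while $\cos(dt)=\sin(d(L-t))\ge d(L-t)/2$. *)
Lemma asin_end_bound (U U1 U2 : R -> R) :
  (forall t : R, is_derive t 1 U (U1 t) /\ is_derive t 1 U1 (U2 t)) -> U1 L = 0 ->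
  exists C del : R, 0 < del /\ forall x : R, 0 <= x < 1 -> 1 - del < x ->
    `|U (asin x / d)| <= C /\ `|U1 (asin x / d) / (d * Num.sqrt (1 - x ^+ 2))| <= C.
Proof.
move=> dU U1L; have [dL dL1] := dU L.
have pi0 := pi_gt0 R.
have L0 : 0 < L by rewrite divr_gt0 ?mulr_gt0.
have dLE : d * L = pi / 2 by field; rewrite gt_eqF.
have [e1 e10 H1] := is_derive_approx dL ltr01.
have [e2 e20 H2] := is_derive_approx dL1 ltr01.
have ds : is_derive (0 : R) 1 (@sin R) 1 by have := is_derive_sin (0 : R); rewrite cos0.
have half0 : 0 < 2^-1 :> R by rewrite invr_gt0.
have [e3 e30 H3] := is_derive_approx ds half0.
pose e := Num.min (Num.min e1 e2) (Num.min (e3 / d) L).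
have e0 : 0 < e by rewrite !lt_min e10 e20 L0 divr_gt0.
have : e <= e by []; rewrite {2}/e !le_min => /andP[/andP[ee1 ee2] /andP[ee3 eL]].
rewrite ler_pdivlMr// in ee3.
pose K1 := `|U L| + (`|U1 L| + 1) * L; pose K2 := 2 * (`|U2 L| + 1) / d ^+ 2.
exists (Num.max K1 K2), (1 - sin (d * (L - e))); split.
  have : sin (d * (L - e)) < sin (pi / 2).
    rewrite ltr_sin ?in_itv /=; [by rewrite -dLE ltr_pM2l//; lra| |lra].
    have : 0 <= d * (L - e) by rewrite mulr_ge0 ?(ltW d0)//; lra.
    have : d * (L - e) <= d * L by rewrite ler_wpM2l ?(ltW d0)//; lra.
    by rewrite dLE; lra.
  by rewrite sin_pihalf subr_gt0.
move=> x x1 xs; have xb : -1 <= x <= 1 by lra.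
have [ab sx] := asin_def xb; set t := asin x / d.
have dt : d * t = asin x by rewrite /t; field; rewrite gt_eqF.
have tL : t < L.
  by rewrite -(ltr_pM2l d0) dt dLE asin_ltpi2//; lra.
have te : L - e < t.
  rewrite -(ltr_pM2l d0) dt; have : sin (d * (L - e)) < sin (asin x) by rewrite sx; lra.
  rewrite ltr_sin ?in_itv//=.
  have : 0 <= d * (L - e) by rewrite mulr_ge0 ?(ltW d0)//; lra.
  have : d * (L - e) <= d * L by rewrite ler_wpM2l ?(ltW d0)//; lra.
  by rewrite dLE; lra.
have tabs : `|t - L| = L - t by rewrite ltr0_norm; lra.
have tLE : L + (t - L) = t by ring.
split; rewrite le_max; apply/orP; [left|right].
  have := H1 (t - L); rewrite tLE tabs => /(_ ltac:(lra)) h.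
  have a1 : `|U t| <= `|U t - U L - U1 L * (t - L)| + `|U1 L * (t - L)| + `|U L|.
    rewrite {1}(_ : U t = (U t - U L - U1 L * (t - L)) + U1 L * (t - L) + U L); last by ring.
    by apply: (le_trans (ler_normD _ _)); rewrite lerD2r ler_normD.
  rewrite normrM tabs in a1; apply: (le_trans a1); rewrite /K1.
  have a2 : `|U1 L| * (L - t) <= `|U1 L| * L by rewrite ler_wpM2l//; lra.
  have a3 : `|U t - U L - U1 L * (t - L)| <= L by lra.
  have a4 : (`|U1 L| + 1) * L = `|U1 L| * L + L by rewrite mulrDl mul1r.
  rewrite a4 addrC; apply: lerD => //; rewrite addrC; apply: lerD; [exact: a2|exact: a3].
have sq : Num.sqrt (1 - x ^+ 2) = sin (d * (L - t)).
  by rewrite -cos_asin// mulrBr dLE dt sin_cosB opprB addrC subrK.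
have sge : d * (L - t) / 2 <= sin (d * (L - t)).
  have q0 : 0 <= d * (L - t) by rewrite mulr_ge0 ?(ltW d0)//; lra.
  have q1 : d * (L - t) < e3.
    apply: lt_le_trans ee3; rewrite mulrC ltr_pM2r//; lra.
  have := H3 (d * (L - t)); rewrite add0r sin0 subr0 mul1r ger0_norm// => /(_ q1).
  by rewrite ler_norml => /andP[h _]; lra.
have := H2 (t - L); rewrite tLE tabs U1L subr0 => /(_ ltac:(lra)) h.
have U1b : `|U1 t| <= (`|U2 L| + 1) * (L - t).
  rewrite -[U1 t](subrK (U2 L * (t - L))); apply: (le_trans (ler_normD _ _)).
  by rewrite normrM tabs; lra.
have den : 0 < d * (d * (L - t) / 2) by rewrite mulr_gt0// divr_gt0// mulr_gt0//; lra.
have den2 : d * (d * (L - t) / 2) <= d * sin (d * (L - t)) by rewrite ler_pM2l.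
rewrite sq normrM normfV (gtr0_norm (lt_le_trans den den2)).
rewrite ler_pdivrMr ?(lt_le_trans den den2)//; apply: (le_trans U1b).
apply: (@le_trans _ _ (K2 * (d * (d * (L - t) / 2)))); last first.
  by rewrite ler_wpM2l// /K2 divr_ge0 ?mulr_ge0 ?exprn_ge0// ?addr_ge0// ltW.
by rewrite le_eqVlt; apply/orP; left; apply/eqP; rewrite /K2; field; rewrite gt_eqF.
Qed.

Definition asin_d1 (U1 : R -> R) (x : R) : R := U1 (asin x / d) / (d * Num.sqrt (1 - x ^+ 2)).
Definition asin_d2 (U1 U2 : R -> R) (x : R) : R :=
  U2 (asin x / d) / (d * Num.sqrt (1 - x ^+ 2)) ^+ 2
  + U1 (asin x / d) * x / (d * Num.sqrt (1 - x ^+ 2) ^+ 3).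

Lemma profile_asin (phi U U1 U2 : R -> R) :
  (forall t : R, is_derive t 1 U (U1 t) /\ is_derive t 1 U1 (U2 t)) ->
  U1 L = 0 -> U1 (- L) = 0 ->
  (forall x : R, -1 < x < 1 -> phi x = U (asin x / d)) ->
  profile phi (asin_d1 U1) (asin_d2 U1 U2).
Proof.
move=> dU UL UL' phiE.
have [C [e [e0 H]]] := asin_end_bound dU UL.
(* The end $-1$ is the end $1$ of the reflected function. *)
have [||C' [e' [e'0 H']]] := @asin_end_bound (fun t => U (- t)) (fun t => - U1 (- t))
    (fun t => U2 (- t)).
- move=> t; have [h1 h2] := dU (- t).
  have lN : is_derive t 1 (fun t : R => - t) (-1) by apply: is_derive_eq.
  have k1 := is_derive_comp1 (h1 : is_derive ((fun t : R => - t) t) _ _ _) lN.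
  have k2 := is_derive_comp1 (h2 : is_derive ((fun t : R => - t) t) _ _ _) lN.
  by split; apply: is_derive_eq; ring.
- by rewrite UL' oppr0.
have bnd x : -1 < x < 1 -> 1 - Num.min 1 (Num.min e e') < `|x| ->
    `|phi x| <= Num.max C C' /\ `|asin_d1 U1 x| <= Num.max C C'.
  move=> x1 xe; rewrite phiE// !le_max.
  have [m1 m2] : Num.min 1 (Num.min e e') <= e /\ Num.min 1 (Num.min e e') <= e'.
    by rewrite !ge_min !lexx !orbT.
  have [x0|x0] := leP 0 x.
    rewrite ger0_norm// in xe.
    by have [h1 h2] := H x ltac:(lra) ltac:(lra); rewrite h1 /asin_d1 h2.
  rewrite ltr0_norm// in xe.
  have [h1 h2] := H' (- x) ltac:(lra) ltac:(lra).
  rewrite asinN ?mulNr ?opprK in h1 h2; [|lra..].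
  rewrite sqrrN normrN in h2.
  by rewrite h1 /asin_d1 h2 !orbT.
have m0 : 0 < Num.min 1 (Num.min e e') by rewrite !lt_min ltr01 e0.
split; first last.
- by exists (Num.max C C'), (Num.min 1 (Num.min e e')); split=> // x x1 xe; have [] := bnd x x1 xe.
- by exists (Num.max C C'), (Num.min 1 (Num.min e e')); split=> // x x1 xe; have [] := bnd x x1 xe.
move=> x x1; have pos : 0 < 1 - x ^+ 2 by have /andP[? ?] := x1; nra.
have sp : 0 < Num.sqrt (1 - x ^+ 2) by rewrite sqrtr_gt0.
have s2 : Num.sqrt (1 - x ^+ 2) ^+ 2 = 1 - x ^+ 2 by rewrite sqr_sqrtr// ltW.
have [h1 h2] := dU (asin x / d).
have da : is_derive x 1 (fun x => asin x / d) ((Num.sqrt (1 - x ^+ 2))^-1 / d).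
  have := is_derive1_asin x1 => dd; apply: is_derive_eq; rewrite /GRing.scale /=; ring.
have k1 := is_derive_comp1 (h1 : is_derive ((fun x => asin x / d) x) _ _ _) da.
have k2 := is_derive_comp1 (h2 : is_derive ((fun x => asin x / d) x) _ _ _) da.
have r0 : 0 < Num.min (1 - x) (1 + x) by rewrite lt_min; lra.
split.
  apply: (is_derive_near_eq (f := fun x => U (asin x / d)) r0).
    move=> y; rewrite lt_min !ltr_norml => /andP[h3 h4]; rewrite phiE//; lra.
  by apply: is_derive_eq; rewrite /asin_d1; field; rewrite !gt_eqF.
have dp : is_derive x 1 (fun x : R => 1 - x ^+ 2) (- 2 * x).
  by apply: is_derive_eq; rewrite /GRing.scale /=; ring.
pose P (x : R) := 1 - x ^+ 2.
have dsq : is_derive x 1 (fun x => Num.sqrt (P x)) _ :=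
  is_derive_comp1 (is_derive1_sqrt (pos : 0 < P x)) (dp : is_derive x 1 P _).
pose S (x : R) := d * Num.sqrt (1 - x ^+ 2).
have dS : is_derive x 1 S (- d * x / Num.sqrt (1 - x ^+ 2)).
  have dd := is_deriveM (is_derive_cst d x 1) dsq.
  by apply: (is_derive_eq dd); rewrite /GRing.scale /= /P; field; rewrite gt_eqF.
have S0 : S x != 0 by rewrite /S gt_eqF// mulr_gt0.
have dV := is_deriveV S0 dS.
rewrite /asin_d1; have dm := is_deriveM k2 dV.
apply: (is_derive_eq dm); rewrite /GRing.scale /= /asin_d2 /S; field.
by rewrite !gt_eqF.
Qed.

End OneVariable.

(** * Extreme values of F and the full meridian *)

Section Meridian.
Variables (R : realType) (n d : nat) (F : 'rV[R]_n.+1 -> R).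
Local Notation V := 'rV[R]_n.+1.
Hypotheses (hF : hom_poly d F) (d0 : (0 < d)%N).
Hypothesis hgrad : forall x, on_sphere x -> gradsq F x = d%:R ^+ 2.
Implicit Types (x y z p v : V).

Lemma hom_polyN : hom_poly d (fun x => - F x).
Proof.
have [a [ad FE]] := hF; exists [ffun al => - a al]; split.
  by move=> al; rewrite ffunE oppr_eq0; exact: ad.
by move=> x; rewrite FE -sumrN; apply: eq_bigr => al _; rewrite ffunE mulNr.
Qed.

Lemma gradN y : y != 0 -> grad (fun x => - F x) y = - grad F y.
Proof.
move=> y0; apply/rowP => j; rewrite !mxE /pderiv.
have [h1 h2] := is_derive_grad hF j y0.
by rewrite (@deriveN _ _ _ F).
Qed.

Lemma gradsqN y : on_sphere y -> gradsq (fun x => - F x) y = d%:R ^+ 2.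
Proof.
move=> yS; rewrite -(hgrad yS); apply: eq_bigr => j _.
have := gradN (sphere_neq0 yS) => /rowP/(_ j); rewrite !mxE => ->.
by rewrite sqrrN.
Qed.

(** At a minimum the spherical gradient vanishes, and its squared norm is $d^2(1-F^2)$. *)
Lemma min_on_sphere y : on_sphere y -> (forall z, on_sphere z -> F y <= F z) -> F y ^+ 2 = 1.
Proof.
move=> yS ymin; have /on_sphereE yy := yS.
have Ey := euler hF (sphere_neq0 yS); have Gy := grad_sphere hgrad yS.
pose w := grad F y - (d%:R * F y) *: y.
have yw : dot y w = 0 by rewrite /w !dotE (dotC y) Ey yy; ring.
have ww : dot w w = d%:R ^+ 2 * (1 - F y ^+ 2).
  by rewrite /w !dotE (dotC y) Ey Gy yy; ring.
have [w0|w0] := eqVneq w 0.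
  move: ww; rewrite w0 (_ : dot 0 0 = 0); last by apply/eqP; rewrite dot_eq0.
  move=> /esym/eqP; rewrite mulf_eq0 sqrf_eq0 pnatr_eq0 (gtn_eqF d0) /=.
  by rewrite subr_eq0 => /eqP.
exfalso.
have e0 := enorm_gt0 w0.
pose v := (enorm w)^-1 *: w.
have vv : dot v v = 1 by apply/on_sphereE/normalize_sphere.
have yv : dot y v = 0 by rewrite dotZr yw mulr0.
have dF := is_derive_F_gcirc hF yy vv yv 0.
have g0 : gcirc y v 0 = y by rewrite /gcirc cos0 sin0 scale1r scale0r addr0.
have g'0 : gcirc' y v 0 = v by rewrite /gcirc' cos0 sin0 oppr0 scale1r scale0r add0r.
have := is_derive_min0 ltr01 dF; rewrite /circ_slope g0 g'0 => H.
have {}H : dot (grad F y) v = 0 by apply: H => s _; apply: ymin; exact: gcirc_sphere.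
have : dot w w = 0.
  rewrite {1}/w dotDl dotNl dotZl yw mulr0 oppr0 addr0.
  by move/eqP: H; rewrite dotZr mulf_eq0 invr_eq0 gt_eqF//= => /eqP.
by move/eqP; rewrite dot_eq0 (negbTE w0).
Qed.

End Meridian.

Section Meridian2.
Variables (R : realType) (n d : nat) (F : 'rV[R]_n.+1 -> R).
Local Notation V := 'rV[R]_n.+1.
Hypotheses (hF : hom_poly d F) (d0 : (0 < d)%N) (n0 : (0 < n)%N).
Hypothesis hgrad : forall x, on_sphere x -> gradsq F x = d%:R ^+ 2.
Hypothesis Fnc : exists x y : V, [/\ on_sphere x, on_sphere y & F x != F y].
Implicit Types (x y z p v : V).

(** The extreme values are $-1$ and $1$, being distinct with square $1$; the intermediate value
    theorem applies on a great circle through points where they are attained. *)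
Lemma exists_zero : exists2 x, on_sphere x & F x = 0.
Proof.
have hFN := hom_polyN hF; have hgN := gradsqN hF hgrad.
have [y yS ymin] : exists2 y, on_sphere y & forall z, on_sphere z -> F y <= F z.
  by apply: sphere_EVT_min => y yS; exact/(F_continuous hF)/sphere_neq0.
have [z zS zmin] : exists2 z, on_sphere z & forall x, on_sphere x -> - F z <= - F x.
  by apply: sphere_EVT_min => z zS; exact/(F_continuous hFN)/sphere_neq0.
have Fy := min_on_sphere hF d0 hgrad yS ymin.
have Fz := min_on_sphere hFN d0 hgN zS zmin.
have [x1 [x2 [x1S x2S x12]]] := Fnc.
have bd x : on_sphere x -> F y <= F x <= F z.
  by move=> xS; rewrite ymin//= -lerN2 zmin.
have Fyz : F y < F z.
  have /andP[h1 h2] := bd _ x1S; have /andP[h3 h4] := bd _ x2S.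
  rewrite lt_neqAle (le_trans h1 h2) andbT; apply: contra_neq x12 => E.
  by apply/eqP; rewrite eq_le; apply/andP; split; lra.
have Fy1 : F y = -1 by move/eqP: Fy; rewrite sqrf_eq1 => /orP[]/eqP// E; move: Fz; nra.
have Fz1 : F z = 1 by move/eqP: Fz; rewrite sqrrN sqrf_eq1 => /orP[]/eqP// E; lra.
have /on_sphereE yy := yS; have /on_sphereE zz := zS.
have [v [vv yv zE]] := polar n0 yy zz.
have g0 : gcirc y v 0 = y by rewrite /gcirc cos0 sin0 scale1r scale0r addr0.
have [|||c _ Fc] := @IVT R (fun t => F (gcirc y v t)) 0 (acos (dot y z)) 0.
- by apply: acos_ge0; exact: dot_sphere_itv.
- apply: continuous_subspaceT => t; apply: is_derive_continuous.
  exact: (is_derive_F_gcirc hF yy vv yv t).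
- by rewrite -zE g0 Fy1 Fz1 ge_min le_max; apply/andP; split; apply/orP; [left|right]; lra.
by exists (gcirc y v c) => //; exact: gcirc_sphere.
Qed.

(** From a zero, the half meridians of [F] and of [- F] leave in opposite directions, hence form one
    arc of a great circle. *)
Lemma meridian : exists p v, [/\ dot p p = 1, dot v v = 1, dot p v = 0 &
  forall t : R, - (pi / (2 * d%:R)) <= t <= pi / (2 * d%:R) -> F (gcirc p v t) = sin (d%:R * t)].
Proof.
have [x xS Fx] := exists_zero; have /on_sphereE xx := xS.
have D0 : d%:R != 0 :> R by rewrite pnatr_eq0 -lt0n.
exists x, (d%:R^-1 *: grad F x); split=> //.
- by rewrite dotZl dotZr (grad_sphere hgrad xS); field.
- by rewrite dotZr dotC (euler hF (sphere_neq0 xS)) Fx !mulr0.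
move=> t /andP[t1 t2]; have [t0|t0] := leP 0 t.
  by apply: (half_meridian hF d0 hgrad n0) => //; rewrite t0.
have := half_meridian (hom_polyN hF) d0 (gradsqN hF hgrad) n0 xS _ (t := - t).
rewrite Fx oppr0 (gradN hF) ?sphere_neq0// => /(_ erefl) H.
have {}H := H ltac:(lra); apply: oppr_inj; rewrite -sinN -mulrN -H; congr (- F _).
by rewrite /gcirc cosN sinN scalerN scaleNr scalerN opprK.
Qed.

End Meridian2.

(** * Invariant functions in the profile variable *)

Section Invariant.
Variables (R : realType) (n d : nat) (c : R) (F : 'rV[R]_n.+1 -> R).
Local Notation V := 'rV[R]_n.+1.
Hypotheses (hF : hom_poly d F) (d0 : (0 < d)%N).
Hypothesis hgrad : forall x, on_sphere x -> gradsq F x = d%:R ^+ 2.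
Hypothesis hlap : forall x, on_sphere x -> lap F x = c * d%:R ^+ 2 / 2.
Implicit Types (x y z u : V).

Lemma is_derive_inv_enormX y j k : y != 0 ->
  is_derive y (ebasis R j) (fun y : V => (enorm y)^-1 ^+ k)
    (- k%:R * (enorm y)^-1 ^+ k.+2 * y ord0 j).
Proof.
move=> y0; elim: k => [|k IH].
  rewrite (_ : (fun _ => _) = cst 1); last by apply/funext => z; rewrite expr0.
  by rewrite oppr0 !mul0r; exact: is_derive_cst.
rewrite (_ : (fun _ => _) = (fun y : V => (enorm y)^-1) * (fun y : V => (enorm y)^-1 ^+ k)); last first.
  by apply/funext => z; rewrite exprS.
apply: (is_derive_eq (is_deriveM (is_derive_inv_enorm j y0) IH)).
rewrite /GRing.scale /= -[k.+1%:R]natr1 !exprS; ring.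
Qed.

(** Partial derivative of $F(y)/|y|^d$, the 0-homogeneous extension of a form of degree $d$. *)
Definition hom_ext_der (j : 'I_n.+1) y : R :=
  grad F y ord0 j * (enorm y)^-1 ^+ d - d%:R * F y * (enorm y)^-1 ^+ d.+2 * y ord0 j.

Lemma is_derive_hom_ext y j : y != 0 ->
  is_derive y (ebasis R j) (hom_ext F) (hom_ext_der j y).
Proof.
move=> y0.
rewrite (_ : hom_ext F = F * (fun y : V => (enorm y)^-1 ^+ d)); last first.
  by apply/funext => z; rewrite (hom_ext_poly _ hF).
apply: (is_derive_eq (is_deriveM (is_derive_grad hF j y0) (is_derive_inv_enormX j d y0))).
rewrite /GRing.scale /= /hom_ext_der; ring.
Qed.

Lemma is_derive_pderiv y j : y != 0 ->
  is_derive y (ebasis R j) (fun y => grad F y ord0 j) (pderiv (pderiv F j) j y).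
Proof.
move=> y0; have [e /funext eF] := hom_poly_expressible hF.
have E z : z != 0 -> sev (sder j e) z = grad F z ord0 j.
  move=> z0; have [_ <-] := is_derive_sev e j z0; have [_ <-] := is_derive_grad hF j z0.
  by rewrite eF.
have nE : \forall z \near y, sev (sder j e) z = grad F z ord0 j.
  by apply: filterS (near_neq0 y0) => z; exact: E.
have dE := near_eq_is_derive nE (is_derive_sev (sder j e) j y0).
rewrite (_ : pderiv (pderiv F j) j y = sev (sder j (sder j e)) y)//.
have [_ <-] := dE; congr ('D_(ebasis R j) _ y); by apply/funext => z; rewrite mxE.
Qed.

Lemma is_derive_hom_ext_der x j : on_sphere x ->
  is_derive x (ebasis R j) (hom_ext_der j)
    (pderiv (pderiv F j) j x - 2 * d%:R * (grad F x ord0 j * x ord0 j) - d%:R * F x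
     + d%:R * (d%:R + 2) * F x * (x ord0 j * x ord0 j)).
Proof.
move=> xS; have x0 := sphere_neq0 xS.
have h1 := is_deriveM (is_derive_pderiv j x0) (is_derive_inv_enormX j d x0).
have h2 := is_deriveM (is_deriveM (is_deriveM (is_derive_cst (d%:R : R) x (ebasis R j))
  (is_derive_grad hF j x0)) (is_derive_inv_enormX j d.+2 x0)) (is_derive_coord x j j).
apply: (is_derive_eq (is_deriveB h1 h2)).
have v1 : (cst d%:R * F * (fun y : V => (enorm y)^-1 ^+ d.+2)) x =
  d%:R * F x * (enorm x)^-1 ^+ d.+2 by [].
have v2 : (cst d%:R * F) x = d%:R * F x by [].
rewrite v1 v2 /GRing.scale /= enorm1// invr1 !expr1n eqxx /cst /= -[d.+2%:R]natr1 -[d.+1%:R]natr1; ring.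
Qed.

Lemma sum_hom_ext_der_sqr x : on_sphere x ->
  \sum_j hom_ext_der j x ^+ 2 = d%:R ^+ 2 * (1 - F x ^+ 2).
Proof.
move=> xS; have /on_sphereE xx := xS.
have Ex := euler hF (sphere_neq0 xS); have Gx := grad_sphere hgrad xS.
transitivity (dot (grad F x - (d%:R * F x) *: x) (grad F x - (d%:R * F x) *: x)).
  apply: eq_bigr => j _; rewrite /hom_ext_der enorm1// invr1 !expr1n !mulr1 expr2.
  by rewrite !mxE.
by rewrite !dotE (dotC x) Ex Gx xx; ring.
Qed.

Lemma hom_ext_der_dot x : on_sphere x -> \sum_j hom_ext_der j x * x ord0 j = 0.
Proof.
move=> xS; have /on_sphereE xx := xS.
transitivity (dot (grad F x - (d%:R * F x) *: x) x).
  apply: eq_bigr => j _; rewrite /hom_ext_der enorm1// invr1 !expr1n !mulr1.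
  by rewrite !mxE.
by rewrite !dotE (euler hF (sphere_neq0 xS)) xx; ring.
Qed.

Definition hom_ext_der2 j x : R :=
  pderiv (pderiv F j) j x - 2 * d%:R * (grad F x ord0 j * x ord0 j) - d%:R * F x
     + d%:R * (d%:R + 2) * F x * (x ord0 j * x ord0 j).

Lemma sum_hom_ext_der2 x : on_sphere x ->
  \sum_j hom_ext_der2 j x = c * d%:R ^+ 2 / 2 - d%:R * (d%:R + n%:R - 1) * F x.
Proof.
move=> xS; have /on_sphereE xx := xS.
rewrite big_split /= 2!sumrB -!mulr_sumr -/(lap F x) hlap//.
rewrite -/(dot (grad F x) x) -/(dot x x) xx (euler hF (sphere_neq0 xS)).
rewrite sumr_const card_ord -mulr_natl -natr1; ring.
Qed.

Lemma near_F_itv x : on_sphere x -> -1 < F x < 1 -> \forall y \near x, y != 0 /\ -1 < hom_ext F y < 1.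
Proof.
move=> xS Fx; have x0 := sphere_neq0 xS.
have [e /funext eF] := hom_ext_expressible hF.
have ce : {for x, continuous (hom_ext F)} by rewrite -eF; exact: sev_continuous.
have r0 : 0 < Num.min (1 - F x) (1 + F x) by rewrite lt_min; lra.
have /cvgrPdist_lt/(_ _ r0) := ce.
rewrite hom_ext_sphere// => H; near=> y; split; first by near: y; exact: near_neq0.
have : `|F x - hom_ext F y| < Num.min (1 - F x) (1 + F x) by near: y.
by rewrite lt_min !ltr_norml => /andP[/andP[? ?] /andP[? ?]]; lra.
Unshelve. all: by end_near. Qed.

(** $\Delta(\varphi\circ f)=\varphi''|\nabla f|^2+\varphi'\Delta f$, with $|\nabla f|^2=d^2(1-f^2)$
    and $\Delta f=cd^2/2-d(n+d-1)f$; dividing by $d^2$ produces the Jacobi parameters. *)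
Lemma sph_lap_profile (w : V -> R) (phi phi1 phi2 : R -> R) x :
  (forall x, on_sphere x -> w x = phi (F x)) ->
  (forall t : R, -1 < t < 1 -> is_derive t 1 phi (phi1 t) /\ is_derive t 1 phi1 (phi2 t)) ->
  on_sphere x -> -1 < F x < 1 ->
  sph_lap w x = d%:R ^+ 2 * jop ((n%:R + d%:R - 1) / d%:R) (c / 2) phi1 phi2 (F x).
Proof.
move=> wE dphi xS Fx; have x0 := sphere_neq0 xS.
have D0 : d%:R != 0 :> R by rewrite pnatr_eq0 -lt0n.
have gE y : y != 0 -> hom_ext w y = phi (hom_ext F y).
  by move=> y0; rewrite /hom_ext wE//; exact: normalize_sphere.
have comp (f f' : R -> R) y j : (forall t : R, -1 < t < 1 -> is_derive t 1 f (f' t)) ->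
    y != 0 -> -1 < hom_ext F y < 1 ->
    is_derive y (ebasis R j) (fun y => f (hom_ext F y)) (f' (hom_ext F y) * hom_ext_der j y).
  move=> df y0 Fy; apply/is_derive_line0.
  have h1 := (is_derive_line0 _ _ _ _).1 (is_derive_hom_ext j y0).
  have h2 := df _ Fy; pose L (h : R) := hom_ext F (h *: ebasis R j + y).
  have L0 : L 0 = hom_ext F y by rewrite /L scale0r add0r.
  rewrite -L0 in h2 *; exact: (is_derive_comp1 h2 (h1 : is_derive _ _ L _)).
have near2 : \forall y \near x, y != 0 /\ -1 < hom_ext F y < 1 by exact: near_F_itv.
have Fx' : -1 < hom_ext F x < 1 by rewrite hom_ext_sphere.
rewrite /sph_lap /lap.
transitivity (\sum_j (phi2 (F x) * hom_ext_der j x ^+ 2 + phi1 (F x) * hom_ext_der2 j x)).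
  apply: eq_bigr => j _.
  have pE y : y != 0 -> -1 < hom_ext F y < 1 ->
      pderiv (hom_ext w) j y = phi1 (hom_ext F y) * hom_ext_der j y.
    move=> y0 Fy; rewrite /pderiv.
    have nE : \near y, phi (hom_ext F y) = hom_ext w y.
      by apply: filterS (near_neq0 y0) => z z0; rewrite gE.
    have [_ <-] := near_eq_is_derive nE (comp phi phi1 y j (fun t t1 => (dphi t t1).1) y0 Fy).
    by [].
  have nE : \near x, phi1 (hom_ext F x) * hom_ext_der j x = pderiv (hom_ext w) j x.
    by apply: filterS near2 => y [y0 Fy]; rewrite pE.
  have h1 := comp phi1 phi2 x j (fun t t1 => (dphi t t1).2) x0 Fx'.
  have h2 := is_derive_hom_ext_der j xS.
  have [_ E] := near_eq_is_derive nE (is_deriveM h1 h2).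
  rewrite {1}/pderiv E /GRing.scale /= hom_ext_sphere// /hom_ext_der2; ring.
rewrite big_split /= -!mulr_sumr sum_hom_ext_der_sqr// sum_hom_ext_der2// /jop.
by field.
Qed.

Variables (p v : V).
Hypotheses (pp : dot p p = 1) (vv : dot v v = 1) (pv : dot p v = 0).
Local Notation L := (@pi R / (2 * d%:R)).
Hypothesis Fsin : forall t : R, - L <= t <= L -> F (gcirc p v t) = sin (d%:R * t).

(** On $[-1,1]$ this agrees with any function witnessing [f_invariant]; defining it through the
    meridian makes the regularity of [u] available. *)
Definition prof (u : V -> R) (t : R) : R := u (gcirc p v (asin t / d%:R)).

Lemma prof_point (t : R) : -1 <= t <= 1 -> F (gcirc p v (asin t / d%:R)) = t.
Proof.
move=> t1; have D0 : 0 < d%:R :> R by rewrite ltr0n.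
have [/andP[h1 h2] h3] := asin_def t1.
have LE : d%:R * L = pi / 2 by field; rewrite gt_eqF.
have tE : d%:R * (asin t / d%:R) = asin t by field; rewrite gt_eqF.
rewrite Fsin ?tE//; apply/andP; split.
  by rewrite -(ler_pM2l D0) mulrN LE tE.
by rewrite -(ler_pM2l D0) LE tE.
Qed.

Lemma prof_invariant (u : V -> R) : f_invariant F u ->
  forall x, on_sphere x -> u x = prof u (F x).
Proof.
move=> [phi uE] x xS; rewrite /prof !uE//; last exact: gcirc_sphere.
by rewrite prof_point//; exact: (F_sphere_itv hF d0 hgrad).
Qed.

(** The arc sine is singular at $\pm1$, so the derivative along the circle has to vanish at $\pm L$.
    It does, because there [F] is extremal on the whole circle and [u] is a function of [F]. *)
Lemma prof_profile (u : V -> R) : f_invariant F u -> C2_sphere u ->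
  exists phi1 phi2, profile (prof u) phi1 phi2.
Proof.
move=> uF uC; have uE := prof_invariant uF.
have D0 : 0 < d%:R :> R by rewrite ltr0n.
have pi0 := pi_gt0 R.
have L0 : 0 < L by rewrite divr_gt0// mulr_gt0.
have LE : d%:R * L = pi / 2 by field; rewrite gt_eqF.
have [U1 [U2 dU]] := C2_gcirc pp vv pv uC.
have cg : continuous (fun t => F (gcirc p v t)).
  by move=> t; apply: is_derive_continuous; exact: (is_derive_F_gcirc hF pp vv pv t).
have gS t := gcirc_sphere pp vv pv t.
have gU s t : F (gcirc p v s) = F (gcirc p v t) -> u (gcirc p v s) = u (gcirc p v t).
  by move=> E; rewrite !uE// E.
have FL : F (gcirc p v L) = 1 by rewrite Fsin ?LE ?sin_pihalf//; lra.
have FNL : F (gcirc p v (- L)) = -1 by rewrite Fsin ?mulrN ?LE ?sinN ?sin_pihalf//; lra.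
exists (asin_d1 d%:R U1), (asin_d2 d%:R U1 U2).
apply: (profile_asin D0 dU) => //.
- have [dL _] := dU L.
  apply: (function_of_max_derive0 cg _ gU dL) => t; rewrite FL.
  by have /andP[] := F_sphere_itv hF d0 hgrad (gS t).
- have [dL _] := dU (- L).
  apply: (function_of_max_derive0 (g := fun t => - F (gcirc p v t)) _ _ _ dL).
  + by move=> t; apply: continuousN; exact: cg.
  + move=> t; rewrite FNL lerN2.
    by have /andP[] := F_sphere_itv hF d0 hgrad (gS t).
  + by move=> s t /oppr_inj; exact: gU.
Qed.

(** A profile vanishing inside makes [u] vanish on the open meridian and, by continuity, at its end
    points; invariance spreads this to the whole sphere, including $F=\pm1$. *)
Lemma prof_neq0 (u : V -> R) : f_invariant F u -> C2_sphere u ->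
  (exists x, on_sphere x /\ u x != 0) -> exists2 t : R, -1 < t < 1 & prof u t != 0.
Proof.
move=> uF uC [x [xS ux]]; apply: contrapT => H.
have z (t : R) : -1 < t < 1 -> prof u t = 0.
  by move=> t1; apply/eqP/negPn/negP => h; apply: H; exists t.
have uE := prof_invariant uF.
have D0 : 0 < d%:R :> R by rewrite ltr0n.
have pi0 := pi_gt0 R.
have L0 : 0 < L by rewrite divr_gt0// mulr_gt0.
have LE : d%:R * L = pi / 2 by field; rewrite gt_eqF.
have [U1 [U2 dU]] := C2_gcirc pp vv pv uC.
have gS t := gcirc_sphere pp vv pv t.
have U0 (t : R) : - L < t < L -> u (gcirc p v t) = 0.
  move=> /andP[t1 t2]; rewrite uE// Fsin; last by rewrite (ltW t1) (ltW t2).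
  have h1 : d%:R * t < pi / 2 by rewrite -LE ltr_pM2l.
  have h2 : - (pi / 2) < d%:R * t by rewrite -LE -mulrN ltr_pM2l.
  have l1 : sin (- (pi / 2)) < sin (d%:R * t) by rewrite ltr_sin ?in_itv//=; lra.
  have l2 : sin (d%:R * t) < sin (pi / 2) by rewrite ltr_sin ?in_itv//=; lra.
  by rewrite sinN sin_pihalf in l1; rewrite sin_pihalf in l2; apply: z; rewrite l1.
have end0 (e : R) : e = 1 \/ e = -1 -> u (gcirc p v (e * L)) = 0.
  move=> e1; pose h (s : R) := u (gcirc p v (e * (L - s))).
  have [dL _] := dU (e * (L - 0)).
  have l : is_derive (0 : R) 1 (fun s => e * (L - s)) (- e).
    by apply: is_derive_eq; rewrite /GRing.scale /=; ring.
  have dh : is_derive (0 : R) 1 h _ := is_derive_comp1 (dL : is_derive ((fun s => e * (L - s)) 0) _ _ _) l.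
  have h0 (s : R) : 0 < s < L -> h s = 0 by move=> s0; apply: U0; case: e1 => ->; lra.
  have k1 : 0 <= h 0 by apply: (ge0_at0 L0 dh) => s s0; rewrite h0.
  have dhN : is_derive (0 : R) 1 (fun s => - h s) _ := is_deriveN dh.
  have k2 : 0 <= - h 0 by apply: (ge0_at0 L0 dhN) => s s0; rewrite h0// oppr0.
  have : h 0 = 0 by lra.
  by rewrite /h subr0.
have asin1 : asin 1 = pi / 2 :> R.
  by rewrite -[X in asin X](@sin_pihalf R) sinK ?in_itv//=; lra.
have := F_sphere_itv hF d0 hgrad xS; rewrite le_eqVlt [X in _ && X]le_eqVlt.
case/andP => /orP[/eqP F1|F1] /orP[/eqP F2|F2].
- lra.
- move/negP: ux; apply; rewrite uE// -F1 /prof.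
  have -> : asin (-1) / d%:R = -1 * L :> R.
    by rewrite asinN ?asin1; [field; rewrite gt_eqF|lra].
  by rewrite end0//; right.
- move/negP: ux; apply; rewrite uE// F2 /prof.
  have -> : asin 1 / d%:R = 1 * L :> R.
    by rewrite asin1; field; rewrite gt_eqF.
  by rewrite end0//; left.
- by move/negP: ux; apply; rewrite uE// z// F1.
Qed.

(* At the minimum point [P] of the 0-homogeneous extension of [F] the Hessian is
   positive semidefinite, so its trace dominates its value [d^2] on the unit tangent
   of the meridian: sum the Hessian over the vectors [w_j e_i - w_i e_j]. *)
Lemma exponent_gt0 : 0 < (n%:R + d%:R - 1) / d%:R + c / 2.
Proof.
have D0 : 0 < d%:R :> R by rewrite ltr0n.
have pi0 := pi_gt0 R.
have L0 : 0 < L by rewrite divr_gt0// mulr_gt0.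
have LE : d%:R * L = pi / 2 by field; rewrite gt_eqF.
have [e /funext eF] := hom_ext_expressible hF.
pose P := gcirc p v (- L); pose w := gcirc' p v (- L).
have [PP ww Pw] : [/\ dot P P = 1, dot w w = 1 & dot P w = 0] by exact: gcirc_orth.
have PS : on_sphere P by exact: gcirc_sphere.
have P0 := sphere_neq0 PS.
have FP : F P = -1 by rewrite /P Fsin ?mulrN ?LE ?sinN ?sin_pihalf//; lra.
pose G j := sev (sder j e); pose H j k := sev (sder k (sder j e)) P.
have GE j y : y != 0 -> G j y = hom_ext_der j y.
  move=> y0; rewrite /G; have [_ <-] := is_derive_sev e j y0; have [_ <-] := is_derive_hom_ext j y0.
  by rewrite eF.
have HE j : H j j = hom_ext_der2 j P.
  rewrite /H /hom_ext_der2; have [_ <-] := is_derive_sev (sder j e) j P0.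
  have nE : \near P, hom_ext_der j P = sev (sder j e) P.
    by apply: filterS (near_neq0 P0) => y y0; rewrite -GE.
  by have [_ <-] := near_eq_is_derive nE (is_derive_hom_ext_der j PS).
(* The trace is the spherical Laplacian of $f$ at a point where $f=-1$. *)
have trE : \sum_j H j j = d%:R ^+ 2 * ((n%:R + d%:R - 1) / d%:R + c / 2).
  under eq_bigr do rewrite HE.
  by rewrite sum_hom_ext_der2// FP; field; rewrite gt_eqF.
pose q z := \sum_j (\sum_k H j k * z ord0 k) * z ord0 j.
have psd z : 0 <= q z.
  pose x (s : R) := s *: z + P.
  (* For parameters below this radius the scalar product with [P] stays nonzero, so the segment
     avoids the origin. *)
  pose r := (`|dot z P| + 1)^-1.
  have r0 : 0 < r by rewrite invr_gt0 ltr_wpDl.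
  have xn0 (s : R) : `|s| < r -> x s != 0.
    move=> sr; apply/negP => /eqP xs; have : dot (x s) P = 0.
      by rewrite xs -(scale0r P) dotZl mul0r.
    rewrite dotDl dotZl PP => E.
    have : `|s * dot z P| < 1.
      rewrite normrM; apply: (@le_lt_trans _ _ (`|s| * (`|dot z P| + 1))).
        by rewrite ler_wpM2l// lerDl.
      by rewrite -ltr_pdivlMr ?ltr_wpDl// mul1r.
    by rewrite (_ : s * dot z P = -1) ?normrN1 ?ltxx//; lra.
  have dx (s : R) j : is_derive s 1 (fun s => x s ord0 j) (z ord0 j).
    rewrite (_ : (fun s => _) = (fun s => s * z ord0 j + P ord0 j)).
      by apply: is_derive_eq; rewrite /GRing.scale /=; ring.
    by apply/funext => t; rewrite !mxE.
  pose f1 (s : R) := \sum_j G j (x s) * z ord0 j.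
  have x0E : x 0 = P by rewrite /x scale0r add0r.
  apply: (second_order_min (f := fun s => sev e (x s)) (f1 := f1) r0).
  - by move=> s sr; apply: (is_derive_sev_curve e (xn0 s sr) (dx s)).
  - rewrite (_ : f1 = \sum_j (fun s => G j (x s) * z ord0 j)); last first.
      by apply/funext => s; rewrite fct_sumE.
    apply: is_derive_sum => j.
    have xx0 : x 0 != 0 by rewrite x0E.
    have h1 := is_derive_sev_curve (sder j e) xx0 (dx 0).
    apply: (is_derive_eq (is_deriveM h1 (is_derive_cst (z ord0 j) (0 : R) 1))).
    by rewrite /GRing.scale /= x0E /cst /= mulr0 add0r mulrC.
  - move=> s sr; rewrite x0E eF hom_ext_sphere// FP.
    have := F_sphere_itv hF d0 hgrad (normalize_sphere (xn0 s sr)).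
    by case/andP.
(* From [P] the function is $-\cos(ds)$ along the meridian. The curvature of the circle contributes
   a radial derivative of the extension, which is zero. *)
have qw : q w = d%:R ^+ 2.
  have gE (s : R) : gcirc P w s = gcirc p v (s - L).
    rewrite /gcirc /P /w /gcirc /gcirc' cosB sinB cosN sinN.
    by apply/rowP => j; rewrite !mxE; ring.
  have Fg (s : R) : 0 <= s < L -> F (gcirc P w s) = - cos (d%:R * s).
    move=> s0; rewrite gE Fsin; last lra.
    by rewrite mulrBr LE sinBpihalf.
  have gn0 (s : R) : gcirc P w s != 0 by apply/sphere_neq0/gcirc_sphere.
  pose f1 (s : R) := \sum_j G j (gcirc P w s) * gcirc' P w s ord0 j.
  have df (s : R) : is_derive s 1 (fun s => F (gcirc P w s)) (f1 s).
    rewrite (_ : (fun s => _) = (fun s => sev e (gcirc P w s))).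
      by apply: is_derive_sev_curve => // j; exact: is_derive_gcirc.
    by apply/funext => t; rewrite eF hom_ext_sphere//; exact: gcirc_sphere.
  have lin (s : R) : is_derive s 1 (fun s : R => d%:R * s) d%:R.
    by apply: is_derive_eq; rewrite /GRing.scale /=; ring.
  have f1E (s : R) : 0 <= s < L -> f1 s = d%:R * sin (d%:R * s).
    move=> /andP[s0 sL].
    have dc := is_derive_comp1 (is_derive_cos _ : is_derive ((fun s : R => d%:R * s) s) _ _ _) (lin s).
    have r0 : 0 < L - s by lra.
    have -> := is_derive_unique_right r0 (df s) (is_deriveN dc).
      by ring.
    by move=> t t1; rewrite Fg//; lra.
  have g0 : gcirc P w 0 = P by rewrite /gcirc cos0 sin0 scale1r scale0r addr0.
  have g'0 : gcirc' P w 0 = w by rewrite /gcirc' cos0 sin0 oppr0 scale1r scale0r add0r.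
  have d1 : is_derive (0 : R) 1 f1 (q w).
    rewrite (_ : f1 = \sum_j (fun s => G j (gcirc P w s) * gcirc' P w s ord0 j)); last first.
      by apply/funext => s; rewrite fct_sumE.
    have -> : q w = \sum_j ((\sum_k H j k * w ord0 k) * w ord0 j - G j P * P ord0 j).
      rewrite sumrB (_ : \sum_j G j P * P ord0 j = 0) ?subr0//.
      transitivity (\sum_j hom_ext_der j P * P ord0 j); last exact: hom_ext_der_dot.
      by apply: eq_bigr => j _; rewrite GE.
    apply: is_derive_sum => j.
    have h1 := is_derive_sev_curve (sder j e) (gn0 0) (is_derive_gcirc P w 0).
    apply: (is_derive_eq (is_deriveM h1 (is_derive_gcirc' P w 0 j))).
    by rewrite /GRing.scale /= g0 g'0 /G; ring.
  have d2 : is_derive (0 : R) 1 (fun s : R => d%:R * sin (d%:R * s)) (d%:R ^+ 2).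
    have ds := is_derive_comp1 (is_derive_sin _ : is_derive ((fun s : R => d%:R * s) 0) _ _ _) (lin 0).
    apply: (is_derive_eq (is_deriveM (is_derive_cst (d%:R : R) (0 : R) 1) ds)).
    by rewrite /GRing.scale /= /cst /= mulr0 cos0; ring.
  apply: (is_derive_unique_right L0 d1 d2) => s; rewrite add0r; exact: f1E.
have w1 : \sum_j w ord0 j ^+ 2 = 1 by rewrite -ww; apply: eq_bigr => j _; rewrite expr2.
have tr_ge : 0 <= \sum_i \sum_j q (w ord0 j *: ebasis R i - w ord0 i *: ebasis R j).
  by apply: sumr_ge0 => i _; apply: sumr_ge0.
have qE i j : q (w ord0 j *: ebasis R i - w ord0 i *: ebasis R j) =
    w ord0 j ^+ 2 * H i i + w ord0 i ^+ 2 * H j j - H i j * w ord0 j * w ord0 i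
    - H j i * w ord0 i * w ord0 j.
  pose hz z : V := \row_l \sum_k H l k * z ord0 k.
  have hzE k i' j' : hz (k *: ebasis R i' - j' *: ebasis R j) =
      k *: hz (ebasis R i') - j' *: hz (ebasis R j).
    apply/rowP => l; rewrite !mxE !mulr_sumr -sumrB; apply: eq_bigr => m _.
    by rewrite !mxE; ring.
  have hb l m : dot (hz (ebasis R l)) (ebasis R m) = H m l.
    have -> : H m l = (\row_k H m k) ord0 l :> R by rewrite mxE.
    rewrite dotC ebasis_dot -(ebasis_dot l) dotC /hz [LHS]mxE.
    by apply: eq_bigr => k _; rewrite !mxE.
  have -> : forall z, q z = dot (hz z) z.
    by move=> z; apply: eq_bigr => l _; rewrite mxE.
  by rewrite hzE !dotE !hb; ring.
have sumE : \sum_i \sum_j q (w ord0 j *: ebasis R i - w ord0 i *: ebasis R j) =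
    2 * (\sum_j H j j) - 2 * q w.
  under eq_bigr do under eq_bigr do rewrite qE.
  under eq_bigr do rewrite 2!sumrB big_split /=.
  rewrite 2!sumrB big_split /=.
  have -> : \sum_i \sum_j w ord0 j ^+ 2 * H i i = \sum_j H j j.
    by apply: eq_bigr => i _; rewrite -mulr_suml w1 mul1r.
  have -> : \sum_i \sum_j w ord0 i ^+ 2 * H j j = \sum_j H j j.
    by rewrite exchange_big /=; apply: eq_bigr => i _; rewrite -mulr_suml w1 mul1r.
  have -> : \sum_i \sum_j H i j * w ord0 j * w ord0 i = q w.
    by apply: eq_bigr => i _; rewrite -mulr_suml.
  have -> : \sum_i \sum_j H j i * w ord0 i * w ord0 j = q w.
    by rewrite exchange_big /=; apply: eq_bigr => i _; rewrite -mulr_suml.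
  ring.
rewrite -(@pmulr_rgt0 _ (d%:R ^+ 2)) ?exprn_gt0// -trE.
have : 0 < d%:R ^+ 2 :> R by rewrite exprn_gt0.
move: tr_ge; rewrite sumE qw; lra.
Qed.

End Invariant.

(** * Transfer of the branch to the profile variable *)

Lemma sph_lap_cst (R : realType) (m : nat) (w : 'rV[R]_m -> R) (k : R) x :
  (forall x, on_sphere x -> w x = k) -> on_sphere x -> sph_lap w x = 0.
Proof.
move=> wk xS; have x0 := sphere_neq0 xS.
have P0 j y : y != 0 -> pderiv (hom_ext w) j y = 0.
  move=> y0; rewrite /pderiv.
  have nE : \near y, cst k y = hom_ext w y.
    by apply: filterS (near_neq0 y0) => z z0; rewrite /hom_ext wk//; exact: normalize_sphere.
  by have [_ ->] := near_eq_is_derive nE (is_derive_cst k y (ebasis R j)).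
rewrite /sph_lap /lap big1// => j _.
have nE : \near x, cst 0 x = pderiv (hom_ext w) j x.
  by apply: filterS (near_neq0 x0) => z z0; rewrite P0.
by have [_ E] := near_eq_is_derive nE (is_derive_cst (0 : R) x (ebasis R j)); rewrite {1}/pderiv E.
Qed.

Unset Implicit Arguments.

Theorem theorem1p2 (R : realType) (n : nat) (q : R) (d : nat) (c : R)
  (F : 'rV[R]_n.+1 -> R) (i : nat)
  (u : R -> 'rV[R]_n.+1 -> R) (lam : R -> R) (eps : R)
  (w : 'rV[R]_n.+1 -> R) :
  (3 <= n)%N -> 1 < q -> CM_poly d c F -> c <= 0 -> (1 <= i)%N ->
  0 < eps ->
  (* a branch of positive f-invariant classical solutions *)
  (forall s : R, `|s| < eps ->
     [/\ f_invariant F (u s), C2_sphere (u s), 0 < lam s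
       & forall x, on_sphere x ->
           0 < u s x /\
           - sph_lap (u s) x + lam s * u s x = lam s * (u s x `^ q)]) ->
  (* bifurcating from (1, lambda_di) *)
  (forall x, on_sphere x -> u 0 x = 1) ->
  lam 0 = lambda_di n d i q ->
  (* nontrivial for s <> 0 *)
  (forall s : R, `|s| < eps -> s != 0 ->
     exists x, on_sphere x /\ u s x != 1) ->
  (* du/ds(0) = w is a nonzero f-invariant eigenfunction, eigenvalue di(n+di-1) *)
  sph_deriv0 u w -> f_invariant F w -> C2_sphere w ->
  (exists x, on_sphere x /\ w x != 0) ->
  (forall x, on_sphere x -> - sph_lap w x = - mu_di n d i * w x) ->
  derivable lam 0 1 ->
  (c = 0 -> (derive1 lam 0 = 0 <-> odd i)) /\
  (c != 0 -> derive1 lam 0 != 0).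
Proof.
move=> n3 q1 [d0 hF hg hl] c0 i1 eps0 branch u0 lam0 _ du wF wC wn0 weig dlam.
have n0 : (0 < n)%N by apply: leq_trans n3.
have D0 : 0 < d%:R :> R by rewrite ltr0n.
have nR : 3 <= n%:R :> R by rewrite ler_nat.
have iR : 1 <= i%:R :> R by rewrite ler1n.
have hgrad x : on_sphere x -> gradsq F x = d%:R ^+ 2.
  by move=> xS; rewrite hg xS expr1n mulr1.
have hlap x : on_sphere x -> lap F x = c * d%:R ^+ 2 / 2.
  by move=> xS; rewrite hl ?sphere_neq0// enorm1// powR1 mulr1.
have muE : mu_di n d i = - (d%:R * i%:R * (n%:R + d%:R * i%:R - 1)) :> R by rewrite /mu_di natrM.
have mu0 : mu_di n d i < 0 :> R.
  rewrite muE oppr_lt0 !mulr_gt0//; first lra.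
  have : 0 < d%:R * i%:R :> R by rewrite mulr_gt0//; lra.
  lra.
(* [CM_poly] admits $F=-|x|^2$, constant on the sphere. Such cases are excluded by [w]: it would be
   constant, with zero Laplacian, against its nonzero eigenvalue. *)
have Fnc : exists x y, [/\ on_sphere x, on_sphere y & F x != F y].
  apply: contrapT => H; have [x [xS wx]] := wn0.
  have [phi wE] := wF.
  have wk y : on_sphere y -> w y = w x.
    move=> yS; rewrite !wE//; congr phi; apply/eqP/negPn/negP => ne.
    by apply: H; exists y, x.
  have := weig x xS; rewrite (sph_lap_cst wk xS) oppr0 => /esym/eqP.
  by rewrite mulf_eq0 oppr_eq0 (lt_eqF mu0) (negbTE wx).
have [p [v [pp vv pv Fsin]]] := meridian hF d0 n0 hgrad Fnc.
pose a : R := (n%:R + d%:R - 1) / d%:R; pose b : R := c / 2.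
have a1 : 1 < a by rewrite /a ltr_pdivlMr// mul1r; lra.
have ab : 0 < a + b := exponent_gt0 hF d0 hgrad hlap pp vv pv Fsin.
have b0 : b <= 0 by rewrite /b; lra.
(* The lower bound is the trace inequality; the upper one comes from the sign of [c]. *)
have ba : `|b| < a by rewrite ltr_norml; lra.
pose P := prof d p v.
have PS t : on_sphere (gcirc p v (asin t / d%:R)) by exact: gcirc_sphere.
have PF (t : R) : -1 < t < 1 -> F (gcirc p v (asin t / d%:R)) = t.
  by move=> /andP[t1 t2]; rewrite (prof_point d0 Fsin)//; lra.
have lapE u' phi1 phi2 (t : R) : f_invariant F u' -> profile (P u') phi1 phi2 -> -1 < t < 1 ->
    sph_lap u' (gcirc p v (asin t / d%:R)) = d%:R ^+ 2 * jop a b phi1 phi2 t.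
  move=> uF [dphi _ _] t1.
  have := sph_lap_profile hF d0 hgrad hlap
    (prof_invariant hF d0 hgrad pp vv pv Fsin uF) dphi (PS t).
  by rewrite PF// => /(_ t1).
have [rho1 [rho2 prho]] := prof_profile hF d0 hgrad pp vv pv Fsin wF wC.
have rn0 := prof_neq0 hF d0 hgrad pp vv pv Fsin wF wC wn0.
have jE : d%:R ^+ 2 * jac_eig a i = - mu_di n d i.
  by rewrite /jac_eig /a muE; field; rewrite gt_eqF.
have L0E : lambda_di n d i q * (q - 1) = d%:R ^+ 2 * jac_eig a i.
  by rewrite jE /lambda_di divfK// subr_eq0 gt_eqF.
have dl : is_derive (0 : R) 1 lam (derive1 lam 0) by rewrite derive1E; exact: derivableP.
have D2 : 0 < d%:R ^+ 2 :> R by rewrite exprn_gt0.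
have := @branch_slope R a b q (d%:R ^+ 2) (lambda_di n d i q) (derive1 lam 0) eps i lam
  (fun s => P (u s)) (P w) rho1 rho2 a1 ba b0 i1 q1 D2 eps0 dl lam0 L0E.
have cb : (b == 0) = (c == 0) by rewrite /b mulf_eq0 invr_eq0 pnatr_eq0 orbF.
rewrite cb => H; have {}H : if c == 0 then (derive1 lam 0 == 0) = odd i else derive1 lam 0 != 0.
  apply: H => //.
  - move=> s /andP[_ seps]; have [uF uC _ ueq] := branch s seps.
    have [phi1 [phi2 pphi]] := prof_profile hF d0 hgrad pp vv pv Fsin uF uC.
    exists phi1, phi2; split=> // t t1.
    by rewrite -(lapE _ _ _ _ uF pphi t1); have [_] := ueq _ (PS t).
  - move=> e e0; have [del del0 Hd] := du e e0; exists del => // s sd t t1.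
    by have := Hd s sd _ (PS t); rewrite u0.
  - move=> t t1; have := weig _ (PS t); rewrite (lapE _ _ _ _ wF prho t1) => E.
    apply: (mulfI (lt0r_neq0 D2)); rewrite mulrA mulrN jE opprK.
    by apply: oppr_inj; rewrite E mulNr.
split=> [cz|cn].
  by move: H; rewrite cz eqxx => <-; split=> [->|/eqP].
by move: H; rewrite (negbTE cn).
Qed.
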